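(* Fix $T>0$ and let $B$ be the complex Banach space of continuous functions $z:[0,T]\to\mathbb C$ with $z(0)=0$, equipped with the supremum norm. There exists a $B$-valued Gaussian field $Z$ such that the stochastic process $W=\{W_t:t\in[0,T]\}$ given by $W_t:=\int_{[0,T]} Z\,d\delta_t$ is the complex Brownian motion.
   Context: $\delta_t$ is the Dirac point measure at $t$, so $W_t(\omega)=Z(\omega)(t)$. A $B$-valued Gaussian field is a Borel measurable map $Z$ from a probability space to $B$ such that $f(Z)$ is a complex Gaussian random variable (real and imaginary parts jointly Gaussian, degenerate cases allowed) for every $f\in B'$. A complex Brownian motion on $[0,T]$ is a complex-valued process $W$ that almost surely has continuous paths and starts in zero, has independent increments, and whose increments $W_t-W_s$ ($0\le s<t\le T$) are proper complex Gaussians with variance $\mathbb E|W_t-W_s|^2=t-s$ (proper: mean zero and $\mathbb E[(W_t-W_s)^2]=0$). *)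

(* Defs.v *)
From HB Require Import structures.
From mathcomp Require Import all_boot all_order all_algebra.
From mathcomp Require Import complex lra.
From mathcomp Require Import all_classical all_reals all_analysis.
Set Implicit Arguments.
Unset Strict Implicit.
Unset Printing Implicit Defensive.
Import Order.TTheory GRing.Theory Num.Theory.
Import numFieldNormedType.Exports.
Import ComplexField.Normc.
Local Open Scope classical_set_scope.
Local Open Scope ring_scope.

(* The library equips [K^o] (for a numeric field [K]) with its norm topology;
   this exports it to the carrier [R[i]] itself. *)
HB.instance Definition _ (R : realType) := NormedModule.copy R[i] R[i]^o.

Section complex_facts.
Variable R : realType.
Implicit Types x y : R[i].

Lemma normE x : `|x| = (normc x)%:C%C.
Proof. by []. Qed.

Lemma normc_ge0 x : 0 <= normc x.
Proof. by case: x => a b /=; rewrite sqrtr_ge0. Qed.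

Lemma normc_distC x y : normc (x - y) = normc (y - x).
Proof. by rewrite -(normcN (x - y : Rcomplex R)) opprB. Qed.

Lemma normc_dist x y : `|normc x - normc y| <= normc (x - y).
Proof.
have H (u v : R[i]) : normc u - normc v <= normc (u - v).
  rewrite lerBlDr; have := le_normcD (u - v : Rcomplex R) v.
  by rewrite subrK.
by rewrite ler_norml H andbT lerNl opprB normc_distC.
Qed.

Lemma gt0_complex (e : R[i]) : 0 < e -> exists2 r : R, 0 < r & e = r%:C%C.
Proof. by case: e => a b; rewrite ltcE/= => /andP[/eqP -> a0]; exists a. Qed.

Lemma complex_near (a b e : R) (z : R[i]) :
  `|a - complex.Re z| < e / 2 -> `|b - complex.Im z| < e / 2 ->
  `|(a +i* b)%C - z| < e%:C%C.
Proof.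
case: z => c d /= ac bd; rewrite ltcR [ltRHS]splitr.
apply: (le_lt_trans _ (ltrD ac bd)).
rewrite -[leRHS]ger0_norm ?addr_ge0// -sqrtr_sqr ler_wsqrtr// [leRHS]sqrrD.
by rewrite !real_normK ?num_real// addrAC lerDl mulrn_wge0// mulr_ge0.
Qed.

Lemma complex_complete (F : set_system R[i]) :
  ProperFilter F -> cauchy F -> cvg F.
Proof.
move=> FF /cauchyP cF.
have part (p : R[i] -> R) : (forall x y, `|p x - p y| <= normc (x - y)) ->
    cvg (p @ F).
  move=> pd; apply/cauchy_cvgP/cauchyP => e e0.
  have e0c : 0 < e%:C%C :> R[i] by rewrite (@ltcR R 0).
  have [x Fx] := cF _ e0c; exists (p x).
  suff : F (p @^-1` ball (p x) e) by [].
  apply: filterS Fx => y; rewrite -!ball_normE /= => xye.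
  by apply: (le_lt_trans (pd _ _)); rewrite -ltcR; exact: xye.
have cRe : cvg (@complex.Re R @ F).
  apply: part => -[a b] [c d] /=; rewrite -sqrtr_sqr ler_wsqrtr//.
  by rewrite lerDl sqr_ge0.
have cIm : cvg (@complex.Im R @ F).
  apply: part => -[a b] [c d] /=; rewrite -sqrtr_sqr ler_wsqrtr//.
  by rewrite lerDr sqr_ge0.
apply/cvg_ex; exists (Complex (lim (@complex.Re R @ F)) (lim (@complex.Im R @ F))).
apply/cvgrPdist_lt => _ /gt0_complex[e e0 ->].
have e20 : 0 < e / 2 by rewrite divr_gt0.
move/cvgrPdist_lt: cRe => /(_ _ e20) cRe.
move/cvgrPdist_lt: cIm => /(_ _ e20) cIm.
near=> z.
by apply: complex_near; near: z.
Unshelve. all: by end_near. Qed.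

End complex_facts.

Section path_space.
Variables (R : realType) (T : R).

(* A continuous function on [0, T] is encoded by its extension by zero to [R],
   so that two paths are equal iff they agree on [0, T]. *)
Definition is_path : {pred R -> R[i]} :=
  mem [set z : R -> R[i] | [/\ {within `[0, T], continuous z}, z 0 = 0 &
                            forall t, ~~ (t \in `[0, T]) -> z t = 0]].

Record path_space := MkPath { path_val :> R -> R[i] ; _ : path_val \in is_path }.

HB.instance Definition _ := [isSub for path_val].
HB.instance Definition _ := [Choice of path_space by <:].

Lemma is_path_submod : submod_closed is_path.
Proof.
split=> [|a u v].
  rewrite inE; split=> // t; apply: cvg_cst.
rewrite !inE => -[cu u0 uo] [cv v0 vo]; split.
- move=> t; apply: cvgD; last exact: cv.
  by apply: cvgZr; exact: cu.
- suff : a *: u 0 + v 0 = 0 by [].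
  by rewrite u0 v0 scaler0 addr0.
- move=> t tT; suff : a *: u t + v t = 0 by [].
  by rewrite uo// vo// scaler0 addr0.
Qed.

HB.instance Definition _ :=
  GRing.isSubmodClosed.Build _ _ is_path is_path_submod.
HB.instance Definition _ := [SubChoice_isSubLmodule of path_space by <:].

Implicit Type z : path_space.

Definition sup_norm z : R := sup [set normc (z t) | t in `[0, T]].

Lemma path_out z t : ~~ (t \in `[0, T]) -> z t = 0.
Proof. by move: z => [z zP]; have := zP; rewrite inE => -[_ _]; apply. Qed.

Lemma path_continuous z : {within `[0, T], continuous z}.
Proof. by move: z => [z zP]; have := zP; rewrite inE => -[]. Qed.

Lemma path0 z : z 0 = 0.
Proof. by move: z => [z zP]; have := zP; rewrite inE => -[]. Qed.

Lemma path_bounded z : has_ubound [set normc (z t) | t in `[0, T]].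
Proof.
have cz : {within `[0, T], continuous (fun t => normc (z t))}.
  move=> t; apply/cvgrPdist_lt => e e0.
  have e0c : 0 < e%:C%C :> R[i] by rewrite (@ltcR R 0).
  have /cvgrPdist_lt/(_ _ e0c) := @path_continuous z t.
  apply: filterS => s zts; apply: (le_lt_trans (normc_dist _ _)).
  by rewrite -ltcR; exact: zts.
have [M [Mr HM]] := compact_bounded
  (continuous_compact cz (segment_compact (a := 0) (b := T))).
exists (M + 1) => _ [t tT <-].
have := HM (M + 1); rewrite ltrDl ltr01 => /(_ isT (normc (z t))) /=.
by rewrite ger0_norm ?normc_ge0//; apply; exists t.
Qed.

Lemma sup_norm_ge0 z : 0 <= sup_norm z.
Proof.
rewrite /sup_norm.
have [->|/set0P[_ [t tT _]]] := eqVneq [set normc (z t) | t in `[0, T]] set0.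
  by rewrite sup0.
apply: (le_trans (normc_ge0 (z t))).
by apply: ub_le_sup; [exact: path_bounded | exists t].
Qed.

Lemma normc_le_sup_norm z t : normc (z t) <= sup_norm z.
Proof.
have [tT|tT] := boolP (t \in `[0, T]); last first.
  by rewrite path_out// normc0 sup_norm_ge0.
by apply: ub_le_sup; [exact: path_bounded | exists t].
Qed.

Lemma sup_norm_le z M : 0 <= M ->
  (forall t, t \in `[0, T] -> normc (z t) <= M) -> sup_norm z <= M.
Proof.
move=> M0 zM; rewrite /sup_norm.
have [->|/set0P nz] := eqVneq [set normc (z t) | t in `[0, T]] set0.
  by rewrite sup0.
by apply: ge_sup => // _ [t tT <-]; exact: zM.
Qed.

Lemma ler_sup_normD z1 z2 :
  (sup_norm (z1 + z2))%:C%C <= (sup_norm z1)%:C%C + (sup_norm z2)%:C%C :> R[i].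
Proof.
rewrite -rmorphD lecR; apply: sup_norm_le; first by rewrite addr_ge0 ?sup_norm_ge0.
move=> t _; apply: (le_trans (le_normcD (z1 t : Rcomplex R) (z2 t))).
by rewrite lerD ?normc_le_sup_norm.
Qed.

Lemma sup_normZ (l : R[i]) z :
  (sup_norm (l *: z))%:C%C = `|l| * (sup_norm z)%:C%C :> R[i].
Proof.
rewrite normE -rmorphM; congr (_ %:C)%C; apply/eqP; rewrite eq_le.
have le_sZ (k : R[i]) (y : path_space) :
    sup_norm (k *: y) <= normc k * sup_norm y.
  apply: sup_norm_le; first by rewrite mulr_ge0 ?normc_ge0 ?sup_norm_ge0.
  move=> t _; suff : normc (k * y t) <= normc k * sup_norm y by [].
  by rewrite normcM ler_wpM2l ?normc_ge0 ?normc_le_sup_norm.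
apply/andP; split; first exact: le_sZ.
have [->|l0] := eqVneq l 0; first by rewrite normc0 mul0r sup_norm_ge0.
have nl0 : 0 < normc l.
  by rewrite lt_def normc_ge0 andbT; apply: contra_neq l0 => /eq0_normc.
rewrite -ler_pdivlMl// -normcV.
by apply: le_trans (le_sZ _ _); rewrite scalerA mulVf// scale1r.
Qed.

Lemma sup_norm0_eq0 z : (sup_norm z)%:C%C = 0 :> R[i] -> z = 0.
Proof.
move=> [z0]; apply/val_inj/funext => t; suff : z t = 0 by [].
apply/eq0_normc/eqP; rewrite eq_le normc_ge0 andbT.
by rewrite (le_trans (normc_le_sup_norm z t))// z0.
Qed.

(* The norm of a normed module over [R[i]] is itself [R[i]]-valued. *)
HB.instance Definition _ := Lmodule_isNormed.Build R[i] path_space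
  ler_sup_normD sup_normZ sup_norm0_eq0.

Lemma path_normE z : `|z| = (sup_norm z)%:C%C.
Proof. by []. Qed.

Lemma path_complete (F : set_system path_space) :
  ProperFilter F -> cauchy F -> cvg F.
Proof.
move=> FF /cauchyP cF.
have cvgt t : cvg ((fun z : path_space => z t) @ F).
  apply: complex_complete; apply/cauchyP => e e0.
  have [z0 Fz] := cF _ e0; exists (z0 t).
  suff : F ((fun z : path_space => z t) @^-1` ball (z0 t) e) by [].
  apply: filterS Fz => z; rewrite -!ball_normE /= => zz.
  apply: (le_lt_trans _ zz); rewrite path_normE lecR.
  exact: (normc_le_sup_norm (z0 - z) t).
pose l t := lim ((fun z : path_space => z t) @ F).
have unif (e : R) : 0 < e ->
    \forall z \near F, forall t, normc (l t - (z : path_space) t) <= e.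
  move=> e0.
  have e20 : 0 < (e / 2)%:C%C :> R[i] by rewrite (@ltcR R 0) divr_gt0.
  have e40 : 0 < (e / 2 / 2)%:C%C :> R[i] by rewrite (@ltcR R 0) !divr_gt0.
  have [z0 Fz] := cF _ e40.
  have z0P z t : ball z0 (e / 2 / 2)%:C%C z -> normc (z0 t - z t) <= e / 2 / 2.
    rewrite -ball_normE /= path_normE ltcR => /ltW; apply: le_trans.
    exact: (normc_le_sup_norm (z0 - z) t).
  apply: (filterS _ Fz) => z zz t.
  have /cvgrPdist_lt/(_ _ e20) Fl := cvgt t.
  have [y [zy ly]] := filter_ex (@filterI _ F _ _ _ Fz Fl).
  rewrite -(subrKA (y t)) [leRHS]splitr.
  apply: (le_trans (le_normcD (l t - y t : Rcomplex R) (y t - z t))).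
  rewrite lerD//; first by rewrite -lecR; exact: ltW ly.
  rewrite -(subrKA (z0 t)) [leRHS]splitr.
  apply: (le_trans (le_normcD (y t - z0 t : Rcomplex R) (z0 t - z t))).
  by rewrite lerD ?z0P// normc_distC z0P.
have l_eq0 t : (forall z : path_space, z t = 0) -> l t = 0.
  move=> zt0; rewrite /l (_ : (fun z : path_space => z t) = cst 0).
    by apply: cvg_lim => //; exact: cvg_cst.
  by apply/funext => z; rewrite zt0.
have lP : l \in is_path.
  rewrite inE; split; [|exact/l_eq0/path0|by move=> t tT; apply/l_eq0 => z; exact: path_out].
  move=> t; apply/cvgrPdist_lt => _ /gt0_complex[e e0 ->].
  have e30 : 0 < e / 2 / 2 by rewrite !divr_gt0.
  have e3c : 0 < (e / 2)%:C%C :> R[i] by rewrite (@ltcR R 0) divr_gt0.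
  have [z zl] := filter_ex (unif _ e30).
  have /cvgrPdist_lt/(_ _ e3c) := @path_continuous z t.
  apply: filterS => s zts.
  suff : normc (l t - l s) < e by rewrite -ltcR.
  rewrite -(subrKA (z t)) -(subrKA (z s) (z t)).
  apply: (le_lt_trans (le_normcD (l t - z t : Rcomplex R) _)).
  apply: (le_lt_trans (lerD (zl t) (le_normcD (z t - z s : Rcomplex R) (z s - l s)))).
  have zs : normc (z t - z s) < e / 2 by rewrite -ltcR; exact: zts.
  have := zl s; rewrite normc_distC => ls; lra.
apply/cvg_ex; exists (MkPath lP); apply/cvgrPdist_le => _ /gt0_complex[e e0 ->].
apply: filterS (unif _ e0) => z zl; rewrite path_normE lecR.
by apply: sup_norm_le => [|t _]; [exact: ltW|exact: zl].
Qed.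

HB.instance Definition _ := Uniform_isComplete.Build path_space path_complete.

End path_space.

Definition borel (X : ptopologicalType) := g_sigma_algebraType (@open X).

Definition cintegral d (X : measurableType d) (R : realType)
    (mu : {measure set X -> \bar R}) (D : set X) (f : X -> R[i]) : R[i] :=
  ((\int[mu]_(x in D) complex.Re (f x)) +i*
   (\int[mu]_(x in D) complex.Im (f x)))%C.

Section gaussian_processes.
Context {d : measure_display} {Omega : measurableType d} {R : realType}.
Variable P : probability Omega R.

(* The degenerate case is a separate Dirac disjunct because the library's
   [normal_prob m 0] is the uniform law on [0, 1]. *)
Definition gaussian (X : Omega -> R) :=
  measurable_fun setT X /\
  exists m : R,
    (forall A : set R, measurable A -> P (X @^-1` A) = \d_m A) \/
    (exists2 s : R, 0 < s &
       forall A : set R, measurable A -> P (X @^-1` A) = normal_prob m s A).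

Definition complex_gaussian (X : Omega -> R[i]) :=
  measurable_fun setT (X : Omega -> borel R[i]) /\
  forall a b : R,
    gaussian (fun w => a * complex.Re (X w) + b * complex.Im (X w)).

Definition cexpectation (X : Omega -> R[i]) : R[i] := cintegral P setT X.

Definition proper_complex_gaussian (X : Omega -> R[i]) (v : R) :=
  [/\ complex_gaussian X,
      cexpectation X = 0,
      cexpectation (fun w => X w ^+ 2) = 0 &
      cexpectation (fun w => `|X w| ^+ 2) = v%:C%C].

Definition gaussian_field (B : normedModType R[i]) (Z : Omega -> B) :=
  measurable_fun setT (Z : Omega -> borel B) /\
  forall f : {linear B -> R[i]}, continuous f ->
    complex_gaussian (fun w => f (Z w)).

(* Taking some [A i] to be [setT] yields the product rule for subfamilies. *)
Definition mutually_independent (I : finType) (X : I -> Omega -> R[i]) :=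
  forall A : I -> set (borel R[i]), (forall i, measurable (A i)) ->
    P (\bigcap_(i in [set: I]) X i @^-1` A i) =
    (\prod_(i : I) P (X i @^-1` A i))%E.

Definition independent_increments (T : R) (W : R -> Omega -> R[i]) :=
  forall (n : nat) (t : nat -> R),
    0 <= t 0%N -> t n <= T -> (forall i, (i < n)%N -> t i <= t i.+1) ->
    mutually_independent (fun (i : 'I_n) w => W (t i.+1) w - W (t i) w).

(* [W] is indexed by all of [R]: only the values [W t] with
   [t \in `[0, T]] are constrained. *)
Definition complex_brownian_motion (T : R) (W : R -> Omega -> R[i]) :=
  [/\ forall t, t \in `[0, T] ->
        measurable_fun setT (W t : Omega -> borel R[i]),
      {ae P, forall w, {within `[0, T], continuous (fun t => W t w)} /\
                       W 0 w = 0},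
      independent_increments T W &
      forall s t, 0 <= s -> s < t -> t <= T ->
        proper_complex_gaussian (fun w => W t w - W s w) (t - s)].

End gaussian_processes.

(* Main.v *)
Require Import Defs.
From HB Require Import structures.
From mathcomp Require Import all_boot all_order all_algebra.
From mathcomp Require Import complex.
From mathcomp Require Import all_classical all_reals all_analysis.
From mathcomp Require Import measurable_realfun ring lra.
Import Order.TTheory GRing.Theory Num.Theory.
Import numFieldNormedType.Exports.
Local Open Scope classical_set_scope.
Local Open Scope ring_scope.
Set Implicit Arguments.
Unset Strict Implicit.
Unset Printing Implicit Defensive.
Import ComplexField.Normc.

(** Everything rests on a probability space that reproduces itself: a space
    [S] of law [Q], a standard normal variable [G] on it, and maps
    [l, r : S -> S] such that [l s] and [r s] are independent, both of law
    [Q], with [G (l s) + G (r s) = sqrt 2 * G s] ([splits]).  A point [s] is a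
    source of randomness for a path on [[0, T]]; [G s] is the endpoint of that
    path, and [l s], [r s] are the sources of its two halves, each rescaled to
    the whole interval.  Such a space exists ([splits_exists]): from [G s] and
    one further independent standard normal variable, the reflection
    [(x, y) |-> ((x + y) / sqrt 2, (x - y) / sqrt 2)] produces the endpoints of
    the two halves.  They are again independent and standard normal, because
    the density of a pair of independent standard normal variables depends only
    on [x ^ 2 + y ^ 2] ([gauss_reflect_rect]).  The further variable, and all
    those needed later, are read off from a sequence of fair coins, which
    itself consists of the binary digits of a uniform number.

    Paul Levy's polygonal approximations then need no explicit basis of
    functions.  The approximation at level [n + 1] from [s] runs through the
    one at level [n] from [l s], then through the one at level [n] from [r s],
    both at double speed and divided by [sqrt 2] ([levy]).  Two consecutive
    approximations have the same endpoint, so the distance between them is the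
    larger of the distances between their halves, divided by [sqrt 2]
    ([levy_step]).  A fourth power turns that maximum into at most a sum of
    two terms and the factor into [1 / 4], so the fourth moment of the
    distance is at least halved at each level ([dyadic_bound_moment]).  By
    Markov's inequality and the Borel-Cantelli lemma the distances almost
    surely end up below a geometric sequence, and the approximations converge
    uniformly to a random path ([limit_path]).

    The laws follow the same recursion.  A continuous linear functional of the
    approximation at level [n + 1] is a sum of two functionals of independent
    approximations at level [n], hence normal, and its variance is
    nondecreasing and bounded in [n]; so the functional of the limit is normal
    ([limit_path_normal_law]), which makes the random path a Gaussian field
    without any description of the dual space.  For the increments the
    recursion is run once more with step functions in place of polygons
    ([walk]).  Whatever the times, the increments of a step function over
    successive intervals are exactly independent at every level
    ([walk_indep]), and their variances are known ([walk_normal_law]).  Step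
    functions and polygons have the same limit, and independence and normality
    pass to almost sure limits ([joint_law_lim]).

    The complex field is [sqrt (T / 2) * (X s + i * X s')], with [X] the
    random path and [s], [s'] independent.  Integrating against the point
    measure at [t] evaluates it at [t]. *)

(** * Joint laws and almost sure limits *)

Definition rectangles d1 d2 (V1 : measurableType d1) (V2 : measurableType d2) :
    set (set (V1 * V2)) :=
  [set A `*` B | A in @measurable _ V1 & B in @measurable _ V2].
Arguments rectangles {d1 d2} V1 V2 _.

Lemma rectanglesP d1 d2 (V1 : measurableType d1) (V2 : measurableType d2) :
  [/\ setI_closed (rectangles V1 V2), rectangles V1 V2 setT,
      rectangles V1 V2 `<=` measurable & measurable `<=` <<s rectangles V1 V2 >>].
Proof.
split.
- move=> _ _ [A mA [B mB <-]] [A' mA' [B' mB' <-]].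
  rewrite -setXI; exists (A `&` A'); first exact: measurableI.
  by exists (B `&` B') => //; exact: measurableI.
- by exists setT => //; exists setT => //; rewrite setXTT.
- by move=> _ [A mA [B mB <-]]; exact: measurableX.
- by rewrite measurable_prod_measurableType.
Qed.

Section joint_laws.
Context {R : realType}.

(** The variables [X i] are jointly distributed as independent variables with the
    laws of the [Y i].  With [Y = X] this is mutual independence of the [X i];
    with a single index it says that [X] and [Y] have the same law.  Keeping
    the two families apart lets one limit theorem serve both purposes. *)
Definition joint_law (I : finType) d1 d2 d (O1 : measurableType d1)
    (O2 : measurableType d2) (V : measurableType d)
    (P : probability O1 R) (X : I -> O1 -> V)
    (P' : probability O2 R) (Y : I -> O2 -> V) :=
  forall A : I -> set V, (forall i, measurable (A i)) ->
  P (\bigcap_(i in [set: I]) X i @^-1` A i) = (\prod_i P' (Y i @^-1` A i))%E.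

Lemma preimage_measurable d1 d2 (T1 : measurableType d1) (T2 : measurableType d2)
    (f : T1 -> T2) (A : set T2) :
  measurable_fun setT f -> measurable A -> measurable (f @^-1` A).
Proof. by move=> mf mA; rewrite -[X in measurable X]setTI; exact: mf. Qed.

Lemma bigcap_preimage_measurable (I : finType) d1 d (O1 : measurableType d1)
    (V : measurableType d) (X : I -> O1 -> V) (A : I -> set V) :
  (forall i, measurable_fun setT (X i)) -> (forall i, measurable (A i)) ->
  measurable (\bigcap_(i in [set: I]) X i @^-1` A i).
Proof.
move=> mX mA; apply: fin_bigcap_measurable => [|i _]; first exact: finite_finset.
exact: preimage_measurable.
Qed.

(** Both sides are finite measures in [B]: the law of [X] restricted to the event
    [E], and a multiple of the law of [Y]. *)
Lemma event_pi_lambda d1 d2 d (O1 : measurableType d1)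
    (O2 : measurableType d2) (V : measurableType d)
    (P : probability O1 R) (P' : probability O2 R)
    (X : O1 -> V) (Y : O2 -> V) (G : set (set V)) (E : set O1) :
  measurable_fun setT X -> measurable_fun setT Y -> measurable E ->
  setI_closed G -> G setT -> G `<=` measurable -> measurable `<=` <<s G >> ->
  (forall B, G B -> P (X @^-1` B `&` E) = (P' (Y @^-1` B) * P E)%E) ->
  forall B, measurable B -> P (X @^-1` B `&` E) = (P' (Y @^-1` B) * P E)%E.
Proof.
move=> mX mY mE GI GT Gm mG H B mB.
have c0 : 0 <= fine (P E) by exact: fine_ge0.
have @m1 : {measure set V -> \bar R} by exact: (pushforward (mrestr P mE) X).
have @nu : {measure set V -> \bar R} by exact: (pushforward P' Y).
pose m2 : {measure set V -> \bar R} := mscale (NngNum c0) nu.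
have PE : (fine (P E))%:E = P E by rewrite fineK// fin_num_measure.
have m2E C : m2 C = (P' (Y @^-1` C) * P E)%E.
  by transitivity ((fine (P E))%:E * P' (Y @^-1` C))%E => //; rewrite PE muleC.
rewrite -m2E -/(m1 B).
apply: (g_sigma_algebra_measure_unique G Gm (fun=> setT) _ _ m1 m2) => //.
- by rewrite bigcup_const//; exists 0%N.
- by move=> A GA; rewrite -[RHS]/(m2 A) m2E -H.
- by move=> _; rewrite /m1/= /pushforward/mrestr/= setTI ltey_eq fin_num_measure.
- exact: mG.
Qed.

(** The sets of the pi-system are replaced by arbitrary measurable sets one index
    at a time, the other indices forming the fixed event of
    [event_pi_lambda]. *)
Lemma joint_law_pi_lambda (I : finType) d1 d2 d (O1 : measurableType d1)
    (O2 : measurableType d2) (V : measurableType d)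
    (P : probability O1 R) (X : I -> O1 -> V)
    (P' : probability O2 R) (Y : I -> O2 -> V) (G : set (set V)) :
  (forall i, measurable_fun setT (X i)) ->
  (forall i, measurable_fun setT (Y i)) ->
  setI_closed G -> G setT -> G `<=` measurable -> measurable `<=` <<s G >> ->
  (forall A : I -> set V, (forall i, G (A i)) ->
   P (\bigcap_(i in [set: I]) X i @^-1` A i) = (\prod_i P' (Y i @^-1` A i))%E) ->
  joint_law P X P' Y.
Proof.
move=> mX mY GI GT Gm mG H A mA.
have key (s : seq I) (B : I -> set V) :
    (forall i, if i \in s then measurable (B i) else G (B i)) ->
   P (\bigcap_(i in [set: I]) X i @^-1` B i) = (\prod_i P' (Y i @^-1` B i))%E.
  elim: s B => [|j s IH] B HB; first by apply: H => i; have := HB i.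
  have mB i : measurable (B i).
    by have := HB i; case: ifP => // _; exact: Gm.
  pose E := \bigcap_(i in [set i | i != j]) X i @^-1` B i.
  have mE : measurable E.
    apply: fin_bigcap_measurable => [|i _]; first exact: finite_finset.
    exact: preimage_measurable.
  pose upd C i := if i == j then C else B i.
  have capE C : \bigcap_(i in [set: I]) X i @^-1` upd C i = X j @^-1` C `&` E.
    apply/seteqP; split => [w h|w [h1 h2] i _].
      split; first by have := h j Logic.I; rewrite /upd eqxx.
      by move=> i /= ij; have := h i Logic.I; rewrite /upd (negbTE ij).
    rewrite /upd; case: eqVneq => [->//|ij]; exact: h2.
  have prodE C : (\prod_i P' (Y i @^-1` upd C i) =
      P' (Y j @^-1` C) * \prod_(i | i != j) P' (Y i @^-1` B i))%E.
    rewrite (bigD1 j)//= {1}/upd eqxx; congr (_ * _)%E.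
    by apply: eq_bigr => i ij; rewrite /upd (negbTE ij).
  have GE C : G C -> P (X j @^-1` C `&` E) =
      (P' (Y j @^-1` C) * \prod_(i | i != j) P' (Y i @^-1` B i))%E.
    move=> GC; rewrite -capE -prodE; apply: IH => i; rewrite /upd.
    case: eqVneq => [_|ij]; first by case: ifP => // _; exact: Gm.
    by have := HB i; rewrite in_cons (negbTE ij).
  have PE : P E = (\prod_(i | i != j) P' (Y i @^-1` B i))%E.
    by have := GE _ GT; rewrite !preimage_setT setTI probability_setT mul1e.
  have updE : upd (B j) = B by apply/funext => i; rewrite /upd; case: eqVneq => // ->.
  rewrite -updE capE prodE -PE.
  apply: (event_pi_lambda (G := G)) => // C GC.
  by rewrite GE// PE.
apply: (key (enum I)) => i.
by rewrite mem_enum; exact: mA.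
Qed.

(** This is the joint law of a family indexed by [bool]. *)
Lemma pair_pi_lambda d1 d (O : measurableType d1) (V : measurableType d)
    (P : probability O R) (Q : probability V R) (f g : O -> V) (G : set (set V)) :
  measurable_fun setT f -> measurable_fun setT g ->
  setI_closed G -> G setT -> G `<=` measurable -> measurable `<=` <<s G >> ->
  (forall A B, G A -> G B -> P (f @^-1` A `&` g @^-1` B) = (Q A * Q B)%E) ->
  forall A B, measurable A -> measurable B ->
    P (f @^-1` A `&` g @^-1` B) = (Q A * Q B)%E.
Proof.
move=> mf mg GI GT Gm mG H A B mA mB.
pose X (b : bool) := if b then f else g.
have capE (C : bool -> set V) : \bigcap_(b in [set: bool]) X b @^-1` C b =
    f @^-1` C true `&` g @^-1` C false.
  apply/seteqP; split => [w h|w [h1 h2] [] _//].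
  by split; [exact: (h true Logic.I)|exact: (h false Logic.I)].
have : joint_law P X Q (fun _ : bool => idfun).
  apply: (joint_law_pi_lambda _ _ GI GT Gm mG) => [[]//|_|C GC].
    exact: measurable_id.
  by rewrite capE big_bool H.
move=> /(_ (fun b => if b then A else B)); rewrite capE big_bool.
by apply; case.
Qed.

Lemma joint_law_pair (I : finType) d (O : measurableType d)
    (P : probability O R) (X Y : I -> O -> R) :
  (forall i, measurable_fun setT (X i)) ->
  (forall i, measurable_fun setT (Y i)) ->
  (forall A B : I -> set R, (forall i, measurable (A i)) ->
     (forall i, measurable (B i)) ->
   P (\bigcap_(i in [set: I]) (X i @^-1` A i `&` Y i @^-1` B i)) =
     (\prod_i (P (X i @^-1` A i) * P (Y i @^-1` B i)))%E) ->
  joint_law P (fun i w => (X i w, Y i w)) P (fun i w => (X i w, Y i w)).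
Proof.
move=> mX mY H.
pose Z i w := (X i w, Y i w).
have mZ i : measurable_fun setT (Z i) by exact: measurable_fun_pair.
have PZ j A B : measurable A -> measurable B ->
    P (Z j @^-1` (A `*` B)) = (P (X j @^-1` A) * P (Y j @^-1` B))%E.
  move=> mA mB.
  have := H (fun i => if i == j then A else setT) (fun i => if i == j then B else setT).
  rewrite (bigD1 j)//= eqxx big1 ?mule1; last first.
    by move=> i /negbTE ->; rewrite !preimage_setT probability_setT mule1.
  move=> <-; [|by move=> i; case: ifP|by move=> i; case: ifP].
  congr (P _); apply/seteqP; split => [w [/= h1 h2] i _|w /(_ j Logic.I)].
    by case: eqVneq => // ->.
  by rewrite eqxx.
have [rI rT rm rg] := rectanglesP R R.
apply: (joint_law_pi_lambda mZ mZ rI rT rm rg) => D GD.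
have /choice[AB HAB] : forall i, exists AB : set R * set R,
    [/\ measurable AB.1, measurable AB.2 & D i = AB.1 `*` AB.2].
  by move=> i; have [A mA [B mB <-]] := GD i; exists (A, B).
transitivity (P (\bigcap_(i in [set: I])
      (X i @^-1` (AB i).1 `&` Y i @^-1` (AB i).2))).
  by congr (P _); apply: eq_bigcapr => i _; have [_ _ ->] := HAB i.
rewrite H; [|by move=> i; have [] := HAB i|by move=> i; have [] := HAB i].
by apply: eq_bigr => i _; have [? ? ->] := HAB i; rewrite PZ.
Qed.

Lemma joint_law_comp (I : finType) d1 d2 d d' (O1 : measurableType d1)
    (O2 : measurableType d2) (V : measurableType d) (V' : measurableType d')
    (P : probability O1 R) (X : I -> O1 -> V)
    (P' : probability O2 R) (Y : I -> O2 -> V) (h : V -> V') :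
  measurable_fun setT h -> joint_law P X P' Y ->
  joint_law P (fun i => h \o X i) P' (fun i => h \o Y i).
Proof.
move=> mh H A mA.
by apply: (H (fun i => h @^-1` A i)) => i; exact: preimage_measurable.
Qed.

(** Fatou's lemma for events: [A] is almost surely contained in the lower limit
    of the events [An n]. *)
Lemma prob_liminf d (O : measurableType d) (P : probability O R)
    (E : set O) (A : set O) (An : nat -> set O) :
  measurable E -> P E = 1%E -> measurable A -> (forall n, measurable (An n)) ->
  (forall w, E w -> A w -> \forall n \near \oo, An n w) ->
  forall e : R, 0 < e -> \forall n \near \oo, (P A <= P (An n) + e%:E)%E.
Proof.
move=> mE PE mA mAn H e e0.
pose B N := \bigcap_(n in [set n | (N <= n)%N]) An n.
have mB N : measurable (B N).
  by apply: bigcap_measurable => [|k _]; [exists N => /=|exact: mAn].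
have mUB : measurable (\bigcup_N B N) by exact: bigcupT_measurable.
have cB : P (B N) @[N --> \oo] --> P (\bigcup_N B N).
  apply: nondecreasing_cvg_mu => // n m nm; apply/subsetPset => w h k /= mk.
  by apply: h; exact: leq_trans mk.
have PAI : P A = P (A `&` E).
  apply/eqP; rewrite eq_le; apply/andP; split; last first.
    by apply: le_measure; rewrite ?inE//; exact: measurableI.
  rewrite (measureDI P mA mE) addeC -[leRHS]adde0 leeD2l//.
  apply: (@le_trans _ _ (P (~` E))).
    by apply: le_measure; rewrite ?inE; [exact: measurableD|exact: measurableC|move=> w []].
  by rewrite probability_setC// PE subee.
have PAB : (P A <= P (\bigcup_N B N))%E.
  rewrite PAI; apply: le_measure; rewrite ?inE//; first exact: measurableI.
  move=> w [Aw Ew]; have [N _ HN] := H w Ew Aw.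
  by exists N => // k; exact: HN.
have Pf C : measurable C -> P C \is a fin_num by exact: fin_num_measure.
have : (fine (P (\bigcup_N B N)))%:E = P (\bigcup_N B N) by rewrite fineK// Pf.
move=> fE; rewrite -fE in cB.
have /fine_cvgP[_ /cvgrPdist_lt/(_ e e0)] := cB.
apply: filterS => n /=; rewrite ltr_norml => /andP[_ h].
apply: (le_trans PAB); rewrite -fE -(@fineK _ (P (An n))) ?Pf// -EFinD lee_fin.
apply: (@le_trans _ _ (fine (P (B n)) + e)); first by lra.
rewrite lerD2r fine_le ?Pf//; apply: le_measure; rewrite ?inE//.
by move=> w; apply => /=.
Qed.

Lemma prob_shrink d (O : measurableType d) (P : probability O R)
    (C : nat -> set O) :
  (forall k, measurable (C k)) -> {homo C : n m / (n <= m)%N >-> m `<=` n} ->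
  fine (P (C k)) @[k --> \oo] --> fine (P (\bigcap_k C k)).
Proof.
move=> mC hC; have mI : measurable (\bigcap_k C k) by exact: bigcapT_measurable.
apply: fine_cvg; rewrite fineK ?fin_num_measure//.
apply: nonincreasing_cvg_mu => //.
  by rewrite ltey_eq fin_num_measure.
by move=> n m nm; apply/subsetPset; exact: hC.
Qed.

(** Almost sure limits preserve joint laws.  The sets [[f <= 0]] with [f]
    continuous form a pi-system that generates the Borel sets.  For such a set,
    [f (X i w) < e] forces [f (Xn n i w) < e] eventually, and the same holds
    with the strict inequality reversed; together with the product formula for
    the approximants this encloses the probability of the limit event between
    products taken at levels [0 < e], and [e] tends to zero. *)
Lemma joint_law_lim (I : finType) d1 d2 (O1 : measurableType d1)
    (O2 : measurableType d2) (P : probability O1 R) (P' : probability O2 R)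
    (X : I -> O1 -> R) (Y : I -> O2 -> R)
    (Xn : nat -> I -> O1 -> R) (Yn : nat -> I -> O2 -> R)
    (E1 : set O1) (E2 : set O2) :
  (forall i, measurable_fun setT (X i)) ->
  (forall i, measurable_fun setT (Y i)) ->
  (forall n i, measurable_fun setT (Xn n i)) ->
  (forall n i, measurable_fun setT (Yn n i)) ->
  measurable E1 -> measurable E2 -> P E1 = 1%E -> P' E2 = 1%E ->
  (forall w i, E1 w -> Xn n i w @[n --> \oo] --> X i w) ->
  (forall w i, E2 w -> Yn n i w @[n --> \oo] --> Y i w) ->
  (forall n, joint_law P (Xn n) P' (Yn n)) -> joint_law P X P' Y.
Proof.
move=> mX mY mXn mYn mE1 mE2 PE1 PE2 cX cY H.
pose G : set (set R) := [set A | exists2 f : R -> R, continuous f & A = [set x | f x <= 0]].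
have mle (g : R -> R) e : measurable_fun setT g -> measurable [set x | g x <= e].
  move=> mg; rewrite (_ : [set _ | _] = g @^-1` `]-oo, e]).
    exact: preimage_measurable.
  by apply/seteqP; split => x /=; rewrite in_itv.
have mlt (g : R -> R) e : measurable_fun setT g -> measurable [set x | g x < e].
  move=> mg; rewrite (_ : [set _ | _] = g @^-1` `]-oo, e[).
    exact: preimage_measurable.
  by apply/seteqP; split => x /=; rewrite in_itv.
apply: (joint_law_pi_lambda (G := G)) => //.
- move=> _ _ [f cf ->] [g cg ->]; exists (fun x => Num.max (f x) (g x)).
    by move=> x; apply: continuous_max; [exact: cf|exact: cg].
  by apply/seteqP; split => x /=; rewrite ge_max => /andP.
- by exists (fun=> 0); [exact: cst_continuous|apply/seteqP; split => x //= _].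
- by move=> _ [f cf ->]; apply: mle; exact: continuous_measurable_fun.
- suff: (@ocitv R).-sigma.-measurable `<=` <<s G >> by [].
  rewrite RGenOInfty.measurableE; apply: smallest_sub.
    exact: smallest_sigma_algebra.
  move=> _ [x ->]; rewrite -setCitvl; apply: sigma_algebraC.
  apply: sub_sigma_algebra; exists (fun y => y - x).
    by move=> y; apply: cvgB; [exact: cvg_id|exact: cvg_cst].
  by apply/seteqP; split => y /=; rewrite in_itv/= subr_le0.
move=> A GA.
have /choice[f Hf] : forall i, exists f : R -> R, continuous f /\ A i = [set x | f x <= 0].
  by move=> i; have [f ? ?] := GA i; exists f.
have cf i : continuous (f i) by have [] := Hf i.
have mf i : measurable_fun setT (f i) by exact: continuous_measurable_fun.
have mBX (Z : I -> O1 -> R) (S : I -> set R) : (forall i, measurable_fun setT (Z i)) ->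
    (forall i, measurable (S i)) -> measurable (\bigcap_(i in [set: I]) Z i @^-1` S i).
  exact: bigcap_preimage_measurable.
have fin d (O : measurableType d) (Q : probability O R) (S : set O) :
    measurable S -> (fine (Q S))%:E = Q S.
  by move=> mS; rewrite fineK// fin_num_measure.
pose e (k : nat) : R := k.+1%:R^-1.
have e0 k : 0 < e k by rewrite invr_gt0.
have ce : e k @[k --> \oo] --> 0 by exact: cvg_harmonic.
have nie n m : (n <= m)%N -> e m <= e n.
  by move=> nm; rewrite lef_pV2 ?posrE// ler_nat.
have capE (x : R) : (forall k, x <= e k) -> x <= 0.
  by move=> xe; apply: (cvgr_to_ge ce); exact: nearW.
have AiE i : A i = \bigcap_k [set x | f i x <= e k].
  have [_ ->] := Hf i; apply/seteqP; split => x /=.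
    by move=> h k _ /=; apply: (le_trans h); exact: ltW.
  by move=> h; apply: capE => k; exact: h.
have cXA : fine (P (\bigcap_(i in [set: I]) X i @^-1` [set x | f i x <= e k]))
    @[k --> \oo] --> fine (P (\bigcap_(i in [set: I]) X i @^-1` A i)).
  rewrite (_ : \bigcap_(i in _) _ @^-1` A i =
     \bigcap_k \bigcap_(i in [set: I]) X i @^-1` [set x | f i x <= e k]).
    apply: prob_shrink => [k|n m nm].
      by apply: mBX => // i; exact: mle.
    by move=> w h i _ /=; apply: (le_trans (h i Logic.I)); exact: nie.
  apply/seteqP; split => [w h k _ i _ |w h i _].
    by have := h i Logic.I; rewrite /preimage/= AiE; apply.
  by rewrite /preimage/= AiE => k _; exact: h.
have cYA i : fine (P' (Y i @^-1` [set x | f i x <= e k]))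
    @[k --> \oo] --> fine (P' (Y i @^-1` A i)).
  rewrite AiE preimage_bigcap; apply: prob_shrink => [k|n m nm].
    by apply: preimage_measurable => //; exact: mle.
  by move=> w /= h; apply: (le_trans h); exact: nie.
have mRR (S : I -> R) d (O : measurableType d) (Z : I -> O -> R) i :
    (forall i, measurable_fun setT (Z i)) ->
    measurable (Z i @^-1` [set x | f i x < S i]) /\
    measurable (Z i @^-1` [set x | f i x <= S i]).
  by move=> mZ; split; apply: preimage_measurable => //; [exact: mlt|exact: mle].
have limX k : \forall n \near \oo,
    (P (\bigcap_(i in [set: I]) X i @^-1` [set x | (f i x < e k)%R]) <=
     P (\bigcap_(i in [set: I]) Xn n i @^-1` [set x | (f i x < e k)%R]) + (e k)%:E)%E.
  apply: (prob_liminf mE1) => // [|n|w E1w Aw].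
  - by apply: mBX => // i; exact: mlt.
  - by apply: mBX => // i; exact: mlt.
  - suff : \forall n \near \oo, forall i, f i (Xn n i w) < e k.
      by apply: filterS => n h i _; exact: h.
    apply: filter_forall => i.
    have c : f i (Xn n i w) @[n --> \oo] --> f i (X i w).
      by apply: continuous_cvg; [exact: cf|exact: cX].
    exact: (cvgr_lt _ c) (Aw i Logic.I).
have limXc k : \forall n \near \oo,
    (P (~` \bigcap_(i in [set: I]) X i @^-1` [set x | (f i x <= e k)%R]) <=
     P (~` \bigcap_(i in [set: I]) Xn n i @^-1` [set x | (f i x <= e k)%R]) + (e k)%:E)%E.
  apply: (prob_liminf mE1) => // [|n|w E1w Aw].
  - by apply: measurableC; apply: mBX => // i; exact: mle.
  - by apply: measurableC; apply: mBX => // i; exact: mle.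
  - have [i /not_implyP[_ /negP]] : exists i, ~ (True -> f i (X i w) <= e k).
      by apply/existsNP => h; apply: Aw => i; exact: h.
    rewrite -ltNge => h.
    have c : f i (Xn n i w) @[n --> \oo] --> f i (X i w).
      by apply: continuous_cvg; [exact: cf|exact: cX].
    apply: filterS (cvgr_gt _ c _ h) => n h' /(_ i Logic.I) /=.
    by rewrite leNgt h'.
have limY k : \forall n \near \oo, forall i,
    (P' (Y i @^-1` [set x | (f i x < e k)%R]) <=
     P' (Yn n i @^-1` [set x | (f i x < e k)%R]) + (e k)%:E)%E.
  apply: filter_forall => i; apply: (prob_liminf mE2) => // [|n|w E1w Aw].
  - by apply: preimage_measurable => //; exact: mlt.
  - by apply: preimage_measurable => //; exact: mlt.
  - have c : f i (Yn n i w) @[n --> \oo] --> f i (Y i w).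
      by apply: continuous_cvg; [exact: cf|exact: cY].
    exact: (cvgr_lt _ c) Aw.
have limYc k : \forall n \near \oo, forall i,
    (P' (~` (Y i @^-1` [set x | (f i x <= e k)%R])) <=
     P' (~` (Yn n i @^-1` [set x | (f i x <= e k)%R])) + (e k)%:E)%E.
  apply: filter_forall => i; apply: (prob_liminf mE2) => // [|n|w E1w /negP].
  - by apply: measurableC; apply: preimage_measurable => //; exact: mle.
  - by apply: measurableC; apply: preimage_measurable => //; exact: mle.
  - rewrite -ltNge => h.
    have c : f i (Yn n i w) @[n --> \oo] --> f i (Y i w).
      by apply: continuous_cvg; [exact: cf|exact: cY].
    apply: filterS (cvgr_gt _ c _ h) => n h' /=.
    by apply/negP; rewrite -ltNge.
have flip d (O : measurableType d) (Q : probability O R) (S S' : set O) (a : R) :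
    measurable S -> measurable S' ->
    (Q (~` S) <= Q (~` S') + a%:E)%E -> fine (Q S') <= fine (Q S) + a.
  move=> mS mS'; rewrite !probability_setC// -(fin _ _ _ _ mS) -(fin _ _ _ _ mS').
  by rewrite -!EFinB -EFinD lee_fin /=; lra.
have unfl d (O : measurableType d) (Q : probability O R) (S S' : set O) (a : R) :
    measurable S -> measurable S' ->
    (Q S <= Q S' + a%:E)%E -> fine (Q S) <= fine (Q S') + a.
  move=> mS mS'; rewrite -(fin _ _ _ _ mS) -(fin _ _ _ _ mS').
  by rewrite -EFinD lee_fin /=.
pose q i := fine (P' (Y i @^-1` A i)).
have mA i : measurable (A i) by have [_ ->] := Hf i; exact: mle.
have fle d (O : measurableType d) (Q : probability O R) (S S' : set O) :
    measurable S -> measurable S' -> S `<=` S' -> fine (Q S) <= fine (Q S').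
  move=> mS mS' SS'; rewrite fine_le ?fin_num_measure//.
  by apply: le_measure; rewrite ?inE.
have HfE n (S : I -> set R) : (forall i, measurable (S i)) ->
    fine (P (\bigcap_(i in [set: I]) Xn n i @^-1` S i)) =
    \prod_i fine (P' (Yn n i @^-1` S i)).
  move=> mS; rewrite (H n)//; apply: EFin_inj; rewrite fineK; last first.
    by apply: prode_fin_num => i _; rewrite fin_num_measure//; exact: preimage_measurable.
  rewrite (big_morph EFin EFinM erefl); apply: eq_bigr => i _.
  by rewrite fin//; exact: preimage_measurable.
have mS1 k i : measurable [set x | f i x < e k] by exact: mlt.
have mS2 k i : measurable [set x | f i x <= e k] by exact: mle.
(* Upper bound: on the left pass from [f <= 0] to the open condition
   [f < e k], which survives the limit; on the right, to the closed one. *)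
have le1 k : fine (P (\bigcap_(i in [set: I]) X i @^-1` A i)) <=
    \prod_i (fine (P' (Y i @^-1` [set x | f i x <= e k])) + e k) + e k.
  have [n [hX hY]] := filter_ex (filterI (limX k) (limYc k)).
  apply: (@le_trans _ _ (fine (P (\bigcap_(i in [set: I]) X i @^-1` [set x | f i x < e k])))).
    apply: fle; [exact: mBX|exact: mBX|move=> w h i _ /=].
    have := h i Logic.I; have [_ ->] := Hf i; rewrite /preimage/= => h'.
    exact: (le_lt_trans h').
  apply: (le_trans (unfl _ _ _ _ _ _ (mBX _ _ mX (mS1 k)) (mBX _ _ (mXn n) (mS1 k)) hX)).
  rewrite lerD2r HfE//; apply: ler_prod => i _; rewrite fine_ge0//=.
  have := flip _ _ _ _ _ _ (preimage_measurable (mY i) (mS2 k i))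
      (preimage_measurable (mYn n i) (mS2 k i)) (hY i).
  apply: le_trans; apply: fle; try exact: preimage_measurable.
  by move=> w /= /ltW.
(* Lower bound, through the complements of the same two conditions. *)
have le2 k : \prod_i Num.max 0 (q i - e k) <=
    fine (P (\bigcap_(i in [set: I]) X i @^-1` [set x | f i x <= e k])) + e k.
  have [n [hX hY]] := filter_ex (filterI (limXc k) (limY k)).
  apply: le_trans (flip _ _ _ _ _ _ (mBX _ _ mX (mS2 k)) (mBX _ _ (mXn n) (mS2 k)) hX).
  apply: (@le_trans _ _ (fine (P (\bigcap_(i in [set: I]) Xn n i @^-1` [set x | f i x < e k])))).
    rewrite HfE//; apply: ler_prod => i _; rewrite le_max lexx/= ge_max fine_ge0//=.
    rewrite lerBlDr.
    have := unfl _ _ _ _ _ _ (preimage_measurable (mY i) (mS1 k i))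
      (preimage_measurable (mYn n i) (mS1 k i)) (hY i).
    apply: le_trans; apply: fle; try exact: preimage_measurable.
    by have [_ ->] := Hf i; move=> w /= h; exact: (le_lt_trans h).
  apply: fle; [exact: mBX|exact: mBX|move=> w h i _ /=].
  by have := h i Logic.I; rewrite /preimage/= => /ltW.
have qE : (\prod_i P' (Y i @^-1` A i))%E = (\prod_i q i)%:E.
  rewrite (big_morph EFin EFinM erefl); apply: eq_bigr => i _.
  by rewrite fin//; exact: preimage_measurable.
rewrite qE -(fin _ _ P); last exact: mBX.
congr (_%:E); apply/eqP; rewrite eq_le; apply/andP; split.
  have c : \prod_i (fine (P' (Y i @^-1` [set x | f i x <= e k])) + e k) + e k
      @[k --> \oo] --> \prod_i q i.
    rewrite -[X in _ --> X]addr0; apply: cvgD => //.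
    apply: cvg_big; first exact: mul_continuous.
    by move=> i _; rewrite -[X in _ --> X]addr0; apply: cvgD => //; exact: cYA.
  by apply: (cvgr_to_ge c); exact: nearW.
have c : \prod_i Num.max 0 (q i - e k) @[k --> \oo] --> \prod_i q i.
  apply: cvg_big; first exact: mul_continuous.
  move=> i _; have q0 : 0 <= q i by rewrite fine_ge0.
  have : Num.max 0 (q i - e k) @[k --> \oo] --> Num.max 0 (q i - 0).
    apply: (@cvg_comp _ _ _ e (fun x => Num.max 0 (q i - x)) _ _ _ ce).
    apply: (@continuous_max R R (fun=> 0) (fun x => q i - x) 0); first exact: cvg_cst.
    by apply: cvgB; [exact: cvg_cst|exact: cvg_id].
  by rewrite subr0 (max_r q0).
apply: (ler_cvg_to c (g := fun k => fine (P (\bigcap_(i in [set: I])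
    X i @^-1` [set x | f i x <= e k])) + e k)).
  by rewrite -[X in _ --> X]addr0; apply: cvgD.
exact: nearW.
Qed.
End joint_laws.

(** * Borel measurability in normed spaces *)

Section borel_measurability.
Context {R : realType}.
Implicit Type M : normedModType R[i].

Lemma continuous_borel_measurable M (f : M -> R) :
  continuous f -> measurable_fun setT (f : borel M -> R).
Proof.
move=> /continuousP cf.
apply: (measurability _ (RGenOpens.measurableE R)) => _ [_ [a [b ->]] <-].
by rewrite setTI; apply: sub_sigma_algebra; apply: cf; exact: interval_open.
Qed.

Lemma countable_measurable_comp d (O : measurableType d) (C : countType)
    (V : Type) (Y : O -> C) (h : C -> V) (A : set V) :
  (forall c, measurable (Y @^-1` [set c])) -> measurable ((h \o Y) @^-1` A).
Proof.
move=> mY.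
rewrite (_ : _ @^-1` _ = \bigcup_k (if (unpickle k : option C) is Some c then
   (if h c \in A then Y @^-1` [set c] else set0) else set0)).
  apply: bigcupT_measurable => k; case: unpickle => [c|//].
  by case: ifP.
apply/seteqP; split => [w /= Ahw|w [k _]].
  by exists (pickle (Y w)) => //; rewrite pickleK mem_set.
by case: unpickle => [c|//]; case: ifP => // /set_mem Ahc /= ->.
Qed.

(** An open set [U] pulls back to the points at which, for some margin [e], the
    approximants eventually have their [e]-ball inside [U].  Countably valued
    approximants pull every set back to a measurable set, so this argument does
    not need the target to be separable. *)
Lemma measurable_lim_discrete M d (O : measurableType d) (X : O -> M)
    (Xn : nat -> O -> M) :
  (forall n (A : set M), measurable (Xn n @^-1` A)) ->
  (forall w, Xn n w @[n --> \oo] --> X w) ->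
  measurable_fun setT (X : O -> borel M).
Proof.
move=> mXn cX.
pose e (k : nat) : R[i] := (k.+1%:R^-1 : R)%:C%C.
have e0 k : 0 < e k by rewrite (@ltcR R 0) invr_gt0.
have small (r : R[i]) : 0 < r -> exists k, e k + e k <= r.
  move=> /gt0_complex[s s0 ->].
  have s20 : 0 < s / 2 by rewrite divr_gt0.
  have [k _ /(_ k (leqnn _)) h] := near_infty_natSinv_lt (PosNum s20).
  have {}h : k.+1%:R^-1 < s / 2 := h.
  by exists k; rewrite /e -rmorphD lecR [leRHS]splitr lerD// ltW.
apply: (@measurability _ _ O (borel M) setT X (@open M) erefl) => // _ [U oU <-]; rewrite setTI.
pose Uk k := [set z : M | ball z (e k) `<=` U].
rewrite (_ : _ @^-1` _ =
  \bigcup_k \bigcup_N \bigcap_(n in [set n | (N <= n)%N]) Xn n @^-1` Uk k).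
  apply: bigcupT_measurable => k; apply: bigcupT_measurable => N.
  by apply: bigcap_measurable => [|n _]; [exists N => /=|exact: mXn].
apply/seteqP; split => [w /= UX|w [k _ [N _ h]]].
  have /nbhs_ballP[r /= r0 hr] : nbhs (X w) U by exact: open_nbhs_nbhs.
  have [k hk] := small _ r0; exists k => //.
  have [N _ HN] : \forall n \near \oo, ball (X w) (e k) (Xn n w).
    by have /cvg_ballP := cX w; apply.
  exists N => // n /= Nn z hz; apply: hr; apply: le_ball hk _ _.
  by apply: ball_triangle hz; exact: HN.
have [N' _ HN'] : \forall n \near \oo, ball (X w) (e k) (Xn n w).
  by have /cvg_ballP := cX w; apply.
apply: (h (maxn N N')); first exact: leq_maxl.
by apply: ball_sym; apply: HN'; rewrite /= leq_maxr.
Qed.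

Definition round_down (n : nat) (x : R) : R := (Num.floor (x * n.+1%:R))%:~R / n.+1%:R.

Lemma round_down_err n x : `|x - round_down n x| <= n.+1%:R^-1.
Proof.
rewrite /round_down -[X in `|X - _|](@mulfK _ n.+1%:R) ?pnatr_eq0// -mulrBl normrM.
rewrite [X in _ * X]ger0_norm ?invr_ge0// ler_piMl// ler_norml.
have := Num.Theory.floor_itv (x * n.+1%:R).
by rewrite intrD => /andP[? ?]; apply/andP; split; lra.
Qed.

Lemma cvg_round_down x : round_down n x @[n --> \oo] --> x.
Proof.
apply/cvgrPdist_le => e e0.
have := near_infty_natSinv_lt (PosNum e0).
by apply: filterS => n /ltW; apply: le_trans; exact: round_down_err.
Qed.

Lemma measurable_floor_fiber d (O : measurableType d) (X : O -> R) (n : nat) (z : int) :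
  measurable_fun setT X ->
  measurable ((fun w => Num.floor (X w * n.+1%:R)) @^-1` [set z]).
Proof.
move=> mX; rewrite (_ : _ @^-1` _ =
  X @^-1` [set` `[z%:~R / n.+1%:R, (z + 1)%:~R / n.+1%:R[]).
  exact: preimage_measurable.
apply/seteqP; split => w /=; rewrite in_itv/= ler_pdivrMr// ltr_pdivlMr//.
  by move=> <-; rewrite Num.Theory.floor_itv.
by move=> /Num.Theory.floor_def.
Qed.

(** Complex numbers carry the Borel sets of their norm topology and not those of a
    product, so measurability goes through countably valued roundings of both
    parts. *)
Lemma measurable_complex d (O : measurableType d) (X Y : O -> R) :
  measurable_fun setT X -> measurable_fun setT Y ->
  measurable_fun setT (fun w => (X w +i* Y w)%C : borel R[i]).
Proof.
move=> mX mY.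
pose fl (n : nat) (x : R) := Num.floor (x * n.+1%:R).
apply: (measurable_lim_discrete
    (Xn := fun n w => (round_down n (X w) +i* round_down n (Y w))%C)) => [n A|w].
  pose h (p : int * int) : R[i] := (p.1%:~R / n.+1%:R +i* (p.2%:~R / n.+1%:R))%C.
  apply: (@countable_measurable_comp _ _ _ _ (fun w => (fl n (X w), fl n (Y w))) h) => -[a b].
  rewrite (_ : _ @^-1` _ = (fun w => fl n (X w)) @^-1` [set a] `&`
     (fun w => fl n (Y w)) @^-1` [set b]).
    by apply: measurableI; exact: measurable_floor_fiber.
  by apply/seteqP; split => w /= [-> ->].
apply/cvgrPdist_lt => _ /gt0_complex[e e0 ->].
have e20 : 0 < e / 2 by rewrite divr_gt0.
have /cvgrPdist_lt hX := @cvg_round_down (X w); have {}hX := hX _ e20.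
have /cvgrPdist_lt hY := @cvg_round_down (Y w); have {}hY := hY _ e20.
by near=> n; apply: complex_near => /=; near: n.
Unshelve. all: by end_near. Qed.

Lemma lipschitz_real_continuous M (f : M -> R) (K : R) : 0 < K ->
  (forall x y, `|f x - f y|%:C%C <= K%:C%C * `|x - y|) -> continuous f.
Proof.
move=> K0 fK y; apply/cvgrPdist_lt => e e0.
have K0c : 0 < K%:C%C :> R[i] by rewrite (@ltcR R 0).
have eK : 0 < (e / K)%:C%C :> R[i] by rewrite (@ltcR R 0) divr_gt0.
apply/nbhs_ballP; exists (e / K)%:C%C => //= z.
rewrite -ball_normE /= => h; rewrite -ltcR; apply: (le_lt_trans (fK _ _)).
rewrite -(ltr_pM2l K0c) in h; apply: (lt_le_trans h).
by rewrite -rmorphM mulrC divfK// gt_eqF.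
Qed.

Lemma Re_le_normc (z : R[i]) : `|complex.Re z| <= normc z.
Proof. by case: z => a b /=; rewrite -sqrtr_sqr ler_wsqrtr// lerDl sqr_ge0. Qed.

Lemma Im_le_normc (z : R[i]) : `|complex.Im z| <= normc z.
Proof. by case: z => a b /=; rewrite -sqrtr_sqr ler_wsqrtr// lerDr sqr_ge0. Qed.

Lemma continuous_Re : continuous (@complex.Re R : R[i] -> R).
Proof.
apply: (@lipschitz_real_continuous R[i] _ 1) => // x y.
rewrite rmorph1 mul1r normE lecR; case: x y => [a b] [c d].
exact: (Re_le_normc ((a +i* b) - (c +i* d))%C).
Qed.

Lemma continuous_Im : continuous (@complex.Im R : R[i] -> R).
Proof.
apply: (@lipschitz_real_continuous R[i] _ 1) => // x y.
rewrite rmorph1 mul1r normE lecR; case: x y => [a b] [c d].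
exact: (Im_le_normc ((a +i* b) - (c +i* d))%C).
Qed.

End borel_measurability.

(** * The standard normal measure and its reflections *)

(** A name of its own, so that the measure can be declared a probability on the
    type [R] with its default measurable structure. *)
Definition stdnormal {R : realType} : set R -> \bar R := normal_prob (0 : R) 1.

Section stdnormal_probability.
Context {R : realType}.
Let nu : {measure set (measurableTypeR R) -> \bar R} := normal_prob (0 : R) 1.

Let stdnormal0 : @stdnormal R set0 = 0%E.
Proof. exact: (measure0 nu). Qed.

Let stdnormal_ge0 A : (0 <= @stdnormal R A)%E.
Proof. exact: (measure_ge0 nu). Qed.

Let stdnormal_additive : semi_sigma_additive (@stdnormal R).
Proof. exact: (@measure_semi_sigma_additive _ _ _ nu). Qed.

HB.instance Definition _ := isMeasure.Build _ _ _ (@stdnormal R)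
  stdnormal0 stdnormal_ge0 stdnormal_additive.

Let stdnormal_setT : @stdnormal R setT = 1%E.
Proof. exact: (probability_setT (normal_prob (0 : R) 1)). Qed.

HB.instance Definition _ :=
  Measure_isProbability.Build _ _ _ (@stdnormal R) stdnormal_setT.

End stdnormal_probability.

Section gaussian_measure.
Context {R : realType}.
Notation mu := (@lebesgue_measure R).
Notation gauss := (@stdnormal R).
Notation phi := (@normal_pdf R 0 1).
Local Open Scope ereal_scope.

Import HBNNSimple.

(** Checked on indicators, then on simple functions, then by monotone
    convergence. *)
Lemma integral_gauss (f : R -> \bar R) :
  measurable_fun setT f -> (forall x, 0 <= f x) ->
  \int[gauss]_x f x = \int[mu]_x (f x * (phi x)%:E).
Proof.
move=> mf f0.
have mphi : measurable_fun setT phi by exact: measurable_normal_pdf.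
have phi0 x : (0 <= phi x)%R by exact: normal_pdf_ge0.
pose f_ := nnsfun_approx measurableT mf.
have f_0 n x : (0 <= f_ n x)%R by [].
have f_nd x : {homo (fun n => (f_ n x)%:E) : m n / (m <= n)%N >-> m <= n}.
  by move=> m n mn; rewrite lee_fin; exact/lefP/nd_nnsfun_approx.
have mf_ n : measurable_fun [set: measurableTypeR R] (f_ n : R -> R).
  have h : measurable_fun [set: R] (f_ n : R -> R) by []. exact: h.
have mEf_ n : measurable_fun [set: measurableTypeR R] (fun x => (f_ n x)%:E).
  exact/measurable_EFinP.
have mEphi : measurable_fun [set: measurableTypeR R] (fun x => (phi x)%:E).
  exact/measurable_EFinP.
have cf_ x : (f_ n x)%:E @[n --> \oo] --> f x by apply: cvg_nnsfun_approx.
transitivity (limn (fun n => \int[gauss]_x (f_ n x)%:E)).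
  rewrite -monotone_convergence//.
  - by apply: eq_integral => y _; apply/esym/cvg_lim => //; exact: cf_.
  - by move=> n x _; rewrite lee_fin.
rewrite [X in limn X](_ : _ = (fun n => \int[mu]_x ((f_ n x)%:E * (phi x)%:E))).
  rewrite -monotone_convergence//; last 3 first.
    - by move=> n; apply: emeasurable_funM; [exact: mEf_|exact: mEphi].
    - by move=> n x _; rewrite -EFinM lee_fin mulr_ge0.
    - move=> x _ m n mn; apply: lee_wpmul2r; first by rewrite lee_fin.
      exact: f_nd.
  apply: eq_integral => x _; apply/cvg_lim => //.
  apply: cvgeZr => //; exact: cf_.
apply/funext => n.
have mk (k : R) : measurable_fun [set: measurableTypeR R]
    (\1_(f_ n @^-1` [set k]) : R -> R).
  have : measurable_fun [set: R] (\1_(f_ n @^-1` [set k]) : R -> R) by [].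
  exact.
have mEk (k : R) : measurable_fun [set: measurableTypeR R]
    (fun x => (\1_(f_ n @^-1` [set k]) x : R)%:E).
  exact/measurable_EFinP.
transitivity (\sum_(k \in range (f_ n))
    \int[gauss]_x (k * \1_(f_ n @^-1` [set k]) x)%:E).
  under eq_integral do rewrite fimfunE -fsumEFin//.
  rewrite ge0_integral_fsum//.
  - by move=> y; exact/measurable_EFinP/measurable_funM.
  - by move=> y x _; rewrite nnfun_muleindic_ge0.
transitivity (\sum_(k \in range (f_ n))
    \int[mu]_x ((k * \1_(f_ n @^-1` [set k]) x)%:E * (phi x)%:E)); last first.
  rewrite -ge0_integral_fsum//.
  - apply: eq_integral => x _.
    rewrite -ge0_mule_fsuml; last by move=> y; rewrite nnfun_muleindic_ge0.
    by rewrite fsumEFin// -fimfunE.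
  - by move=> r; apply: emeasurable_funM => //; apply/measurable_EFinP/measurable_funM.
  - move=> r x _; apply: mule_ge0; last by rewrite lee_fin.
    by rewrite EFinM nnfun_muleindic_ge0.
apply: eq_fsbigr => r _.
have [r0|r0] := leP 0%R r; last first.
  rewrite preimage_nnfun0// indic0.
  under eq_integral do rewrite mulr0.
  under [RHS]eq_integral do rewrite mulr0 mul0e.
  by rewrite !integral0.
rewrite integralZl_indic_nnsfun// integral_indic//= setIT.
under [RHS]eq_integral do rewrite EFinM -muleA.
rewrite ge0_integralZl//; last 2 first.
- by apply: emeasurable_funM.
- by move=> x _; rewrite -EFinM lee_fin mulr_ge0.
congr (_ * _).
rewrite /stdnormal /normal_prob [LHS]integral_mkcond; apply: eq_integral => x _.
rewrite patchE indicE; case: ifPn => _; by rewrite ?mul1e ?mul0e.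
Qed.

(** The left-hand side is a measure in [A] that gives intervals their length. *)
Lemma lebesgue_affine (a b : R) (A : set R) : (0 < a)%R -> measurable A ->
  a%:E * mu ((fun x => a * x + b)%R @^-1` A) = mu A.
Proof.
move=> a0 mA; apply/esym.
pose h : measurableTypeR R -> measurableTypeR R := (fun x => a * x + b)%R.
have mh : measurable_fun setT h.
  by apply: measurable_funD => //; exact: measurable_funM.
have @nu : {measure set (measurableTypeR R) -> \bar R}.
  by exact: (pushforward mu h).
pose nu' : {measure set (measurableTypeR R) -> \bar R} := mscale (NngNum (ltW a0)) nu.
rewrite (_ : a%:E * _ = nu' A)//.
apply: lebesgue_measure_unique => // _ [[x y]] _ <- /=.
rewrite (_ : nu' _ = a%:E * mu (h @^-1` `]x, y]))//.
rewrite (_ : h @^-1` _ = `](x - b) / a, (y - b) / a]%classic)%R; last first.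
  apply/seteqP; split => z /=; rewrite /h !in_itv/= ltr_pdivrMr// ler_pdivlMr//;
  move=> /andP[? ?]; apply/andP; split; lra.
rewrite !lebesgue_measure_itv/= !lte_fin ltr_pM2r ?invr_gt0// ltrD2r.
case: ifPn => xy; last by rewrite mule0.
rewrite -!EFinB -EFinM; congr EFin; field; exact: lt0r_neq0.
Qed.

Lemma ge0_integral_affine (a b : R) (f : R -> \bar R) : (0 < a)%R ->
  measurable_fun setT f -> (forall x, 0 <= f x) ->
  \int[mu]_x f x = a%:E * \int[mu]_x f (a * x + b)%R.
Proof.
move=> a0 mf f0.
pose h : measurableTypeR R -> measurableTypeR R := (fun x => a * x + b)%R.
have mh : measurable_fun setT h.
  by apply: measurable_funD => //; exact: measurable_funM.
have @nu : {measure set (measurableTypeR R) -> \bar R}.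
  by exact: (pushforward mu h).
transitivity (\int[mscale (NngNum (ltW a0)) nu]_x f x).
  by apply: eq_measure_integral => A mA _; exact/esym/lebesgue_affine.
rewrite ge0_integral_mscale//; congr (_ * _).
by rewrite ge0_integral_pushforward.
Qed.

Lemma phi_rotate (c s x y : R) : (c ^+ 2 + s ^+ 2 = 1)%R ->
  (phi (c * x + s * y) * phi (s * x - c * y) = phi x * phi y)%R.
Proof.
move=> cs; rewrite !normal_pdfE ?oner_eq0// /normal_fun.
set p := normal_peak _.
transitivity (p ^+ 2 * expR (- (x ^+ 2 + y ^+ 2) / (1 ^+ 2 *+ 2)))%R.
  rewrite mulrACA -expRD expr2; congr (_ * expR _)%R.
  rewrite -mulrDl; congr (_ / _)%R; rewrite !subr0 -opprD; congr (- _)%R.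
  rewrite -[RHS]mul1r -cs; ring.
rewrite mulrACA -expRD expr2; congr (_ * expR _)%R.
by rewrite !subr0 -mulrDl -opprD.
Qed.

Definition reflect2 (c s : R) (z : R * R) : R * R :=
  (c * z.1 + s * z.2, s * z.1 - c * z.2)%R.

Lemma measurable_reflect2 c s : measurable_fun setT (reflect2 c s).
Proof.
apply: measurable_fun_pair.
  by apply: measurable_funD; apply: measurable_funM => //.
by apply: measurable_funB; apply: measurable_funM => //.
Qed.

Lemma gaussE (S : set R) : measurable S ->
  gauss S = \int[mu]_y (\1_S y * phi y)%:E.
Proof.
move=> mS; rewrite /stdnormal /normal_prob [LHS]integral_mkcond.
apply: eq_integral => x _.
by rewrite patchE indicE; case: ifPn => _; rewrite ?mul1r ?mul0r.
Qed.

(** Written with densities, the left-hand side is a double integral over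
    [(x, y)].  The substitution [u = c x + s y] in the inner integral, an
    exchange of the two integrals, and the substitution [v = s x - c y] in the
    new inner one turn it into the right-hand side; [phi_rotate] says that the
    density does not change.  Only one-dimensional substitutions are used. *)
Lemma gauss_reflect_rect (c s : R) (A B : set R) :
  (0 < s)%R -> (c ^+ 2 + s ^+ 2 = 1)%R -> measurable A -> measurable B ->
  (gauss \x gauss) (reflect2 c s @^-1` (A `*` B)) = gauss A * gauss B.
Proof.
move=> s0 cs mA mB.
have mphi : measurable_fun setT phi by exact: measurable_normal_pdf.
have phi0 x : (0 <= phi x)%R by exact: normal_pdf_ge0.
set E := _ @^-1` _.
have mE : measurable E.
  by apply: preimage_measurable; [exact: measurable_reflect2|exact: measurableX].
have EE x y : \1_E (x, y) = (\1_A (c * x + s * y) * \1_B (s * x - c * y))%R :> R.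
  rewrite !indicE -natrM mulnb (_ : (_, _) \in E = (c * x + s * y \in A)%R && (s * x - c * y \in B)%R)//.
  by apply/idP/andP => [/set_mem[? ?]|[/set_mem ? /set_mem ?]];
    [split; exact: mem_set|exact: mem_set].
have sn0 : s != 0%R by rewrite gt_eqF.
have mind d (T : measurableType d) (f : T -> R) C : measurable C -> measurable_fun setT f ->
    measurable_fun setT (fun z => \1_C (f z) : R).
  by move=> mC mf; apply: (measurableT_comp (f := \1_C : R -> R)) => //; exact: measurable_indic.
(* The integrand after the substitution [u = c x + s y], in the variables
   [(x, u)]. *)
pose K (z : R * R) : \bar R := (s^-1 * (\1_A z.2 * \1_B ((z.1 - c * z.2) / s))
  * (phi z.1 * phi ((z.2 - c * z.1) / s)))%:E.
have m1 : measurable_fun setT (fst : R * R -> R) by exact: measurable_fst.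
have m2 : measurable_fun setT (snd : R * R -> R) by exact: measurable_snd.
have mK : measurable_fun setT K.
  apply/measurable_EFinP; apply: measurable_funM.
    apply: measurable_funM => //; apply: measurable_funM; first exact: mind.
    apply: mind => //; apply: measurable_funM => //.
    by apply: measurable_funB => //; apply: measurable_funM.
  apply: measurable_funM; first exact: measurableT_comp.
  apply: (measurableT_comp mphi); apply: measurable_funM => //.
  by apply: measurable_funB => //; apply: measurable_funM.
have K0 z : 0 <= K z by rewrite lee_fin !mulr_ge0// invr_ge0 ltW.
transitivity (\int[mu]_x \int[mu]_u K (x, u)).
  rewrite /product_measure1 /= integral_gauss//; last exact: measurable_fun_xsection.
  apply: eq_integral => x _.
  rewrite /= gaussE; last exact: measurable_xsection.
  rewrite muleC -ge0_integralZl//; last 3 first.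
  - apply/measurable_EFinP/measurable_funM => //.
    by apply: measurable_indic; exact: measurable_xsection.
  - by move=> y _; rewrite lee_fin mulr_ge0.
  - by rewrite lee_fin.
  have is0 : (0 < s^-1)%R by rewrite invr_gt0.
  rewrite (ge0_integral_affine (- c * x / s) is0); last 2 first.
  - apply: emeasurable_funM => //; apply/measurable_EFinP/measurable_funM => //.
    by apply: measurable_indic; exact: measurable_xsection.
  - by move=> y; rewrite -EFinM lee_fin !mulr_ge0.
  rewrite -ge0_integralZl//; last 3 first.
  - apply/measurable_EFinP; apply: measurable_funM => //.
    have ma : measurable_fun setT (fun x0 : R => s^-1 * x0 + - c * x / s)%R.
      by apply: measurable_funD => //; exact: measurable_funM.
    apply: measurable_funM; last exact: measurableT_comp.
    by apply: mind => //; exact: measurable_xsection.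
  - by move=> y _; rewrite -EFinM lee_fin !mulr_ge0.
  - by rewrite lee_fin ltW.
  apply: eq_integral => u _; rewrite -!EFinM; congr EFin.
  rewrite (_ : \1_(xsection E x) _ = \1_A u * \1_B ((x - c * u) / s))%R; last first.
    rewrite indicE mem_xsection -indicE EE; congr (\1_A _ * \1_B _)%R.
      by field.
    by rewrite -[in RHS](mul1r x) -cs; field.
  rewrite (_ : s^-1 * u + - c * x / s = (u - c * x) / s)%R; last by field.
  by rewrite /=; ring.
rewrite (@fubini_tonelli _ _ _ _ R mu mu K mK K0)//.
transitivity (\int[mu]_u \int[mu]_v ((\1_A u * phi u)%:E * (\1_B v * phi v)%:E)).
  apply: eq_integral => u _.
  rewrite [LHS](ge0_integral_affine (c * u) s0)//; last exact: (measurable_fun_pair1 u mK).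
  rewrite -ge0_integralZl//; last 2 first.
  - apply: (measurableT_comp mK); apply: measurable_fun_pair => //.
    by apply: measurable_funD => //; exact: measurable_funM.
  - by rewrite lee_fin ltW.
  apply: eq_integral => v _; rewrite /K/= -!EFinM; congr EFin.
  rewrite (_ : (s * v + c * u - c * u) / s = v)%R; last by field.
  rewrite (_ : (u - c * (s * v + c * u)) / s = s * u - c * v)%R; last first.
    by apply: (mulIf sn0); rewrite divfK// -[X in (X - _)%R = _]mul1r -cs; ring.
  rewrite [(s * v + c * u)%R]addrC phi_rotate//.
  by field.
transitivity (\int[mu]_u ((\1_A u * phi u)%:E * gauss B)).
  apply: eq_integral => u _; rewrite ge0_integralZl//; first by rewrite -gaussE.
  - by apply/measurable_EFinP/measurable_funM.
  - by move=> y _; rewrite lee_fin mulr_ge0.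
  - by rewrite lee_fin mulr_ge0.
rewrite ge0_integralZr//; first by rewrite -gaussE.
- by apply/measurable_EFinP/measurable_funM.
- by move=> y _; rewrite lee_fin mulr_ge0.
Qed.

End gaussian_measure.

(** * Centred normal laws *)

Section gaussian_laws.
Context {R : realType}.
Notation mu := (@lebesgue_measure R).
Notation gauss := (@stdnormal R).
Notation phi := (@normal_pdf R 0 1).

Lemma phiE x : phi x = normal_peak 1 * expR (- x ^+ 2 / 2).
Proof. by rewrite normal_pdfE ?oner_eq0// /normal_fun subr0 expr1n. Qed.

Lemma phiN x : phi (- x) = phi x.
Proof. by rewrite !phiE sqrrN. Qed.

Lemma gauss_opp (A : set R) : measurable A -> gauss (-%R @^-1` A) = gauss A.
Proof.
move=> mA.
have mN : measurable_fun setT (-%R : R -> R) by exact: measurable_funN.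
rewrite !gaussE//; last exact: preimage_measurable.
have mf : measurable_fun setT (fun y => (\1_A y * phi y)%:E).
  apply/measurable_EFinP/measurable_funM; last exact: measurable_normal_pdf.
  exact: measurable_indic.
transitivity (\int[pushforward mu (-%R : _ -> measurableTypeR R)]_y (\1_A y * phi y)%:E)%E.
  rewrite ge0_integral_pushforward//.
  - by apply: eq_integral => x _ /=; rewrite phiN.
  - by move=> y _; rewrite lee_fin mulr_ge0// normal_pdf_ge0.
by apply: eq_measure_integral => B mB _; exact: lebesgue_measureN.
Qed.

(** A measure that agrees with the product on rectangles is the product. *)
Lemma gauss_reflect (c s : R) (E : set (R * R)) :
  0 < s -> c ^+ 2 + s ^+ 2 = 1 -> measurable E ->
  (gauss \x gauss)%E (reflect2 c s @^-1` E) = (gauss \x gauss)%E E.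
Proof.
move=> s0 cs mE.
have mr : measurable_fun setT (reflect2 c s) by exact: measurable_reflect2.
have @nu : {measure set (R * R) -> \bar R}.
  by exact: (pushforward (gauss \x gauss)%E (reflect2 c s)).
apply/esym; apply: (product_measure_unique (m1 := gauss) (m2 := gauss) (m' := nu)) => //.
by move=> A B mA mB; exact: gauss_reflect_rect.
Qed.

(** [X] has the law of [s] times a standard normal variable.  The scales [s] and
    [- s] describe the same law, and [s = 0] is allowed, which makes the notion
    stable under sums, scaling and limits. *)
Definition normal_law d (O : measurableType d) (P : probability O R) (X : O -> R) (s : R) :=
  measurable_fun setT X /\
  forall A : set R, measurable A -> P (X @^-1` A) = gauss ((fun x => s * x) @^-1` A).

Section normal_law.
Context d (O : measurableType d) (P : probability O R).
Implicit Types (X Y : O -> R) (s : R).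

Let mscl s : measurable_fun setT (fun x : R => s * x).
Proof. exact: measurable_funM. Qed.

Lemma normal_lawN X s : normal_law P X s -> normal_law P X (- s).
Proof.
move=> [mX XE]; split => // A mA; rewrite XE// -gauss_opp; last exact: preimage_measurable.
congr (gauss _); apply/seteqP; split => x /=; rewrite ?mulNr -?mulrN ?opprK//.
Qed.

Lemma normal_law_norm X s : normal_law P X s -> normal_law P X `|s|.
Proof. by move=> Xs; case: ger0P => // _; exact: normal_lawN. Qed.

Lemma normal_lawZ a X s : normal_law P X s -> normal_law P (fun w => a * X w) (a * s).
Proof.
move=> [mX XE]; split; first exact: measurable_funM.
move=> A mA.
have := XE ((fun x => a * x) @^-1` A) (preimage_measurable (mscl a) mA).
by rewrite /preimage /= => ->; congr (gauss _); apply/seteqP; split => x /=; rewrite mulrA.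
Qed.

(** Taking both scales nonnegative, the sum has the law of [s x + t y] under the
    product measure; with [r ^ 2 = s ^ 2 + t ^ 2] this is [r] times the first
    coordinate of a reflection. *)
Lemma normal_lawD X Y s t : normal_law P X s -> normal_law P Y t ->
  (forall A B, measurable A -> measurable B ->
     P (X @^-1` A `&` Y @^-1` B) = (P (X @^-1` A) * P (Y @^-1` B))%E) ->
  normal_law P (fun w => X w + Y w) (Num.sqrt (s ^+ 2 + t ^+ 2)).
Proof.
move=> /normal_law_norm[mX XE] /normal_law_norm[mY YE] ind.
split; first exact: measurable_funD.
rewrite -(real_normK (num_real s)) -(real_normK (num_real t)).
move: (`|s|) (`|t|) (normr_ge0 s) (normr_ge0 t) XE YE => {}s {}t s0 t0 XE YE A mA.
pose pl (z : R * R) := s * z.1 + t * z.2.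
have mpl : measurable_fun setT pl by apply: measurable_funD; apply: measurable_funM.
have mst : measurable_fun setT (fun z : R * R => (s * z.1, t * z.2)).
  by apply: measurable_fun_pair; apply: measurable_funM.
have madd : measurable_fun setT (fun z : R * R => z.1 + z.2).
  by apply: measurable_funD; [exact: measurable_fst|exact: measurable_snd].
have -> : P ((fun w => X w + Y w) @^-1` A) = (gauss \x gauss)%E (pl @^-1` A).
  have := @event_pi_lambda R _ _ _ O (R * R)%type (R * R)%type P (gauss \x gauss)%E
    (fun w => (X w, Y w)) (fun z => (s * z.1, t * z.2)) (rectangles R R) setT.
  have [rI rT rm rg] := rectanglesP R R.
  rewrite probability_setT => H.
  have := H _ _ _ rI rT rm rg _ ((fun z => z.1 + z.2) @^-1` A).
  rewrite setIT mule1; apply => //.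
  - exact: measurable_fun_pair.
  - move=> _ [B mB [C mC <-]]; rewrite setIT mule1.
    transitivity (P (X @^-1` B `&` Y @^-1` C)) => //.
    rewrite ind// XE// YE//.
    rewrite -product_measure1E; last 2 first.
    + exact: preimage_measurable.
    + exact: preimage_measurable.
    by [].
  - exact: preimage_measurable.
have gT : gauss setT = 1%E by exact: probability_setT.
have fstE B : measurable B -> (gauss \x gauss)%E (fst @^-1` B) = gauss B.
  move=> mB; rewrite (_ : _ @^-1` _ = B `*` setT); last first.
    by apply/seteqP; split => [[x y]//= Bx|[x y] []//].
  transitivity (gauss B * gauss setT)%E; first exact: product_measure1E.
  by rewrite gT mule1.
(* The reflection needs a positive second coefficient. *)
move: t0; rewrite le_eqVlt => /orP[/eqP t0|t0].
  rewrite -t0 expr0n/= addr0 sqrtr_sqr ger0_norm// -fstE; last exact: preimage_measurable.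
  by congr ((gauss \x gauss)%E _); apply/seteqP; split => z; rewrite /preimage/= /pl -t0 mul0r addr0.
pose r := Num.sqrt (s ^+ 2 + t ^+ 2).
have r20 : 0 < s ^+ 2 + t ^+ 2 by rewrite ltr_wpDl ?sqr_ge0// exprn_gt0.
have r0 : 0 < r by rewrite sqrtr_gt0.
have rE : r ^+ 2 = s ^+ 2 + t ^+ 2 by rewrite sqr_sqrtr// ltW.
rewrite -/r -fstE; last exact: preimage_measurable.
rewrite -[RHS](@gauss_reflect (s / r) (t / r)); last 3 first.
- by rewrite divr_gt0.
- by rewrite !expr_div_n -mulrDl -rE divff// sqrf_eq0 gt_eqF.
- apply: (preimage_measurable (f := fst)); first exact: measurable_fst.
  exact: preimage_measurable.
have key (z : R * R) : r * (s / r * z.1 + t / r * z.2) = pl z.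
  by rewrite /pl; field; rewrite gt_eqF.
congr ((gauss \x gauss)%E _); apply/seteqP; split => z; rewrite /preimage/=.
  by rewrite -/(pl z) key.
by rewrite -/(pl z) key.
Qed.

End normal_law.

(** If [xi] is standard normal then [sn n * xi] converges to [s * xi], so this is
    the case of a single index in [joint_law_lim]. *)
Lemma normal_law_lim d (O : measurableType d) (P : probability O R) (E : set O)
    (Xn : nat -> O -> R) (X : O -> R) (sn : nat -> R) (s : R) :
  measurable_fun setT X -> measurable E -> P E = 1%E ->
  (forall w, E w -> Xn n w @[n --> \oo] --> X w) ->
  (forall n, normal_law P (Xn n) (sn n)) -> sn n @[n --> \oo] --> s ->
  normal_law P X s.
Proof.
move=> mX mE PE cX H cs; split => // A mA.
have : joint_law P (fun _ : 'I_1 => X) gauss (fun _ : 'I_1 => (fun x : R => s * x)).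
  apply: (@joint_law_lim R 'I_1 _ _ O R P gauss _ _ (fun n _ => Xn n)
      (fun n _ => (fun x : R => sn n * x)) E setT) => //.
  - by move=> _; exact: measurable_funM.
  - by move=> n _; have [] := H n.
  - by move=> n _; exact: measurable_funM.
  - exact: probability_setT.
  - by move=> w _ Ew; exact: cX.
  - by move=> w _ _; apply: cvgMl.
  - move=> n B mB; rewrite big_ord1 /=.
    rewrite (_ : \bigcap_(_ in _) _ = Xn n @^-1` B ord0); first by apply (H n).2.
    by apply/seteqP; split => [w h|w h i _]; [exact: (h ord0 Logic.I)|rewrite (ord1 i)].
move=> /(_ (fun=> A) (fun=> mA)); rewrite big_ord1 /= => <-.
by congr (P _); apply/seteqP; split => [w h _ _//|w h]; exact: (h ord0 Logic.I).
Qed.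

End gaussian_laws.

(** * Moments of normal variables *)

Section gaussian_moments.
Context {R : realType}.
Notation mu := (@lebesgue_measure R).
Notation phi := (@normal_pdf R 0 1).
Notation gauss := (@stdnormal R).

Let mphi : measurable_fun setT phi.
Proof. exact: measurable_normal_pdf. Qed.

Let phi0 x : 0 <= phi x.
Proof. exact: normal_pdf_ge0. Qed.

Lemma derive_phi (x : R) : is_derive x 1 (- phi : R -> R) (x * phi x).
Proof.
have -> : (- phi : R -> R) = (fun x => - (normal_peak 1 * expR (- x ^+ 2 / 2))).
  by apply/funext => y; rewrite /= -phiE.
apply: is_derive_eq.
rewrite phiE /GRing.scale /=.
by rewrite !mulr1 /=; field.
Qed.

Lemma cvg_phi : phi x @[x --> +oo] --> 0.
Proof.
have cexp : normal_peak 1 * expR (- x) @[x --> +oo] --> (0 : R).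
  rewrite -[X in _ --> X](mulr0 (normal_peak 1)).
  by apply: cvgMl_tmp; exact: cvgr_expR.
apply: (@squeeze_cvgr _ _ _ _ (fun=> 0) (fun x => normal_peak 1 * expR (- x))) => //.
  near=> x; rewrite phi0/= phiE ler_wpM2l ?normal_peak_ge0// ler_expR.
  rewrite mulNr lerN2 ler_pdivlMr// expr2 ler_wpM2l//; near: x; exact: nbhs_pinfty_ge.
exact: cvg_cst.
Unshelve. all: by end_near. Qed.

Lemma integral_x_phi (x : R) : 0 <= x ->
  (\int[mu]_(t in `[x, +oo[) (t * phi t)%:E = (phi x)%:E)%E.
Proof.
move=> x0.
have cphi : continuous phi by apply: continuous_normal_pdf; rewrite oner_eq0.
rewrite (@ge0_continuous_FTC2y _ _ (- phi) _ 0).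
- by rewrite -EFinB sub0r; congr EFin; exact: opprK.
- by move=> t xt; rewrite mulr_ge0// (le_trans x0).
- apply: continuous_subspaceT => t.
  by apply: cvgM; [exact: cvg_id|exact: cphi].
- by rewrite -[X in _ --> X]oppr0; apply: cvgN; exact: cvg_phi.
- by move=> t _; have [] := derive_phi t.
- by apply: cvg_at_right_filter; apply: cvgN; exact: cphi.
- by move=> t _; rewrite derive1E; have [_ ->] := derive_phi t.
Qed.

(** Writing [x ^ 2 phi x] as the integral of [x phi x] over [[0, x]] and exchanging
    the integrals leaves the integral over [x] of the tail integrals of
    [t phi t], which are [phi x]; so the second moment equals the total mass.
    All integrals are of nonnegative functions. *)
Lemma gauss_x2 : (\int[gauss]_x (x ^+ 2)%:E = 1)%E.
Proof.
have cphi : continuous phi by apply: continuous_normal_pdf; rewrite oner_eq0.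
have mT : measurable_fun setT (fun x : R => (x ^+ 2)%:E).
  by apply/measurable_EFinP; exact: measurable_funX.
rewrite integral_gauss//; last by move=> x; rewrite lee_fin sqr_ge0.
under eq_integral do rewrite -EFinM.
rewrite ge0_symfun_integralT; last 3 first.
- by move=> x; rewrite mulr_ge0// sqr_ge0.
- by move=> x; apply: cvgM; [exact: exprn_continuous|exact: cphi].
- by move=> x; rewrite /= sqrrN phiN.
rewrite -(@integral_normal_pdf R 0 1) ge0_symfun_integralT//; last first.
  by move=> x; rewrite /= phiN.
congr (_ * _)%E.
(* The region [0 <= x <= t], in the variables [(t, x)]. *)
pose C : set (R * R) := [set z | 0 <= z.2 <= z.1].
have m1 : measurable_fun setT (fst : R * R -> R) by exact: measurable_fst.
have m2 : measurable_fun setT (snd : R * R -> R) by exact: measurable_snd.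
have mC : measurable C.
  rewrite (_ : C = (snd @^-1` `[0, +oo[) `&`
      ((fun z : R * R => z.1 - z.2) @^-1` `[0, +oo[)); last first.
    apply/seteqP; split => z; rewrite /C/= !in_itv/= !andbT subr_ge0.
      by move=> /andP[].
    by move=> [-> ->].
  apply: measurableI; apply: preimage_measurable => //.
  exact: measurable_funB.
pose K (z : R * R) : \bar R := (\1_C z * (z.1 * phi z.1))%:E.
have mK : measurable_fun setT K.
  apply/measurable_EFinP; apply: measurable_funM; first exact: measurable_indic.
  by apply: measurable_funM => //; exact: measurableT_comp.
have K0 z : (0 <= K z)%E.
  rewrite lee_fin indicE; have [/set_mem|_] := boolP (z \in C); last by rewrite mul0r.
  by rewrite /C/= => /andP[h1 h2]; rewrite mul1r mulr_ge0// (le_trans h1).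
transitivity (\int[mu]_t \int[mu]_x K (t, x))%E.
  rewrite integral_mkcond; apply: eq_integral => t _; rewrite patchE.
  case: ifPn => [/set_mem /= t0|/negP t0].
    transitivity (\int[mu]_x (t * phi t * \1_(`[0, t]%classic) x)%:E)%E.
      under eq_integral do rewrite EFinM.
      rewrite ge0_integralZl//; last 2 first.
      - by apply/measurable_EFinP; exact: measurable_indic.
      - by rewrite lee_fin mulr_ge0.
      rewrite integral_indic//= setIT lebesgue_measure_itv/= lte_fin.
      case: ltP => t0'; first by rewrite -EFinB -EFinM subr0; congr EFin; ring.
      have -> : t = 0 by apply/eqP; rewrite eq_le t0 t0'.
      by rewrite mule0 expr0n/= mul0r.
    apply: eq_integral => x _; rewrite /K/=.
    have -> : \1_C (t, x) = \1_`[0, t]%classic x :> R.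
      rewrite !indicE (_ : ((t, x) \in C) = (x \in `[0, t]%classic))//.
    by rewrite mulrC.
  rewrite integral0_eq// => x _; rewrite /K/= indicE memNset ?mul0r//.
  by rewrite /C/= => /andP[h1 h2]; apply: t0; apply/mem_set; exact: le_trans h2.
rewrite (@fubini_tonelli _ _ _ _ R mu mu K mK K0).
rewrite [RHS]integral_mkcond; apply: eq_integral => x _; rewrite patchE.
case: ifPn => [/set_mem /= x0|/negP x0].
  rewrite -integral_x_phi// [RHS]integral_mkcond; apply: eq_integral => t _.
  rewrite patchE /K/= indicE.
  have -> : ((t, x) \in C) = (t \in `[x, +oo[%classic).
    apply/idP/idP => /set_mem; rewrite /C/= ?in_itv/= ?andbT => h; apply/mem_set.
      by rewrite /= in_itv/= andbT; case/andP : h.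
    by rewrite /= x0.
  by case: ifP; rewrite ?mul1r ?mul0r.
rewrite integral0_eq// => t _; rewrite /K/= indicE memNset ?mul0r//.
by rewrite /C/= => /andP[h1 h2]; apply: x0; apply/mem_set.
Qed.

(** The density absorbs the polynomial: up to a constant, [x ^ 4 phi x] is bounded
    by the density of the normal law of variance [2]. *)
Lemma gauss_x4 : (\int[gauss]_x (x ^+ 4)%:E < +oo)%E.
Proof.
have mT : measurable_fun setT (fun x : R => (x ^+ 4)%:E).
  by apply/measurable_EFinP; exact: measurable_funX.
have x40 (x : R) : 0 <= x ^+ 4 by rewrite (exprM x 2 2) sqr_ge0.
rewrite integral_gauss//.
pose s : R := Num.sqrt 2.
have s2 : s ^+ 2 = 2 by rewrite sqr_sqrtr.
have s0 : s != 0 by rewrite gt_eqF// sqrtr_gt0.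
pose c : R := 64 * normal_peak 1 / normal_peak s.
have ps0 : 0 < normal_peak s by exact: normal_peak_gt0.
apply: (@le_lt_trans _ _ (\int[mu]_x (c%:E * (normal_pdf 0 s x)%:E))%E).
  apply: ge0_le_integral => //.
  - by move=> x _; rewrite -EFinM lee_fin mulr_ge0.
  - by apply: emeasurable_funM => //; exact/measurable_EFinP.
  - apply: emeasurable_funM => //; apply/measurable_EFinP.
    exact: measurable_normal_pdf.
  - move=> x _; rewrite -!EFinM lee_fin phiE normal_pdfE// /normal_fun subr0 s2.
    (* With [y = x ^ 2 / 8] one has [x ^ 4 = 64 y ^ 2] and [y <= exp y]; the
       factor [exp (2 y)] halves the exponent of the density. *)
    have key : x ^+ 4 * expR (- x ^+ 2 / 2) <= 64 * expR (- x ^+ 2 / (2 *+ 2)).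
      have -> : - x ^+ 2 / (2 *+ 2) = x ^+ 2 / 8 + x ^+ 2 / 8 + - x ^+ 2 / 2 :> R.
        by rewrite -mulr_natr; field.
      rewrite expRD mulrA ler_wpM2r ?expR_ge0// expRD -expr2.
      have -> : x ^+ 4 = 64 * (x ^+ 2 / 8) ^+ 2 by field.
      rewrite ler_wpM2l// ler_sqr ?nnegrE ?expR_ge0 ?divr_ge0 ?sqr_ge0//.
      by have := expR_ge1Dx (x ^+ 2 / 8); lra.
    rewrite mulrCA (_ : c * _ = normal_peak 1 * (64 * expR (- x ^+ 2 / (2 *+ 2)))).
      by rewrite ler_wpM2l ?normal_peak_ge0.
    by rewrite /c; field; rewrite gt_eqF.
rewrite ge0_integralZl//.
- by rewrite integral_normal_pdf mule1 ltry.
- by apply/measurable_EFinP; exact: measurable_normal_pdf.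
- by move=> x _; rewrite lee_fin normal_pdf_ge0.
- by rewrite lee_fin !mulr_ge0// ?normal_peak_ge0// invr_ge0 ltW.
Qed.

Lemma normal_prob_scale (s : R) (A : set R) : 0 < s -> measurable A ->
  normal_prob 0 s A = gauss ((fun x => s * x) @^-1` A).
Proof.
move=> s0 mA.
have mA' : measurable ((fun x => s * x) @^-1` A).
  by apply: preimage_measurable => //; exact: measurable_funM.
have mpdf : measurable_fun setT (normal_pdf 0 s : R -> R) by exact: measurable_normal_pdf.
rewrite gaussE// /normal_prob [LHS]integral_mkcond.
transitivity (\int[mu]_x (\1_A x * normal_pdf 0 s x)%:E)%E.
  apply: eq_integral => x _.
  by rewrite patchE indicE; case: ifPn => _; rewrite ?mul1r ?mul0r.
rewrite (ge0_integral_affine 0 s0); last 2 first.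
- by apply/measurable_EFinP/measurable_funM => //; exact: measurable_indic.
- by move=> x; rewrite lee_fin mulr_ge0// normal_pdf_ge0.
rewrite -ge0_integralZl//; last 3 first.
- apply/measurable_EFinP; apply: measurable_funM.
    apply: (measurableT_comp (f := \1_A : R -> R)); first exact: measurable_indic.
    by apply: measurable_funD => //; exact: measurable_funM.
  apply: (measurableT_comp mpdf).
  by apply: measurable_funD => //; exact: measurable_funM.
- by move=> x _; rewrite lee_fin mulr_ge0// normal_pdf_ge0.
- by rewrite lee_fin ltW.
apply: eq_integral => x _; rewrite -EFinM; congr EFin; rewrite addr0 mulrCA.
congr (_ * _); rewrite phiE normal_pdfE ?gt_eqF// /normal_fun subr0 mulrA.
congr (_ * expR _); last by field; rewrite gt_eqF.
rewrite /normal_peak expr1n mul1r -mulrnAr sqrtrM ?sqr_ge0// sqrtr_sqr gtr0_norm//.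
by rewrite invfM mulrA divff ?mul1r// gt_eqF.
Qed.

Section normal_law_moments.
Context d (O : measurableType d) (P : probability O R) (X : O -> R) (s : R).
Hypothesis Xs : normal_law P X s.

Let mX : measurable_fun setT X. Proof. by have [] := Xs. Qed.

Lemma normal_law_gaussian : gaussian P X.
Proof.
split => //; exists 0; have [_ XE] := normal_law_norm Xs.
have := normr_ge0 s; rewrite le_eqVlt => /orP[/eqP s0|s0]; [left|right].
  move=> A mA; rewrite XE// -s0 diracE.
  have [A0|A0] := boolP (0 \in A).
    rewrite (_ : _ @^-1` _ = setT); first exact: probability_setT.
    by apply/seteqP; split => // x _; rewrite /preimage/= mul0r; exact: set_mem.
  rewrite (_ : _ @^-1` _ = set0); first exact: measure0.
  by apply/seteqP; split => // x; rewrite /preimage/= mul0r => /mem_set; apply/negP.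
by exists `|s| => // A mA; rewrite XE// -normal_prob_scale.
Qed.

Lemma normal_law_integral (f : R -> \bar R) : measurable_fun setT f ->
  (forall x, (0 <= f x)%E) -> (\int[P]_w f (X w) = \int[gauss]_x f (s * x)%R)%E.
Proof.
move=> mf f0.
have ms : measurable_fun setT (fun x : R => s * x) by exact: measurable_funM.
rewrite -(@ge0_integral_pushforward _ _ _ _ _ _ mX P setT f)//.
rewrite -(@ge0_integral_pushforward _ _ _ _ _ _ ms gauss setT f)//.
by apply: eq_measure_integral => A mA _; have [_] := Xs; apply.
Qed.

Let msq : measurable_fun setT (fun x : R => (x ^+ 2)%:E).
Proof. by apply/measurable_EFinP; exact: measurable_funX. Qed.

Lemma normal_law_sqr : (\int[P]_w (X w ^+ 2)%:E = (s ^+ 2)%:E)%E.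
Proof.
rewrite (@normal_law_integral (fun x => (x ^+ 2)%:E))//; last first.
  by move=> x; rewrite lee_fin sqr_ge0.
under eq_integral do rewrite exprMn EFinM.
rewrite ge0_integralZl//.
- by rewrite gauss_x2 mule1.
- by move=> x _; rewrite lee_fin sqr_ge0.
- by rewrite lee_fin sqr_ge0.
Qed.

Lemma normal_law_integrable_sqr : P.-integrable setT (fun w => (X w ^+ 2)%:E).
Proof.
apply/integrableP; split.
  by apply/measurable_EFinP; exact: measurable_funX.
under eq_integral do rewrite gee0_abs ?lee_fin ?sqr_ge0//.
by rewrite normal_law_sqr ltry.
Qed.

(** The law is symmetric, so the positive and negative parts have the same
    integral, and that integral is finite by the second moment. *)
Lemma normal_law_mean : (\int[P]_w (X w)%:E = 0)%E.
Proof.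
have mp : measurable_fun setT (fun x : R => (Num.max (- x) 0)%:E).
  by apply/measurable_EFinP; apply: measurable_maxr => //; exact: measurable_funN.
have mq : measurable_fun setT (fun x : R => (Num.max x 0)%:E).
  by apply/measurable_EFinP; apply: measurable_maxr.
have Np x : (0 <= (Num.max (- x) 0 : R)%:E)%E by rewrite lee_fin le_max lexx orbT.
have Nq x : (0 <= (Num.max x 0 : R)%:E)%E by rewrite lee_fin le_max lexx orbT.
have HP : (\int[P]_w (Num.max (X w) 0)%:E = \int[P]_w (Num.max (- X w) 0)%:E)%E.
  rewrite (@normal_law_integral (fun x => (Num.max x 0)%:E))//.
  transitivity (\int[gauss]_x (Num.max (- (- s * x)) 0)%:E)%E.
    by apply: eq_integral => x _; rewrite mulNr opprK.
  have [mX' XE] := normal_lawN Xs.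
  have ms : measurable_fun setT (fun x : R => - s * x) by exact: measurable_funM.
  rewrite -(@ge0_integral_pushforward _ _ _ _ _ _ ms gauss setT
     (fun x => (Num.max (- x) 0)%:E))//.
  rewrite -(@ge0_integral_pushforward _ _ _ _ _ _ mX P setT
     (fun x => (Num.max (- x) 0)%:E))//.
  by apply: eq_measure_integral => A mA _; apply/esym; exact: XE.
rewrite integralE.
have -> : (\int[P]_w (fun w => (X w)%:E)^\+ w = \int[P]_w (Num.max (X w) 0)%:E)%E.
  by apply: eq_integral => w _; rewrite funeposE EFin_max.
have -> : (\int[P]_w (fun w => (X w)%:E)^\- w = \int[P]_w (Num.max (- X w) 0)%:E)%E.
  by apply: eq_integral => w _; rewrite funenegE EFin_max.
rewrite -HP subee// ge0_fin_numE; last by apply: integral_ge0.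
apply: (@le_lt_trans _ _ (\int[P]_w (1 + (X w ^+ 2)%:E))%E).
  apply: ge0_le_integral => //.
  - by apply/measurable_EFinP; exact: measurable_maxr.
  - apply: emeasurable_funD => //.
    by apply/measurable_EFinP; exact: measurable_funX.
  - move=> w _; rewrite -EFinD lee_fin ge_max; apply/andP; split.
      by have := sqr_ge0 (X w - 1/2); rewrite sqrrB; lra.
    by rewrite addr_ge0// sqr_ge0.
rewrite ge0_integralD//.
- have -> : (\int[P]_w 1 = 1)%E by rewrite integral_cst// mul1e; exact: probability_setT.
  by rewrite normal_law_sqr -EFinD ltry.
- by move=> w _; rewrite lee_fin sqr_ge0.
- by apply/measurable_EFinP; exact: measurable_funX.
Qed.

End normal_law_moments.

End gaussian_moments.

(** * Fair coins from a uniform number *)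

Definition uniform01 {R : realType} (A : set R) : \bar R :=
  @lebesgue_measure R (A `&` `[0, 1[).

Section uniform01.
Context {R : realType}.
Notation mu := (@lebesgue_measure R).

Let mI : @measurable _ (measurableTypeR R) `[0%R, 1%R[. Proof. by []. Qed.
Let nu : {measure set (measurableTypeR R) -> \bar R} := mrestr mu mI.

Let uniform010 : @uniform01 R set0 = 0%E.
Proof. exact: (measure0 nu). Qed.

Let uniform01_ge0 A : (0 <= @uniform01 R A)%E.
Proof. exact: (measure_ge0 nu). Qed.

Let uniform01_additive : semi_sigma_additive (@uniform01 R).
Proof. exact: (@measure_semi_sigma_additive _ _ _ nu). Qed.

HB.instance Definition _ := isMeasure.Build _ _ _ (@uniform01 R)
  uniform010 uniform01_ge0 uniform01_additive.

Let uniform01_setT : @uniform01 R setT = 1%E.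
Proof.
by rewrite /uniform01 setTI lebesgue_measure_itv/= lte_fin ltr01 -EFinB subr0.
Qed.

HB.instance Definition _ :=
  Measure_isProbability.Build _ _ _ (@uniform01 R) uniform01_setT.

(** The shift on binary expansions: [doubling x] is the fractional part of [2 x]
    for [x] in [[0, 1[]. *)
Definition doubling (x : R) : R := if x < 1 / 2 then 2 * x else 2 * x - 1.
Definition digit (x : R) : bool := ~~ (x < 1 / 2).

Let mlt : measurable_fun setT (fun x : R => x < 1 / 2).
Proof. by apply: measurable_fun_ltr. Qed.

Lemma measurable_doubling : measurable_fun setT doubling.
Proof.
apply: (measurable_fun_ifT mlt); first exact: measurable_funM.
by apply: measurable_funB => //; exact: measurable_funM.
Qed.

Lemma measurable_digit : measurable_fun setT digit.
Proof. exact: measurable_neg. Qed.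

(** On each half of [[0, 1[] doubling is an affine map of slope [2] onto [[0, 1[], so
    [lebesgue_affine] gives the factor [1 / 2]. *)
Lemma uniform01_digit (b : bool) (E : set R) : measurable E ->
  uniform01 (digit @^-1` [set b] `&` doubling @^-1` E) = (2^-1%:E * uniform01 E)%E.
Proof.
move=> mE; rewrite /uniform01.
have mE1 : measurable (E `&` `[0, 1[) by exact: measurableI.
pose c : R := if b then - 1 else 0.
have := @lebesgue_affine R 2 c _ (ltr0Sn _ _) mE1.
have -> : (fun x : R => 2 * x + c) @^-1` (E `&` `[0, 1[) =
    digit @^-1` [set b] `&` doubling @^-1` E `&` `[0, 1[; last first.
  by move=> <-; rewrite muleA -EFinM mulVf ?mul1e.
rewrite /digit /doubling /c {c}; apply/seteqP; split => x; rewrite /preimage/= !in_itv/=.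
  case: b => -[Ex /andP[x0 x1]].
    have xh : (x < 1 / 2) = false by apply/negbTE; rewrite -leNgt; lra.
    by rewrite xh; do ![split=> //]; apply/andP; split; lra.
  have xh : x < 1 / 2 by lra.
  by rewrite xh; rewrite addr0 in Ex; do ![split=> //]; apply/andP; split; lra.
case: (ltP x (1/2)) => xh; case: b => -[[]] //= _ Ex /andP[x0 x1].
  by rewrite addr0; split=> //; apply/andP; split; lra.
by split=> //; apply/andP; split; lra.
Qed.

End uniform01.

Section coins.
Context {R : realType}.

(** Conditions [A i] on the coordinates, in place of prescribed values, make the
    cylinders closed under intersection. *)
Definition cylinder : set (set (nat -> bool)) :=
  [set C | exists n (A : nat -> set bool),
     C = [set w | forall i, (i < n)%N -> A i (w i)]].

Definition coins := g_sigma_algebraType cylinder.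

Lemma cylinderT : cylinder setT.
Proof. by exists 0%N, (fun=> setT); apply/seteqP; split. Qed.

Lemma cylinder_common C D : cylinder C -> cylinder D -> exists n (A B : nat -> set bool),
  C = [set w | forall i, (i < n)%N -> A i (w i)] /\
  D = [set w | forall i, (i < n)%N -> B i (w i)].
Proof.
move=> [n [A ->]] [m [B ->]].
exists (maxn n m), (fun i => if (i < n)%N then A i else setT),
  (fun i => if (i < m)%N then B i else setT).
split; apply/seteqP; split => w h i.
- by move=> _; case: ifPn => // /h.
- by move=> im; have := h i; rewrite im leq_max im; apply.
- by move=> _; case: ifPn => // /h.
- by move=> im; have := h i; rewrite im leq_max im orbT; apply.
Qed.

Lemma cylinderI : setI_closed cylinder.
Proof.
move=> C D cC cD; have [n [A [B [-> ->]]]] := cylinder_common cC cD.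
exists n, (fun i => A i `&` B i); apply/seteqP; split => w /=.
  by move=> [h1 h2] i im; split; [exact: h1|exact: h2].
by move=> h; split => i /h[].
Qed.

Lemma cylinder_measurable : cylinder `<=` @measurable _ coins.
Proof. exact: sub_sigma_algebra. Qed.

Lemma measurable_coin i : measurable_fun setT (fun w : coins => w i).
Proof.
move=> _ B _; rewrite setTI; apply: cylinder_measurable.
exists i.+1, (fun j => if j == i then B else setT).
apply/seteqP; split => w /=; last by move=> /(_ i (ltnSn i)); rewrite eqxx.
by move=> Bw j _; case: eqVneq => // ->.
Qed.

Lemma measurable_to_coins d (O : measurableType d) (f : O -> coins) :
  (forall i, measurable_fun setT (fun w => f w i)) -> measurable_fun setT f.
Proof.
move=> mf; apply: (@measurability _ _ O coins setT f cylinder erefl).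
move=> _ [_ [n [A ->]] <-]; rewrite setTI.
rewrite (_ : _ @^-1` _ = \bigcap_(i in [set i | (i < n)%N]) (fun w => f w i) @^-1` A i).
  by apply: bigcap_measurableType => i _; exact: preimage_measurable.
by apply/seteqP; split.
Qed.

Definition digits (x : R) : coins := fun i => digit (iter i doubling x).

Lemma measurable_digits : measurable_fun setT digits.
Proof.
apply: measurable_to_coins => i.
apply: (measurableT_comp (@measurable_digit R)).
elim: i => [|i IH]; first exact: measurable_id.
exact: (measurableT_comp (@measurable_doubling R) IH).
Qed.

HB.instance Definition _ :=
  isMeasurableFun.Build _ _ _ _ digits measurable_digits.

Definition coin_law : probability coins R := distribution (@uniform01 R) digits.

Lemma coin_lawE A : coin_law A = uniform01 (digits @^-1` A).
Proof. by []. Qed.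

Definition fair_weight (S : set bool) : \bar R :=
  (((true \in S)%:R + (false \in S)%:R) / 2)%:E.

(** By induction on the number of coordinates, the first digit being split off by
    [uniform01_digit]. *)
Lemma coin_law_cylinder n (A : nat -> set bool) :
  coin_law [set w | forall i, (i < n)%N -> A i (w i)] = (\prod_(i < n) fair_weight (A i))%E.
Proof.
elim: n A => [|n IH] A.
  rewrite big_ord0 (_ : [set _ | _] = setT); first exact: probability_setT.
  by apply/seteqP; split.
rewrite big_ord_recl -(IH (fun i => A i.+1)).
set C := [set w : coins | forall i, (i < n)%N -> A i.+1 (w i)].
have mC : measurable (digits @^-1` C).
  apply: preimage_measurable; first exact: measurable_digits.
  by apply: cylinder_measurable; exists n, (fun i => A i.+1).
pose S b := if b \in A 0%N then digit @^-1` [set b] `&` doubling @^-1` (digits @^-1` C) else set0.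
have mS b : measurable (S b).
  rewrite /S; case: ifP => // _; apply: measurableI.
    by apply: preimage_measurable => //; exact: measurable_digit.
  by apply: preimage_measurable => //; exact: measurable_doubling.
have US b : uniform01 (S b) = (((b \in A 0%N)%:R / 2)%:E * coin_law C)%E.
  rewrite /S; case: ifP => _; first by rewrite uniform01_digit// mul1r.
  by rewrite mul0r mul0e; exact: measure0.
rewrite coin_lawE (_ : digits @^-1` _ = S true `|` S false).
  rewrite measureU//.
    rewrite [X in (X + _)%E]US [X in (_ + X)%E]US -ge0_muleDl ?lee_fin ?divr_ge0//.
    by rewrite -EFinD -mulrDl.
  rewrite /S; case: ifP => _; case: ifP => _; rewrite ?setI0 ?set0I//.
  by apply/seteqP; split => // x [[/= -> _] []].
have digS x i : digits x i.+1 = digits (doubling x) i by rewrite /digits iterSr.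
apply/seteqP; split => [x /= h|x].
  have h0 := h 0%N isT.
  have [dx|dx] : digit x = true \/ digit x = false by case: (digit x); [left|right].
    left; rewrite /S mem_set; last by move: h0; rewrite /digits/= dx.
    by split => // i im; rewrite -digS; exact: h.
  right; rewrite /S mem_set; last by move: h0; rewrite /digits/= dx.
  by split => // i im; rewrite -digS; exact: h.
rewrite /S; case: ifP => [/set_mem At|_]; case: ifP => [/set_mem Af|_] // [] // [/= dx h];
  by case=> [_|i im]; [rewrite /digits/= dx|rewrite digS; exact: h].
Qed.

Definition evens (w : coins) : coins := fun i => w i.*2.
Definition odds (w : coins) : coins := fun i => w i.*2.+1.

Lemma measurable_evens : measurable_fun setT evens.
Proof. by apply: measurable_to_coins => i; exact: measurable_coin. Qed.

Lemma measurable_odds : measurable_fun setT odds.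
Proof. by apply: measurable_to_coins => i; exact: measurable_coin. Qed.

(** A sequence of fair coins is dealt into two independent ones.  On cylinders
    this is a rearrangement of the factors of [coin_law_cylinder]. *)
Lemma coin_law_split (C D : set coins) : measurable C -> measurable D ->
  coin_law (evens @^-1` C `&` odds @^-1` D) = (coin_law C * coin_law D)%E.
Proof.
move=> mC mD.
have mev := measurable_evens; have mod := measurable_odds.
have gen : @measurable _ coins `<=` <<s cylinder >> by [].
move: mC mD; apply: (pair_pi_lambda mev mod cylinderI cylinderT cylinder_measurable gen).
move=> {mev mod gen C D} C D cC cD; have [n [A [A' [-> ->]]]] := cylinder_common cC cD.
(* The cylinder that interleaves the two. *)
pose B i := if odd i then A' i./2 else A i./2.
transitivity (coin_law [set w | forall i, (i < n.*2)%N -> B i (w i)]).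
  congr (coin_law _); apply/seteqP; split => [w [hC hD] i im|w h].
    have i2 : (i./2 < n)%N by rewrite ltn_half_double.
    have := hC _ i2; have := hD _ i2; rewrite /B /evens /odds.
    by rewrite -[in w i](odd_double_half i); case: (odd i).
  split => i im.
    by have := h i.*2; rewrite /B odd_double doubleK; apply; rewrite ltn_double.
  have := h i.*2.+1; rewrite /B /= odd_double /= uphalf_double.
  by apply; rewrite ltn_Sdouble.
rewrite !coin_law_cylinder -big_split/=; elim: n => [|n IH]; first by rewrite !big_ord0.
rewrite doubleS !big_ord_recr/= IH -muleA; congr (_ * (_ * _))%E.
  by rewrite /B odd_double doubleK.
by rewrite /B /= odd_double /= uphalf_double.
Qed.

End coins.

(** * A standard normal variable from coins *)

Lemma cvg_half_pow (R : realType) : 2^-1 ^+ n @[n --> \oo] --> (0 : R).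
Proof. by apply: cvg_expr; rewrite ger0_norm ?invf_lt1 ?invr_ge0// ltr1n. Qed.

Section normal_coin.
Context {R : realType}.
Notation mu := (@lebesgue_measure R).
Notation gauss := (@stdnormal R).
Notation coin_law := (@coin_law R).

Definition bits (n : nat) (w : coins) : R := \sum_(i < n) (w i)%:R / 2 ^+ i.+1.

Lemma bits_digits n (x : R) : x \in `[0, 1[ ->
  `|x - bits n (digits x)| <= 2^-1 ^+ n.
Proof.
move=> x01.
have it (y : R) : y \in `[0, 1[ -> doubling y \in `[0, 1[.
  rewrite !in_itv/= /doubling => /andP[y0 y1].
  by case: (ltP y (1 / 2)) => yh; apply/andP; split; lra.
have itn k : iter k doubling x \in `[0, 1[ by elim: k => //= k IH; exact: it.
(* The remainder after [k] digits is the [k]-th shift of [x], scaled. *)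
have E k : x = bits k (digits x) + iter k doubling x / 2 ^+ k.
  elim: k => [|k IH]; first by rewrite /bits big_ord0 add0r expr0 divr1.
  rewrite [LHS]IH /bits big_ord_recr/= -addrA; congr (_ + _).
  rewrite /digits; move: (iter k doubling x) => y; rewrite /digit /doubling exprS.
  have := @expf_neq0 R 2 k (lt0r_neq0 (ltr0Sn R 1)); move: (2 ^+ k) => p p0.
  by case: (ltP y (1 / 2)) => _ /=; field.
rewrite [X in X - _](E n) addrC addKr exprVn normrM.
have := itn n; rewrite in_itv/= => /andP[h0 h1].
rewrite !ger0_norm ?invr_ge0 ?exprn_ge0//.
by rewrite ler_piMl ?invr_ge0 ?exprn_ge0// ltW.
Qed.

Lemma is_cvg_bits w : cvgn (bits ^~ w).
Proof.
apply: nondecreasing_is_cvgn => [n m nm|].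
  rewrite /bits -(subnKC nm) big_split_ord/= lerDl sumr_ge0// => i _.
exists 1 => _ [n _ <-].
suff : bits n w <= 1 - 2^-1 ^+ n.
  by move=> h; apply: (le_trans h); rewrite gerBl exprn_ge0.
elim: n => [|n IH]; first by rewrite /bits big_ord0 expr0 subrr.
rewrite /bits big_ord_recr/= -/(bits n w).
have h : (w n)%:R / 2 ^+ n.+1 <= 2^-1 ^+ n.+1 :> R.
  by rewrite -exprVn ler_piMl ?exprn_ge0// lern1; case: (w n).
have e : 2^-1 ^+ n.+1 = 2^-1 * 2^-1 ^+ n :> R by rewrite exprS.
rewrite e in h *; move: (_ / _) h => t h.
by move: (2^-1 ^+ n) IH h => z IH h; lra.
Qed.

Definition expansion (w : coins) : R := limn (bits ^~ w).

Lemma measurable_expansion : measurable_fun setT expansion.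
Proof.
apply: (@measurable_fun_cvg _ coins R setT bits) => //.
  move=> n; rewrite (_ : bits n = (fun w => \sum_(i < n) (w i)%:R / 2 ^+ i.+1))//.
  apply: measurable_sum => i; apply: measurable_funM => //.
  by apply: measurableT_comp => //; exact: measurable_coin.
by move=> w _; exact: is_cvg_bits.
Qed.

Lemma expansion_digits (x : R) : x \in `[0, 1[ -> expansion (digits x) = x.
Proof.
move=> x01; apply/cvg_lim => //; apply/cvgrPdist_le => e e0.
have c := @cvg_half_pow R.
near=> n; apply: (le_trans (bits_digits n x01)).
by near: n; exact: (cvgr_le _ c).
Unshelve. all: by end_near. Qed.

(** On [[0, 1[] the expansion of the digits of a number is that number. *)
Lemma coin_law_expansion (A : set R) : measurable A ->
  coin_law (expansion @^-1` A) = uniform01 A.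
Proof.
move=> mA; rewrite coin_lawE /uniform01; congr (mu _).
apply/seteqP; split => x [/= h x01]; split => //; move: h;
  by rewrite /preimage/= expansion_digits.
Qed.

Definition normal_cdf (x : R) : R := fine (gauss `]-oo, x]).

Lemma normal_cdf_nd : {homo normal_cdf : x y / x <= y}.
Proof.
move=> x y xy; rewrite /normal_cdf fine_le ?fin_num_measure//.
by apply: le_measure; rewrite ?inE//; exact: subitvPr.
Qed.

Lemma normal_cdfE x : gauss `]-oo, x] = (normal_cdf x)%:E.
Proof. by rewrite /normal_cdf fineK ?fin_num_measure. Qed.

Lemma normal_cdf_ge0 x : 0 <= normal_cdf x.
Proof. by rewrite fine_ge0. Qed.

Lemma normal_cdf_le1 x : normal_cdf x <= 1.
Proof. by rewrite -lee_fin -normal_cdfE; exact: probability_le1. Qed.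

Lemma normal_cdf_small u : 0 < u -> exists x, normal_cdf x < u.
Proof.
move=> u0.
have h := @prob_shrink R _ R gauss (fun n => `]-oo, (- n%:R)]%classic) _ _.
have : fine (gauss `]-oo, - n%:R]) @[n --> \oo] --> fine (gauss (\bigcap_n `]-oo, - n%:R]%classic)).
  apply: h => [//|n m nm]; apply: subitvPr.
  by rewrite bnd_simp lerN2 ler_nat.
rewrite (_ : \bigcap_n _ = set0); last first.
  rewrite -subset0 => t /(_ (Num.truncn (- t)).+1 Logic.I).
  by rewrite /= in_itv/= leNgt => /negP; apply; rewrite ltrNl archimedean.Num.Theory.truncnS_gt.
rewrite (_ : gauss set0 = 0%E); last exact: measure0.
move=> c; have [n] := filter_ex (cvgr_lt _ c _ u0).
by exists (- n%:R).
Qed.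

Lemma normal_cdf_big u : u < 1 -> exists x, u <= normal_cdf x.
Proof.
move=> u1.
have : gauss `]-oo, n%:R] @[n --> \oo] --> gauss (\bigcup_n `]-oo, n%:R]%classic).
  apply: nondecreasing_cvg_mu => //; first exact: bigcupT_measurable.
  by move=> n m nm; apply/subsetPset; apply: subitvPr; rewrite bnd_simp ler_nat.
rewrite (_ : \bigcup_n _ = setT); last first.
  rewrite -subTset => t _; exists (Num.truncn t).+1 => //=.
  by rewrite in_itv/= ltW// archimedean.Num.Theory.truncnS_gt.
rewrite (_ : gauss setT = 1%E); last exact: probability_setT.
move=> /fine_cvgP[_ c].
have [n /ltW] := filter_ex (cvgr_gt _ c _ u1).
by exists n%:R.
Qed.

Lemma normal_cdf_right u x : (forall e, 0 < e -> u <= normal_cdf (x + e)) -> u <= normal_cdf x.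
Proof.
move=> h.
have := @prob_shrink R _ R gauss (fun n => `]-oo, (x + n.+1%:R^-1)]%classic) _ _.
rewrite -itvNycEbigcap => c.
apply: (cvgr_to_ge (c _ _)) => //.
  move=> n m nm; apply: subitvPr; rewrite bnd_simp lerD2l.
  by rewrite lef_pV2 ?posrE// ler_nat.
by apply: nearW => n; apply: h; rewrite invr_gt0.
Qed.

Definition quantile (u : R) : R :=
  if (0 < u) && (u < 1) then inf [set x | u <= normal_cdf x] else 0.

(** The Galois connection between a distribution function and its quantile
    function; it rests on right continuity. *)
Lemma quantile_le (u x : R) : 0 < u < 1 -> (quantile u <= x) = (u <= normal_cdf x).
Proof.
move=> u01; rewrite /quantile u01; have /andP[u0 u1] := u01.
have hi : has_inf [set x | u <= normal_cdf x].
  split; first by have [y] := normal_cdf_big u1; exists y.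
  have [y yu] := normal_cdf_small u0; exists y => z /= uz.
  by rewrite leNgt; apply/negP => /ltW/normal_cdf_nd; rewrite leNgt (lt_le_trans yu).
apply/idP/idP => [h|h]; last by apply: ge_inf; [exact: hi.2|].
apply: normal_cdf_right => e e0.
have [y /= uy ye] := inf_adherent e0 hi.
by apply: (le_trans uy); apply: normal_cdf_nd; apply: (le_trans (ltW ye)); rewrite lerD2r.
Qed.

Lemma measurable_quantile : measurable_fun setT quantile.
Proof.
apply: (measurability _ (RGenOInfty.measurableE R)) => _ [_ [x ->] <-].
rewrite setTI -setCitvl preimage_setC; apply: measurableC.
suff : measurable (quantile @^-1` `]-oo, x]) by [].
rewrite (_ : _ @^-1` _ = (`]0, 1[ `&` `]-oo, normal_cdf x]) `|` (~` `]0, 1[ `&` [set _ | 0 <= x])).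
  apply: measurableU; apply: measurableI => //; first exact: measurableC.
  by case: (leP 0 x) => x0; [rewrite (_ : [set _ | _] = setT)|rewrite (_ : [set _ | _] = set0)] => //;
   apply/seteqP; split.
apply/seteqP; split => u; rewrite /preimage/= !in_itv/=.
  have [u01|u01] := boolP (0 < u < 1); first by rewrite quantile_le//; left.
  by rewrite /quantile (negbTE u01) => x0; right; split => //; apply/negP.
move=> [[u01 h]|[/negP u01 x0]]; first by rewrite quantile_le.
by rewrite /quantile (negbTE u01).
Qed.

Lemma uniform01_quantile (x : R) : uniform01 (quantile @^-1` `]-oo, x]) = gauss `]-oo, x].
Proof.
rewrite normal_cdfE.
have mq : measurable (quantile @^-1` `]-oo, x]).
  by apply: preimage_measurable => //; exact: measurable_quantile.
have P0 := normal_cdf_ge0 x; have P1 := normal_cdf_le1 x.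
apply/eqP; rewrite eq_le; apply/andP; split.
  apply: (@le_trans _ _ (mu `[0, normal_cdf x])).
    rewrite /uniform01; apply: le_measure; rewrite ?inE//; first exact: measurableI.
    move=> u [] /=; rewrite !in_itv/= => ux /andP[u0 u1]; rewrite u0/=.
    move: u0; rewrite le_eqVlt => /orP[/eqP <-//|u0].
    by rewrite -quantile_le// u0.
  by rewrite lebesgue_measure_itv/=; case: ifP => _; rewrite ?lee_fin ?subr0 ?lexx.
apply: (@le_trans _ _ (mu `]0, normal_cdf x[)).
  rewrite lebesgue_measure_itv/= lte_fin; case: ltP => h; first by rewrite -EFinB subr0.
  by rewrite lee_fin.
rewrite /uniform01; apply: le_measure; rewrite ?inE//; first exact: measurableI.
move=> u /=; rewrite !in_itv/= => /andP[u0 u1].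
have u1' : u < 1 by exact: lt_le_trans P1.
by rewrite quantile_le ?u0//= ltW//; split => //; rewrite ltW.
Qed.

Definition coin_normal (w : coins) : R := quantile (expansion w).

Lemma measurable_coin_normal : measurable_fun setT coin_normal.
Proof.
by apply: measurableT_comp; [exact: measurable_quantile|exact: measurable_expansion].
Qed.

Lemma coin_law_coin_normal (A : set R) : measurable A -> coin_law (coin_normal @^-1` A) = gauss A.
Proof.
move=> mA.
pose G : set (set R) := [set A | A = setT \/ exists x, A = `]-oo, x]%classic].
have := @event_pi_lambda R _ _ _ coins R R coin_law gauss coin_normal id G setT.
rewrite probability_setT => H.
have := H _ _ _ _ _ _ _ _ A mA; rewrite setIT mule1; apply => //.
- exact: measurable_coin_normal.
- move=> _ _ [->|[x ->]] [->|[y ->]]; rewrite ?setTI ?setIT.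
  + by left. + by right; exists y. + by right; exists x.
  right; exists (Num.min x y); apply/seteqP; split => z /=; rewrite !in_itv/= le_min.
    by move=> [-> ->].
  by move=> /andP[].
- by left.
- by move=> _ [->|[x ->]].
- suff : (@ocitv R).-sigma.-measurable `<=` <<s G >> by [].
  rewrite RGenOInfty.measurableE; apply: smallest_sub.
    exact: smallest_sigma_algebra.
  move=> _ [x ->]; rewrite -setCitvl; apply: sigma_algebraC.
  by apply: sub_sigma_algebra; right; exists x.
- move=> _ [->|[x ->]]; rewrite setIT mule1.
    rewrite !preimage_setT probability_setT; apply/esym; exact: probability_setT.
  transitivity (uniform01 (quantile @^-1` `]-oo, x])); last exact: uniform01_quantile.
  rewrite -coin_law_expansion//.
  by apply: preimage_measurable => //; exact: measurable_quantile.
Qed.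

End normal_coin.

(** * A probability space that splits into two copies of itself *)

Section splitting.
Context {R : realType}.
Notation gauss := (@stdnormal R).
Notation coin_law := (@coin_law R).

(** In terms of paths, [G s] is the value at the final time of the path that the
    source [s] generates, and [l s], [r s] are the sources of its two halves.
    The last clause says that the increments over the halves, each of half the
    variance, add up to that value. *)
Definition splits d (S : measurableType d) (Q : probability S R) (G : S -> R)
    (l r : S -> S) :=
  [/\ normal_law Q G 1, measurable_fun setT l, measurable_fun setT r,
      forall A B, measurable A -> measurable B ->
        Q (l @^-1` A `&` r @^-1` B) = (Q A * Q B)%E &
      forall s, G (l s) + G (r s) = Num.sqrt 2 * G s].

(** A point is the endpoint of the path together with the coins that decide the
    rest of it. *)
Let S : measurableType _ := (R * coins)%type.
Let Q : probability S R := (gauss \x coin_law)%E.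
Let c : R := (Num.sqrt 2)^-1.
Let ends (z : S) : R * R := reflect2 c c (z.1, coin_normal (evens z.2)).
Let l (z : S) : S := ((ends z).1, evens (odds z.2)).
Let r (z : S) : S := ((ends z).2, odds (odds z.2)).

Let c0 : 0 < c. Proof. by rewrite invr_gt0 sqrtr_gt0. Qed.
Let c2 : c ^+ 2 + c ^+ 2 = 1.
Proof. by rewrite exprVn sqr_sqrtr//; field. Qed.

Let mw : measurable_fun setT (snd : S -> coins).
Proof. exact: measurable_snd. Qed.

Let mx : measurable_fun setT (fst : S -> R).
Proof. exact: measurable_fst. Qed.

Let mxi : measurable_fun setT (fun z : S => coin_normal (evens z.2) : R).
Proof.
apply: (measurableT_comp (@measurable_coin_normal R)).
exact: (measurableT_comp measurable_evens).
Qed.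

Let mpair : measurable_fun setT (fun z : S => (z.1, coin_normal (evens z.2)) : R * R).
Proof. exact: measurable_fun_pair. Qed.

Let mends : measurable_fun setT ends.
Proof. exact: (measurableT_comp (measurable_reflect2 c c) mpair). Qed.

Let ml : measurable_fun setT l.
Proof.
apply: measurable_fun_pair; first exact: (measurableT_comp measurable_fst mends).
apply: (measurableT_comp measurable_evens).
exact: (measurableT_comp measurable_odds).
Qed.

Let mr : measurable_fun setT r.
Proof.
apply: measurable_fun_pair; first exact: (measurableT_comp measurable_snd mends).
apply: (measurableT_comp measurable_odds).
exact: (measurableT_comp measurable_odds).
Qed.

Let gaussT : gauss setT = 1%E. Proof. exact: probability_setT. Qed.
Let coin_lawT : coin_law setT = 1%E. Proof. exact: probability_setT. Qed.

Let QX (A : set R) (E : set coins) : measurable A -> measurable E ->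
  Q (A `*` E) = (gauss A * coin_law E)%E.
Proof. by move=> mA mE; exact: product_measure1E. Qed.

Let coin_law_odds (E : set coins) : measurable E -> coin_law (odds @^-1` E) = coin_law E.
Proof.
move=> mE; have := @coin_law_split R setT E measurableT mE.
by rewrite preimage_setT setTI coin_lawT mul1e.
Qed.

(** The coins passed on to the halves fix an event [Ev].  On it the pair made of
    the current endpoint and the fresh normal variable still has the product
    law; [event_pi_lambda] extends this from rectangles to the preimage of a
    rectangle under the reflection. *)
Let split_rect (A B : set R) (E F : set coins) :
  measurable A -> measurable B -> measurable E -> measurable F ->
  Q (l @^-1` (A `*` E) `&` r @^-1` (B `*` F)) = (Q (A `*` E) * Q (B `*` F))%E.
Proof.
move=> mA mB mE mF.
pose D := evens @^-1` E `&` odds @^-1` F.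
have mD : measurable D.
  by apply: measurableI; apply: preimage_measurable => //;
    [exact: measurable_evens|exact: measurable_odds].
have moD : measurable (odds @^-1` D).
  by apply: preimage_measurable => //; exact: measurable_odds.
have kD : coin_law (odds @^-1` D) = (coin_law E * coin_law F)%E.
  by rewrite coin_law_odds// coin_law_split.
pose Ev : set S := setT `*` (odds @^-1` D).
have mEv : measurable Ev by exact: measurableX.
have QEv : Q Ev = (coin_law E * coin_law F)%E by rewrite QX// gaussT mul1e kD.
have mr2 : measurable (reflect2 c c @^-1` (A `*` B)).
  by apply: preimage_measurable; [exact: measurable_reflect2|exact: measurableX].
have := @event_pi_lambda R _ _ _ S (R * R)%type (R * R)%type Q (gauss \x gauss)%E
  (fun z : S => (z.1, coin_normal (evens z.2))) id (rectangles R R) Ev.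
have [rI rT rm rg] := rectanglesP R R.
move=> /(_ _ _ _ rI rT rm rg _ _ mr2) H.
rewrite (_ : l @^-1` _ `&` _ =
    (fun z : S => (z.1, coin_normal (evens z.2))) @^-1` (reflect2 c c @^-1` (A `*` B)) `&` Ev); last first.
  apply/seteqP; split => z; rewrite /preimage /l /r /ends /Ev /D/=.
    by move=> [[? ?] [? ?]].
  by move=> [[? ?] [_ [? ?]]].
rewrite H//.
- rewrite QEv [X in (X * _)%E](_ : _ = (gauss A * gauss B)%E).
    by rewrite !QX// muleACA.
  exact: gauss_reflect_rect.
- move=> _ [B1 mB1 [C1 mC1 <-]].
  have mnC : measurable (coin_normal @^-1` C1 : set coins).
    by apply: preimage_measurable => //; exact: measurable_coin_normal.
  have -> : (fun z : S => (z.1, coin_normal (evens z.2))) @^-1` (B1 `*` C1) `&` Ev =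
      B1 `*` (evens @^-1` (coin_normal @^-1` C1) `&` odds @^-1` D).
    apply/seteqP; split => z; rewrite /preimage /Ev/=.
      by move=> [[? ?] [_ ?]].
    by move=> [? [? ?]].
  rewrite QX//; last first.
    apply: measurableI => //.
    by apply: preimage_measurable => //; exact: measurable_evens.
  rewrite coin_law_split// coin_law_coin_normal// QEv coin_law_split// preimage_id.
  rewrite muleA; congr (_ * _)%E; apply/esym; exact: product_measure1E.
Qed.

(** The fresh normal variable comes from the coins of even rank; those of odd
    rank are dealt to the two halves. *)
Lemma splits_exists : exists d (S : measurableType d) (Q : probability S R)
  (G : S -> R) (l r : S -> S), splits Q G l r.
Proof.
exists _, S, Q, fst, l, r; split => //.
- split => // A mA; rewrite (_ : _ @^-1` _ = A `*` setT); last first.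
    by apply/seteqP; split => [[x y]//= Bx|[x y] []//].
  rewrite QX// coin_lawT mule1; congr (gauss _).
  by apply/seteqP; split => x; rewrite /preimage/= mul1r.
- have [rI rT rm rg] := rectanglesP R coins.
  apply: (pair_pi_lambda ml mr rI rT rm rg) => A B.
  move=> [A1 mA1 [E mE <-]] [B1 mB1 [F mF <-]].
  exact: split_rect.
- move=> z; rewrite /l /r /ends /reflect2/= addrACA subrr addr0 -mulrDl.
  congr (_ * _).
  apply: (mulIf (lt0r_neq0 c0)); rewrite mulrDl -expr2 c2.
  by rewrite /c divff// gt_eqF// sqrtr_gt0.
Qed.

End splitting.

(** * Consequences of splitting: maxima, normality, independence *)

Section joint_law_constant.
Context {R : realType}.

(** The events that concern the constant members have probability zero or one. *)
Lemma joint_law_constant d (O : measurableType d) (P : probability O R)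
    (I : finType) (X : I -> O -> R) (i0 : I) (c : I -> R) :
  (forall i, measurable_fun setT (X i)) ->
  (forall i, i != i0 -> X i = cst (c i)) -> joint_law P X P X.
Proof.
move=> mX Xc A mA.
have PX i : i != i0 -> X i @^-1` A i = if c i \in A i then setT else set0.
  move=> ii0; rewrite Xc// preimage_cst.
  by [].
have [cA|] := pselect (forall i, i != i0 -> c i \in A i).
  rewrite (bigD1 i0)//= big1 ?mule1; last first.
    by move=> i ii0; rewrite PX// cA//; exact: probability_setT.
  congr (P _); apply/seteqP; split => [w /(_ i0 Logic.I)//|w Aw i _].
  have [->//|ii0] := eqVneq i i0.
  by rewrite PX// cA.
move=> /existsNP[i /not_implyP[ii0 /negP/negbTE cA]].
rewrite (bigD1 i)//= PX// cA measure0 mul0e.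
rewrite (_ : \bigcap_(i in _) _ = set0) ?measure0// -subset0 => w /(_ i Logic.I).
by rewrite PX// cA.
Qed.

End joint_law_constant.

Section split_consequences.
Context {R : realType} d (S : measurableType d) (Q : probability S R).
Variables (G : S -> R) (l r : S -> S).
Hypothesis H : splits Q G l r.

Let mG : measurable_fun setT G. Proof. by have [[]] := H. Qed.
Let ml : measurable_fun setT l. Proof. by have [] := H. Qed.
Let mr : measurable_fun setT r. Proof. by have [] := H. Qed.
Let Glr s : G (l s) + G (r s) = Num.sqrt 2 * G s. Proof. by have [] := H. Qed.
Let ind A B : measurable A -> measurable B ->
  Q (l @^-1` A `&` r @^-1` B) = (Q A * Q B)%E.
Proof. by have [_ _ _ + _] := H; apply. Qed.

Lemma split_l A : measurable A -> Q (l @^-1` A) = Q A.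
Proof.
by move=> mA; have := ind mA measurableT; rewrite preimage_setT setIT probability_setT mule1.
Qed.

Lemma split_r A : measurable A -> Q (r @^-1` A) = Q A.
Proof.
by move=> mA; have := ind measurableT mA; rewrite preimage_setT setTI probability_setT mul1e.
Qed.

Lemma integral_split_l (f : S -> \bar R) : measurable_fun setT f ->
  (forall s, 0 <= f s)%E -> (\int[Q]_s f (l s) = \int[Q]_s f s)%E.
Proof.
move=> mf f0; rewrite -(@ge0_integral_pushforward _ _ _ _ _ _ ml Q setT f)//.
by apply: eq_measure_integral => A mA _; exact: split_l.
Qed.

Lemma integral_split_r (f : S -> \bar R) : measurable_fun setT f ->
  (forall s, 0 <= f s)%E -> (\int[Q]_s f (r s) = \int[Q]_s f s)%E.
Proof.
move=> mf f0; rewrite -(@ge0_integral_pushforward _ _ _ _ _ _ mr Q setT f)//.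
by apply: eq_measure_integral => A mA _; exact: split_r.
Qed.

Section dyadic_bound.
Variable h : S -> R.
Hypotheses (mh : measurable_fun setT h) (h0 : forall s, 0 <= h s).
Hypothesis h4 : (\int[Q]_s (h s ^+ 4)%:E < +oo)%E.

(** The growth of a quantity that, at each level, is the worse of the two halves
    scaled by [1 / sqrt 2].  Both distances of interest, between consecutive
    polygons and between polygons and step functions, are bounded in this way
    with different initial functions [h]. *)
Fixpoint dyadic_bound n s : R := if n is m.+1 then
  Num.max (dyadic_bound m (l s)) (dyadic_bound m (r s)) / Num.sqrt 2 else h s.

Lemma dyadic_bound_ge0 n s : 0 <= dyadic_bound n s.
Proof.
elim: n s => [|n IH] s //=.
by rewrite divr_ge0// le_max IH.
Qed.

Lemma measurable_dyadic_bound n : measurable_fun setT (dyadic_bound n).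
Proof.
elim: n => [|n IH] //=; apply: measurable_funM => //.
by apply: measurable_maxr; [exact: (measurableT_comp IH ml)|exact: (measurableT_comp IH mr)].
Qed.

Let mb4 n : measurable_fun setT (fun s => (dyadic_bound n s ^+ 4)%:E).
Proof. by apply/measurable_EFinP/measurable_funX; exact: measurable_dyadic_bound. Qed.

Let b40 n s : (0 <= (dyadic_bound n s ^+ 4)%:E)%E.
Proof. by rewrite lee_fin exprn_ge0// dyadic_bound_ge0. Qed.

(** The fourth power of a maximum is at most the sum of the fourth powers, each of
    the two terms has the moment of the previous level because [l] and [r]
    preserve [Q], and [sqrt 2 ^ 4 = 4]: the factor is [2 / 4]. *)
Lemma dyadic_bound_moment n :
  (\int[Q]_s (dyadic_bound n s ^+ 4)%:E <= (2^-1 ^+ n)%:E * \int[Q]_s (h s ^+ 4)%:E)%E.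
Proof.
elim: n => [|n IH]; first by rewrite expr0 mul1e.
apply: (@le_trans _ _ (\int[Q]_s (4^-1%:E *
    ((dyadic_bound n (l s) ^+ 4)%:E + (dyadic_bound n (r s) ^+ 4)%:E)))%E).
  apply: ge0_le_integral => //.
  - apply: emeasurable_funM => //; apply: emeasurable_funD.
      exact: (measurableT_comp (mb4 n) ml).
    exact: (measurableT_comp (mb4 n) mr).
  - move=> s _; rewrite -EFinD -EFinM lee_fin /= expr_div_n.
    have -> : Num.sqrt 2 ^+ 4 = 4 :> R by rewrite (exprM _ 2 2) sqr_sqrtr// -natrX.
    rewrite mulrC ler_wpM2l//.
    have := dyadic_bound_ge0 n (l s); have := dyadic_bound_ge0 n (r s).
    move: (dyadic_bound n (l s)) (dyadic_bound n (r s)) => a b b0 a0.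
    by rewrite maxEle; case: ifP => _; rewrite ?lerDl ?lerDr exprn_ge0.
rewrite ge0_integralZl//; last 2 first.
- apply: emeasurable_funD; first exact: (measurableT_comp (mb4 n) ml).
  exact: (measurableT_comp (mb4 n) mr).
- by move=> s _; exact: adde_ge0.
rewrite ge0_integralD//; last 2 first.
- exact: (measurableT_comp (mb4 n) ml).
- exact: (measurableT_comp (mb4 n) mr).
rewrite (integral_split_l (mb4 n))// (integral_split_r (mb4 n))//.
rewrite -mule2n -mule_natl muleA -EFinM.
have -> : 4^-1 * 2 = 2^-1 :> R by field.
rewrite exprS EFinM -muleA lee_pmul2l ?lte_fin ?invr_gt0//.
Qed.

(** Any rate below [1] whose fourth power exceeds [1 / 2] would do: the
    probabilities in the Borel-Cantelli argument are of order
    [(2 * decay_rate ^ 4) ^ - n]. *)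
Definition decay_rate : R := 9 / 10.
Definition tame : set S := [set s | \forall n \near \oo, dyadic_bound n s <= decay_rate ^+ n].

Let F n := [set s | decay_rate ^+ n < dyadic_bound n s].

Let decay_rate0 : 0 < decay_rate. Proof. by rewrite divr_gt0. Qed.

Let mF n : measurable (F n).
Proof.
rewrite (_ : F n = dyadic_bound n @^-1` `]decay_rate ^+ n, +oo[).
  exact: preimage_measurable (measurable_dyadic_bound n) _.
by apply/seteqP; split => s /=; rewrite in_itv/= andbT.
Qed.

Let tameE : tame = ~` lim_sup_set F.
Proof.
apply/seteqP; split => s /=.
  by move=> [N _ hN] /(_ N Logic.I)[n /= Nn]; rewrite /F/= ltNge hN.
move=> h'; have [N hN] : exists N, ~ (\bigcup_(j >= N) F j) s.
  by apply/existsNP => h''; apply: h' => N _; exact: h''.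
exists N => // n /= Nn; rewrite leNgt; apply/negP => Fn; apply: hN.
by exists n.
Qed.

Lemma measurable_tame : measurable tame.
Proof.
rewrite tameE; apply: measurableC; apply: bigcapT_measurable => n.
by apply: bigcup_measurable.
Qed.

(** Markov's inequality for the fourth moment, summed over [n] in the
    Borel-Cantelli lemma. *)
Lemma prob_tame : Q tame = 1%E.
Proof.
have mL : measurable (lim_sup_set F).
  by rewrite -[lim_sup_set F]setCK -tameE; apply: measurableC; exact: measurable_tame.
rewrite tameE probability_setC// (lim_sup_set_cvg0 mF) ?sube0//.
pose I := (\int[Q]_s (h s ^+ 4)%:E)%E.
have I0 : (0 <= I)%E by apply: integral_ge0 => s _; rewrite lee_fin exprn_ge0.
have Ifin : I = (fine I)%:E by rewrite fineK// ge0_fin_numE.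
(* The ratio of the geometric series that bounds the probabilities. *)
pose z : R := (2 * decay_rate ^+ 4)^-1.
have QF n : (Q (F n) <= (fine I * z ^+ n)%:E)%E.
  have r4 : 0 < (decay_rate ^+ n) ^+ 4 by rewrite !exprn_gt0.
  have : (((decay_rate ^+ n) ^+ 4)%:E * Q (F n) <= \int[Q]_s (dyadic_bound n s ^+ 4)%:E)%E.
    rewrite -[Q (F n)]mul1e -(@setIT _ (F n)) -integral_indic// mul1e -ge0_integralZl//; last 2 first.
    - by apply/measurable_EFinP; exact: measurable_indic.
    - by rewrite lee_fin ltW.
    apply: ge0_le_integral => //.
    - by move=> x _; rewrite -EFinM lee_fin mulr_ge0// ltW.
    - apply: emeasurable_funM => //.
      by apply/measurable_EFinP; exact: measurable_indic.
    move=> s _; rewrite -EFinM lee_fin indicE; have [/set_mem Fs|_] := boolP (s \in F n).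
      by rewrite mulr1 lerXn2r ?nnegrE ?dyadic_bound_ge0// ?exprn_ge0 ?ltW.
    by rewrite mulr0 exprn_ge0// dyadic_bound_ge0.
  move=> /le_trans/(_ (dyadic_bound_moment n)); rewrite -/I Ifin -EFinM.
  have Qf : (fine (Q (F n)))%:E = Q (F n) by rewrite fineK// fin_num_measure.
  rewrite -Qf -EFinM !lee_fin => hh.
  have -> : z ^+ n = 2^-1 ^+ n / (decay_rate ^+ n) ^+ 4.
    rewrite /z !exprVn exprMn invfM; congr (_ * _^-1); exact: exprAC.
  by rewrite /= mulrA ler_pdivlMr// mulrC [fine I * _]mulrC.
apply: (@le_lt_trans _ _ (\sum_(0 <= n <oo) (fine I * z ^+ n)%:E)%E).
  by apply: lee_nneseries => n *; [exact: measure_ge0|exact: QF].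
have z1 : `|z| < 1.
  rewrite ger0_norm ?invr_ge0 ?mulr_ge0 ?exprn_ge0 ?ltW// invf_lt1 ?mulr_gt0 ?exprn_gt0//.
  by rewrite /decay_rate; lra.
have := @cvg_geometric_series R (fine I) z z1.
rewrite (_ : (\sum_(0 <= n <oo) _)%E = (fine I / (1 - z))%:E) ?ltry//.
apply/cvg_lim => //.
rewrite (_ : (fun n => _) = EFin \o series (geometric (fine I) z)).
  by apply: cvg_EFin; [exact: nearW|exact: cvg_geometric_series].
by apply/funext => n /=; rewrite /series/= -sumEFin.
Qed.

End dyadic_bound.

(** The two summands are independent normal variables with the scales of [X] and
    [Y]. *)
Lemma normal_law_step (X Y : S -> R) (a b : R) : normal_law Q X a -> normal_law Q Y b ->
  normal_law Q (fun s => (X (l s) + Y (r s)) / Num.sqrt 2) (Num.sqrt ((a ^+ 2 + b ^+ 2) / 2)).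
Proof.
move=> Xa Yb; have [mX XE] := Xa; have [mY YE] := Yb.
have lX : normal_law Q (X \o l) a.
  split; first exact: measurableT_comp.
  move=> A mA; rewrite -XE// comp_preimage; apply: split_l.
  exact: preimage_measurable.
have rY : normal_law Q (Y \o r) b.
  split; first exact: measurableT_comp.
  move=> A mA; rewrite -YE// comp_preimage; apply: split_r.
  exact: preimage_measurable.
have := normal_lawD lX rY; rewrite sqrtrM ?addr_ge0 ?sqr_ge0// sqrtrV// mulrC => h.
rewrite (_ : (fun s => _) = (fun s => (Num.sqrt 2)^-1 * ((X \o l) s + (Y \o r) s))); last first.
  by apply/funext => s /=; rewrite mulrC.
apply: normal_lawZ; apply: h => A B mA mB.
have mXA : measurable (X @^-1` A) by exact: preimage_measurable.
have mYB : measurable (Y @^-1` B) by exact: preimage_measurable.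
transitivity (Q (l @^-1` (X @^-1` A) `&` r @^-1` (Y @^-1` B))) => //.
by rewrite (ind mXA mYB) -[in LHS](split_l mXA) -[in LHS](split_r mYB).
Qed.

(** The families [X] composed with [l] and [Y] composed with [r] are independent of
    each other and each is independent within itself, so the pairs are
    independent over [i]. *)
Lemma indep_step (I : finType) (X Y : I -> S -> R) :
  (forall i, measurable_fun setT (X i)) -> (forall i, measurable_fun setT (Y i)) ->
  joint_law Q X Q X -> joint_law Q Y Q Y ->
  joint_law Q (fun i s => (X i (l s) + Y i (r s)) / Num.sqrt 2)
            Q (fun i s => (X i (l s) + Y i (r s)) / Num.sqrt 2).
Proof.
move=> mX mY jX jY.
have mXl i : measurable_fun setT (X i \o l) by exact: measurableT_comp.
have mYr i : measurable_fun setT (Y i \o r) by exact: measurableT_comp.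
have QX i A : measurable A -> Q ((X i \o l) @^-1` A) = Q (X i @^-1` A).
  by move=> mA; rewrite comp_preimage; apply: split_l; exact: preimage_measurable.
have QY i A : measurable A -> Q ((Y i \o r) @^-1` A) = Q (Y i @^-1` A).
  by move=> mA; rewrite comp_preimage; apply: split_r; exact: preimage_measurable.
have mh : measurable_fun setT (fun z : R * R => (z.1 + z.2) / Num.sqrt 2).
  by apply: measurable_funM => //; apply: measurable_funD.
pose XY (i : I) s := ((X i \o l) s, (Y i \o r) s).
suff jXY : joint_law Q XY Q XY by exact: (joint_law_comp mh jXY).
apply: joint_law_pair => // A B mA mB.
have mcap (Z : I -> S -> R) (C : I -> set R) : (forall i, measurable_fun setT (Z i)) ->
    (forall i, measurable (C i)) -> measurable (\bigcap_(i in [set: I]) Z i @^-1` C i).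
  exact: bigcap_preimage_measurable.
rewrite (_ : \bigcap_(i in _) _ = l @^-1` (\bigcap_(i in [set: I]) X i @^-1` A i) `&`
    r @^-1` (\bigcap_(i in [set: I]) Y i @^-1` B i)); last first.
  apply/seteqP; split => [s h|s [h1 h2] i _].
    by split => i _; have [] := h i Logic.I.
  by split; [exact: (h1 i Logic.I)|exact: (h2 i Logic.I)].
rewrite (ind (mcap X A mX mA) (mcap Y B mY mB)).
rewrite jX// jY// -big_split/=; apply: eq_bigr => i _.
by rewrite QX// QY.
Qed.

End split_consequences.

(** * Step processes with independent increments *)

Section halves.
Context {R : realType} (T : R).
Hypothesis T0 : 0 < T.

(** The time reached at [t] by the first half of a path when it is run at double
    speed: it stops at [T], and [rhalf] starts only then.  A path glued from two
    halves is thus a sum of two time-changed paths, with no case distinction on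
    [t]. *)
Definition lhalf (t : R) : R := Num.min (2 * t) T.
Definition rhalf (t : R) : R := Num.max (2 * t - T) 0.

Lemma lhalf_le u t : u <= t -> lhalf u <= lhalf t.
Proof. by move=> ut; rewrite /lhalf le_min !ge_min ler_pM2l// ut lexx orbT. Qed.

Lemma rhalf_le u t : u <= t -> rhalf u <= rhalf t.
Proof. by move=> ut; rewrite /rhalf ge_max !le_max lerD2r ler_pM2l// ut lexx orbT. Qed.

Lemma lhalf0 : lhalf 0 = 0. Proof. by rewrite /lhalf mulr0 min_l// ltW. Qed.
Lemma rhalf0 : rhalf 0 = 0. Proof. by rewrite /rhalf mulr0 sub0r max_r// oppr_le0 ltW. Qed.
Lemma lhalfT : lhalf T = T. Proof. by rewrite /lhalf min_r//; have := T0; lra. Qed.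
Lemma rhalfT : rhalf T = T. Proof. by rewrite /rhalf max_l; have := T0; lra. Qed.

Lemma lhalf_itv t : 0 <= t <= T -> 0 <= lhalf t <= T.
Proof.
by move=> /andP[t0 tT]; rewrite /lhalf le_min ge_min lexx orbT andbT (ltW T0) andbT mulr_ge0.
Qed.

Lemma rhalf_itv t : 0 <= t <= T -> 0 <= rhalf t <= T.
Proof.
move=> /andP[t0 tT]; rewrite /rhalf le_max ge_max lexx orbT (ltW T0) andbT/=; lra.
Qed.

Lemma half_cases t : (lhalf t = 2 * t /\ rhalf t = 0) \/ (lhalf t = T /\ rhalf t = 2 * t - T).
Proof.
by rewrite /lhalf /rhalf; case: (leP (2 * t) T) => h; [left|right]; split=> //;
  [rewrite max_r//; lra|rewrite max_l//; lra].
Qed.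

(** The variance accumulated by [walk] up to time [t]: a step approximation of
    [t / T] with jumps at the multiples of [T / 2 ^ n]. *)
Fixpoint clock n t : R := if n is m.+1 then (clock m (lhalf t) + clock m (rhalf t)) / 2
  else if T <= t then 1 else 0.

Lemma clock0 n : clock n 0 = 0.
Proof.
elim: n => [|n IH] /=; first by rewrite leNgt T0.
by rewrite lhalf0 rhalf0 IH addr0 mul0r.
Qed.

Lemma clockT n : clock n T = 1.
Proof.
elim: n => [|n IH] /=; first by rewrite lexx.
by rewrite lhalfT rhalfT IH; field.
Qed.

Lemma clock_err n t : 0 <= t <= T -> `|clock n t - t / T| <= 2^-1 ^+ n.
Proof.
have Tn0 : T != 0 by rewrite gt_eqF.
elim: n t => [|n IH] t tT.
  rewrite /= expr0; case: ifPn => [Tt|_].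
    have -> : t = T by apply/eqP; rewrite eq_le Tt andbT; case/andP: tT.
    by rewrite divff// subrr normr0.
  rewrite sub0r normrN ger0_norm.
    by rewrite ler_pdivrMr// mul1r; case/andP: tT.
  by case/andP: tT => t0 _; rewrite divr_ge0// ltW.
rewrite /= exprS.
have [[lE rE]|[lE rE]] := half_cases t.
  have := IH _ (lhalf_itv tT); rewrite lE rE clock0 addr0 => h.
  rewrite (_ : _ - _ = 2^-1 * (clock n (2 * t) - (2 * t) / T)); last by field.
  by rewrite normrM ger0_norm// ler_wpM2l.
have := IH _ (rhalf_itv tT); rewrite lE rE clockT => h.
rewrite (_ : _ - _ = 2^-1 * (clock n (2 * t - T) - (2 * t - T) / T)); last by field.
by rewrite normrM ger0_norm// ler_wpM2l.
Qed.

Lemma cvg_clock t : 0 <= t <= T -> clock n t @[n --> \oo] --> t / T.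
Proof.
move=> tT; apply/cvgrPdist_le => e e0.
have c := @cvg_half_pow R.
near=> n; rewrite distrC; apply: (le_trans (clock_err n tT)).
by near: n; exact: (cvgr_le _ c).
Unshelve. all: by end_near. Qed.

Section walk.
Context d (S : measurableType d) (Q : probability S R).
Variables (G : S -> R) (l r : S -> S).
Hypothesis H : splits Q G l r.

Let mG : measurable_fun setT G. Proof. by have [[]] := H. Qed.
Let ml : measurable_fun setT l. Proof. by have [] := H. Qed.
Let mr : measurable_fun setT r. Proof. by have [] := H. Qed.
Let Glr s : G (l s) + G (r s) = Num.sqrt 2 * G s. Proof. by have [] := H. Qed.

(** A step process that jumps at the multiples of [T / 2 ^ n].  It takes the
    values of the polygon [levy] at these times and, unlike the polygon, has
    exactly independent increments between arbitrary times. *)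
Fixpoint walk n s t : R :=
  if n is m.+1 then (walk m (l s) (lhalf t) + walk m (r s) (rhalf t)) / Num.sqrt 2
  else if T <= t then G s else 0.

Lemma walk0 n s : walk n s 0 = 0.
Proof.
elim: n s => [|n IH] s /=; first by rewrite leNgt T0.
by rewrite lhalf0 rhalf0 !IH addr0 mul0r.
Qed.

Lemma walkT n s : walk n s T = G s.
Proof.
elim: n s => [|n IH] s /=; first by rewrite lexx.
by rewrite lhalfT rhalfT !IH Glr mulrC mulKf// gt_eqF// sqrtr_gt0.
Qed.

Lemma walk_normal_law n u t : u <= t -> clock n u <= clock n t /\
  normal_law Q (fun s => walk n s t - walk n s u) (Num.sqrt (clock n t - clock n u)).
Proof.
elim: n u t => [|n IH] u t ut /=.
  have [GG _ _ _ _] := H; have G0 := normal_lawZ 0 GG; have G1 := normal_lawZ 1 GG.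
  have [Tu|uT] := leP T u; have [Tt|tT] := leP T t; split=> //.
  - rewrite subrr sqrtr0 (_ : (fun s => _) = (fun w => 0 * G w)).
      by rewrite -[X in normal_law _ _ X](mul0r 1).
    by apply/funext => s /=; rewrite ?subrr mul0r.
  - by move: (lt_le_trans tT Tu); rewrite ltNge ut.
  - by move: (lt_le_trans tT Tu); rewrite ltNge ut.
  - rewrite subr0 sqrtr1 (_ : (fun s => _) = (fun w => 1 * G w)).
      by rewrite -[X in normal_law _ _ X](mul1r 1).
    by apply/funext => s /=; rewrite ?subr0 mul1r.
  - rewrite subrr sqrtr0 (_ : (fun s => _) = (fun w => 0 * G w)).
      by rewrite -[X in normal_law _ _ X](mul0r 1).
    by apply/funext => s /=; rewrite ?subrr mul0r.
have [c1 g1] := IH _ _ (lhalf_le ut); have [c2 g2] := IH _ _ (rhalf_le ut).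
split; first by rewrite ler_pM2r// lerD.
have := normal_law_step H g1 g2; rewrite !sqr_sqrtr ?subr_ge0//.
rewrite (_ : (_ + _) / 2 - (_ + _) / 2 = (clock n (lhalf t) - clock n (lhalf u) +
  (clock n (rhalf t) - clock n (rhalf u))) / 2); last by field.
congr (normal_law _ _ _); apply/funext => s; rewrite -mulrBl; congr (_ / _); ring.
Qed.

Lemma measurable_walk n t : measurable_fun setT (walk n ^~ t).
Proof.
elim: n t => [|n IH] t /=.
  by have [_|_] := leP T t.
apply: measurable_funM => //; apply: measurable_funD.
  exact: (measurableT_comp (IH _) ml).
exact: (measurableT_comp (IH _) mr).
Qed.

(** At level zero there is one jump, at [T], and at most one of the intervals
    contains it.  Passing to the next level adds two independent families of
    increments, taken along the times [lhalf (t i)] and [rhalf (t i)], which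
    are again nondecreasing. *)
Lemma walk_indep n N (t : nat -> R) : (forall i, (i < N)%N -> t i <= t i.+1) ->
  joint_law Q (fun (i : 'I_N) s => walk n s (t i.+1) - walk n s (t i))
            Q (fun (i : 'I_N) s => walk n s (t i.+1) - walk n s (t i)).
Proof.
elim: n t => [|n IH] t ti.
  have mw (i : 'I_N) : measurable_fun setT (fun s => walk 0 s (t i.+1) - walk 0 s (t i)).
    by apply: measurable_funB; exact: measurable_walk.
  have tmono i j : (i <= j)%N -> (j <= N)%N -> t i <= t j.
    elim: j => [|j IHj]; first by rewrite leqn0 => /eqP ->.
    rewrite leq_eqVlt => /orP[/eqP ->//|]; rewrite ltnS => ij jN.
    by apply: (le_trans (IHj ij (ltnW jN))); exact: ti.
  (* [i0] is the interval that contains the jump. *)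
  have [[i0 [ti0 ti1]]|no] := pselect (exists i0 : 'I_N, t i0 < T /\ T <= t i0.+1).
    apply: (@joint_law_constant R _ S Q 'I_N _ i0 (fun=> 0)) => // i ii0.
    apply/funext => s /=.
    have [ii|ii] : (i < i0)%N \/ (i0 < i)%N by apply/orP; rewrite -neq_ltn.
      have h : t i.+1 < T by apply: le_lt_trans ti0; apply: tmono => //; exact: ltnW.
      have h' : t i < T by apply: le_lt_trans h; exact: ti.
      by rewrite !leNgt h h' subrr.
    have h : T <= t i by apply: (le_trans ti1); apply: tmono => //; exact: ltnW.
    by rewrite h (le_trans h (ti _ _))// subrr.
  case: N t ti mw tmono no => [|N] t ti mw tmono no.
    move=> A mA; rewrite big_ord0 (_ : \bigcap_(i in _) _ = setT) ?probability_setT//.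
    by apply/seteqP; split => // s _ [].
  apply: (@joint_law_constant R _ S Q 'I_N.+1 _ ord0 (fun=> 0)) => // i _.
  apply/funext => s /=.
  have [Tt|tT] := leP T (t i).
    by rewrite (le_trans Tt (ti _ _))// subrr.
  case: ifPn => [Tt|_]; last by rewrite subrr.
  by exfalso; apply: no; exists i.
have mX (f : R -> R) (i : 'I_N) :
    measurable_fun setT (fun s => walk n s (f (t i.+1)) - walk n s (f (t i))).
  by apply: measurable_funB; exact: measurable_walk.
have j1 := IH (fun i => lhalf (t i)) (fun i iN => lhalf_le (ti i iN)).
have j2 := IH (fun i => rhalf (t i)) (fun i iN => rhalf_le (ti i iN)).
have := indep_step H (fun i => mX lhalf i) (fun i => mX rhalf i) j1 j2.
rewrite (_ : (fun _ _ => _ / Num.sqrt 2) =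
  (fun (i : 'I_N) s => walk n.+1 s (t i.+1) - walk n.+1 s (t i)))//.
by apply/funext => i; apply/funext => s /=; rewrite -mulrBl; congr (_ / _); ring.
Qed.

End walk.
End halves.

(** * The two halves of a path *)

Lemma normc_real (R : realType) (x : R) : normc x%:C%C = `|x|.
Proof. by rewrite /= expr0n addr0 sqrtr_sqr. Qed.

Section path_operators.
Context {R : realType} (T : R).
Hypothesis T0 : 0 < T.
Notation B := (path_space T).

Section cut.
Variable f : R -> R[i].

(** Extension by zero, the encoding of a path on [[0, T]]. *)
Definition cut t : R[i] := if t \in `[0, T] then f t else 0.

Lemma cut_path : continuous f -> f 0 = 0 -> cut \in is_path T.
Proof.
move=> cf f0; rewrite inE; split.
- apply: (@subspace_eq_continuous _ _ _ f); last exact: continuous_subspaceT.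
  have E (t : R) : t \in `[0, T] -> f t = cut t by rewrite /cut => ->.
  by move=> t /set_mem; exact: E.
- by rewrite /cut f0; case: ifP.
- by move=> t /negbTE tT; rewrite /cut; case: ifP => //; rewrite tT.
Qed.

End cut.

(** The retraction of the line onto [[0, T]], used to reparametrise a path before
    cutting it. *)
Definition clamp (x : R) : R := Num.max 0 (Num.min x T).

Lemma clamp_itv x : clamp x \in `[0, T].
Proof. by rewrite in_itv/= /clamp le_max lexx/= ge_max ge_min lexx orbT (ltW T0). Qed.

Lemma clamp_lip x y : `|clamp x - clamp y| <= `|x - y|.
Proof.
suff key u v : u <= v -> 0 <= clamp v - clamp u <= v - u.
  have [xy|/ltW xy] := leP x y.
    by have /andP[h1 h2] := key _ _ xy; rewrite distrC (ger0_norm h1) distrC ger0_norm ?subr_ge0.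
  by have /andP[h1 h2] := key _ _ xy; rewrite (ger0_norm h1) ger0_norm ?subr_ge0.
move=> uv; rewrite /clamp.
have TT := T0.
case: (leP u T) => uT; case: (leP v T) => vT;
  case: (leP 0 u) => u0; case: (leP 0 v) => v0; case: (leP 0 T) => T0';
  apply/andP; split; lra.
Qed.

Lemma path_clamp_continuous (z : B) : continuous (fun x => z (clamp x)).
Proof.
move=> x; apply/cvgrPdist_lt => e e0.
have /cvgrPdist_lt/(_ _ e0) := @path_continuous _ _ z (clamp x).
have cT : `[0, T]%classic (clamp x) by exact: clamp_itv.
move=> hz.
have : within `[0, T]%classic (nbhs (clamp x)) [set s | `|z (clamp x) - z s| < e].
  by rewrite nbhs_subspace_in.
move=> /nbhs_ballP[d /= d0 hd].
apply/nbhs_ballP; exists d => //= y xy.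
apply: hd; last exact: clamp_itv.
have {}xy : `|x - y| < d by exact: xy.
suff : `|clamp x - clamp y| < d by [].
by apply: le_lt_trans xy; exact: clamp_lip.
Qed.

Lemma clamp_lhalf t : 0 <= t <= T -> clamp (2 * t) = lhalf T t.
Proof. by move=> /(lhalf_itv T0)/andP[h _]; rewrite /clamp max_r. Qed.

Lemma clamp_rhalf t : 0 <= t <= T -> clamp (2 * t - T) = rhalf T t.
Proof.
move=> /andP[t0 tT]; rewrite /clamp min_l; last by lra.
by rewrite /rhalf maxC.
Qed.

Lemma cont_shift (z : B) (b : R) : continuous (fun t : R => z (clamp (2 * t + b))).
Proof.
move=> t; apply: (@continuous_comp R R R[i] (fun t : R => 2 * t + b) (fun x : R => z (clamp x))).
  by apply: cvgD; [apply: cvgMl_tmp; exact: cvg_id|exact: cvg_cst].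
exact: path_clamp_continuous.
Qed.

Lemma shift0 (z : B) (b : R) : b <= 0 -> z (clamp (2 * 0 + b)) = 0.
Proof.
move=> b0; rewrite mulr0 add0r -(path0 z); congr (z _).
by rewrite /clamp max_l// ge_min b0.
Qed.

Let NT0 : - T <= 0. Proof. by rewrite oppr_le0 ltW. Qed.

(** The path [z] run at double speed and then stopped at [z T]; [rpath z] stays at
    zero for the first half. *)
Definition lpath (z : B) : B := MkPath (cut_path (@cont_shift z 0) (shift0 z (lexx 0))).
Definition rpath (z : B) : B := MkPath (cut_path (@cont_shift z (- T)) (shift0 z NT0)).

Lemma lpathE z t : 0 <= t <= T -> lpath z t = z (lhalf T t).
Proof. by move=> tT; rewrite /= /cut in_itv/= tT addr0 clamp_lhalf. Qed.

Lemma rpathE z t : 0 <= t <= T -> rpath z t = z (rhalf T t).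
Proof. by move=> tT; rewrite /= /cut in_itv/= tT clamp_rhalf. Qed.

Lemma path_eq (y z : B) : (forall t, 0 <= t <= T -> y t = z t) -> y = z.
Proof.
move=> yz; apply/val_inj/funext => t /=.
have [tT|tT] := boolP (t \in `[0, T]); last by rewrite !path_out.
by apply: yz; move: tT; rewrite in_itv.
Qed.

Lemma path_addE (y z : B) t : (y + z) t = y t + z t. Proof. by []. Qed.
Lemma path_subE (y z : B) t : (y - z) t = y t - z t. Proof. by []. Qed.
Lemma path_scaleE (a : R[i]) (z : B) t : (a *: z) t = a * z t. Proof. by []. Qed.

Lemma lpathD y z : lpath (y + z) = lpath y + lpath z.
Proof. by apply: path_eq => t tT; rewrite path_addE !lpathE. Qed.
Lemma rpathD y z : rpath (y + z) = rpath y + rpath z.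
Proof. by apply: path_eq => t tT; rewrite path_addE !rpathE. Qed.
Lemma lpathB y z : lpath (y - z) = lpath y - lpath z.
Proof. by apply: path_eq => t tT; rewrite path_subE !lpathE. Qed.
Lemma rpathB y z : rpath (y - z) = rpath y - rpath z.
Proof. by apply: path_eq => t tT; rewrite path_subE !rpathE. Qed.
Lemma lpathZ a z : lpath (a *: z) = a *: lpath z.
Proof. by apply: path_eq => t tT; rewrite path_scaleE !lpathE. Qed.
Lemma rpathZ a z : rpath (a *: z) = a *: rpath z.
Proof. by apply: path_eq => t tT; rewrite path_scaleE !rpathE. Qed.

Lemma sup_norm_le_itv (z : B) M : 0 <= M ->
  (forall t, 0 <= t <= T -> normc (z t) <= M) -> sup_norm z <= M.
Proof. by move=> M0 zM; apply: sup_norm_le => // t; rewrite in_itv/=; exact: zM. Qed.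

Lemma lpath_norm z : sup_norm (lpath z) <= sup_norm z.
Proof.
apply: sup_norm_le_itv => [|t tT]; first exact: sup_norm_ge0.
by rewrite lpathE// normc_le_sup_norm.
Qed.

Lemma rpath_norm z : sup_norm (rpath z) <= sup_norm z.
Proof.
apply: sup_norm_le_itv => [|t tT]; first exact: sup_norm_ge0.
by rewrite rpathE// normc_le_sup_norm.
Qed.

Lemma ramp_cont : continuous (fun t : R => (t / T)%:C%C : R[i]).
Proof.
move=> t; apply/cvgrPdist_lt => _ /gt0_complex[e e0 ->].
have c : x / T @[x --> t] --> t / T by apply: cvgMr_tmp; exact: cvg_id.
have /cvgrPdist_lt/(_ _ e0) := c; apply: filterS => s h.
by rewrite -rmorphB normE ltcR normc_real.
Qed.

Lemma ramp0 : (0 / T)%:C%C = 0 :> R[i]. Proof. by rewrite mul0r. Qed.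

Definition ramp : B := MkPath (cut_path ramp_cont ramp0).

Lemma rampE t : 0 <= t <= T -> ramp t = (t / T)%:C%C.
Proof. by move=> tT; rewrite /= /cut in_itv/= tT. Qed.

(** The times reached in the two halves add up to [2 t]. *)
Lemma ramp_halves : lpath ramp + rpath ramp = ramp + ramp.
Proof.
apply: path_eq => t tT; rewrite !path_addE lpathE// rpathE// !rampE ?lhalf_itv ?rhalf_itv//.
rewrite -!rmorphD -!mulrDl; congr (_ / T)%:C%C.
by have [[-> ->]|[-> ->]] := half_cases T t; ring.
Qed.

Lemma ramp_norm : sup_norm ramp <= 1.
Proof.
apply: sup_norm_le_itv => // t tT; rewrite rampE// normc_real.
case/andP: tT => t0 tT; have h : 0 <= t / T by rewrite divr_ge0// ltW.
by rewrite (ger0_norm h) ler_pdivrMr// mul1r.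
Qed.

End path_operators.

(** * Countably valued maps *)

Section discrete.
Context {R : realType}.

(** Every set has a measurable preimage under such a map, and the property passes
    to pairs, whereas the Borel sets of a product of normed spaces need not be
    generated by rectangles. *)
Definition discrete_rv d (S : measurableType d) (V : Type) (X : S -> V) :=
  exists (C : countType) (Y : S -> C) (h : C -> V),
    (forall c, measurable (Y @^-1` [set c])) /\ X = h \o Y.

Lemma discrete_measurable d (S : measurableType d) V (X : S -> V) (A : set V) :
  discrete_rv X -> measurable (X @^-1` A).
Proof. by move=> [C [Y [h [mY ->]]]]; exact: countable_measurable_comp. Qed.

Lemma discrete_comp d (S : measurableType d) V V' (f : V -> V') (X : S -> V) :
  discrete_rv X -> discrete_rv (f \o X).
Proof. by move=> [C [Y [h [mY ->]]]]; exists C, Y, (f \o h). Qed.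

Lemma discrete_precomp d d' (S : measurableType d) (S' : measurableType d') V
    (f : S -> S') (X : S' -> V) :
  measurable_fun setT f -> discrete_rv X -> discrete_rv (X \o f).
Proof.
move=> mf [C [Y [h [mY ->]]]]; exists C, (Y \o f), h; split=> // c.
exact: (preimage_measurable mf (mY c)).
Qed.

Lemma discrete_pair d (S : measurableType d) V V' (X : S -> V) (X' : S -> V') :
  discrete_rv X -> discrete_rv X' -> discrete_rv (fun s => (X s, X' s)).
Proof.
move=> [C [Y [h [mY ->]]]] [C' [Y' [h' [mY' ->]]]].
exists (C * C')%type, (fun s => (Y s, Y' s)), (fun c => (h c.1, h' c.2)); split=> // -[c c'].
rewrite (_ : _ @^-1` _ = Y @^-1` [set c] `&` Y' @^-1` [set c']).
  exact: measurableI.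
by apply/seteqP; split => s /= [-> ->].
Qed.

Lemma discrete_if d (S : measurableType d) V (E : set S) (X : S -> V) (v : V) :
  measurable E -> discrete_rv X -> discrete_rv (fun s => if s \in E then X s else v).
Proof.
move=> mE dX.
have dE : discrete_rv (fun s => s \in E).
  exists bool, (fun s => s \in E), id; split=> // b.
  rewrite (_ : _ @^-1` _ = if b then E else ~` E).
    by case: b => //; exact: measurableC.
  case: b; apply/seteqP; split => s /=.
  - by move/set_mem.
  - by move/mem_set.
  - by move=> h Es; move: h; rewrite mem_set.
  - by move=> h; apply/negbTE/negP => /set_mem.
exact: (discrete_comp (fun p : bool * V => if p.1 then p.2 else v) (discrete_pair dE dX)).
Qed.

Lemma discrete_round_down d (S : measurableType d) (X : S -> R) n :
  measurable_fun setT X -> discrete_rv (fun s => round_down n (X s)).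
Proof.
move=> mX; exists int, (fun s => Num.floor (X s * n.+1%:R)),
  (fun z => z%:~R / n.+1%:R); split=> // z.
exact: measurable_floor_fiber.
Qed.

End discrete.

(** * Polygonal approximations *)

Section levy.
Context {R : realType} (T : R).
Hypothesis T0 : 0 < T.
Notation B := (path_space T).
Notation lp := (lpath T0).
Notation rp := (rpath T0).

Lemma cvg_pathP (x : nat -> B) (y : B) :
  (forall e : R, 0 < e -> \forall n \near \oo, sup_norm (y - x n) < e) ->
  x n @[n --> \oo] --> y.
Proof.
move=> h; apply/cvgrPdist_lt => _ /gt0_complex[e e0 ->].
by apply: filterS (h _ e0) => n; rewrite path_normE ltcR.
Qed.

Lemma path_cvgP (x : nat -> B) (y : B) : x n @[n --> \oo] --> y ->
  forall e : R, 0 < e -> \forall n \near \oo, sup_norm (y - x n) < e.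
Proof.
move=> /cvgrPdist_lt h e e0.
have e0c : 0 < e%:C%C :> R[i] by rewrite (@ltcR R 0).
by apply: filterS (h _ e0c) => n; rewrite path_normE ltcR.
Qed.

Lemma sup_normD (y z : B) : sup_norm (y + z) <= sup_norm y + sup_norm z.
Proof. by rewrite -lecR rmorphD; exact: ler_sup_normD. Qed.

Lemma sup_normZr (a : R) (z : B) : sup_norm (a%:C%C *: z) = `|a| * sup_norm z.
Proof.
by apply: (@complexI R); rewrite rmorphM (sup_normZ (a%:C%C) z) normE normc_real.
Qed.

(** The constant [10] is [1 / (1 - decay_rate)], the sum of the geometric
    series. *)
Lemma cvg_geometric_path (x : nat -> B) N :
  (forall n, (N <= n)%N -> sup_norm (x n.+1 - x n) <= decay_rate ^+ n) ->
  cvg (x n @[n --> \oo]).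
Proof.
move=> h.
have decay_rate0 : 0 < decay_rate :> R by rewrite divr_gt0.
have key k n : (N <= n)%N -> sup_norm (x (n + k)%N - x n) <= 10 * decay_rate ^+ n.
  elim: k n => [|k IH] n Nn.
    rewrite addn0 subrr (_ : sup_norm 0 = 0) ?mulr_ge0 ?exprn_ge0 ?ltW//.
    by apply: (@complexI R); exact: (normr0 B).
  rewrite -(subrKA (x n.+1)); apply: (le_trans (sup_normD _ _)).
  have h1 := IH n.+1 (leqW Nn); rewrite addSnnS in h1.
  have h2 := h n Nn.
  apply: (le_trans (lerD h1 h2)).
  have -> : decay_rate ^+ n.+1 = 9 / 10 * decay_rate ^+ n :> R by rewrite exprS.
  lra.
apply: path_complete; apply/cauchyP => _ /gt0_complex[e e0 ->].
have c : decay_rate ^+ n @[n --> \oo] --> (0 : R).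
  by apply: cvg_expr; rewrite ger0_norm ?ltW// /decay_rate; lra.
have e10 : 0 < e / 10 by rewrite divr_gt0.
have [N' _ hN'] := cvgr_lt _ c _ e10.
exists (x (maxn N N')); exists (maxn N N') => // n /= Nn.
rewrite -ball_normE /= distrC path_normE ltcR -(subnKC Nn).
apply: (le_lt_trans (key _ _ (leq_maxl _ _))).
have := hN' (maxn N N') (leq_maxr _ _); rewrite /=; lra.
Qed.

Section levy_def.
Context d (S : measurableType d) (Q : probability S R).
Variables (G : S -> R) (l r : S -> S).
Hypothesis H : splits Q G l r.

Let mG : measurable_fun setT G. Proof. by have [[]] := H. Qed.
Let ml : measurable_fun setT l. Proof. by have [] := H. Qed.
Let mr : measurable_fun setT r. Proof. by have [] := H. Qed.
Let Glr s : G (l s) + G (r s) = Num.sqrt 2 * G s. Proof. by have [] := H. Qed.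

Let c : R := (Num.sqrt 2)^-1.
Let s20 : 0 < Num.sqrt 2 :> R. Proof. by rewrite sqrtr_gt0. Qed.
Let c0 : 0 < c. Proof. by rewrite invr_gt0. Qed.

Let frac_itv u : 0 <= u <= T -> 0 <= u / T <= 1.
Proof.
by move=> /andP[u0 uT]; rewrite divr_ge0 ?(ltW T0)//= ler_pdivrMr// mul1r.
Qed.

(** The polygon of level [n], whose increments over the intervals of length
    [T / 2 ^ n] are the values of [g] at the descendants of [s], suitably
    scaled.  The function [g] is a parameter because it will be [G] as well as
    countably valued roundings of it. *)
Fixpoint levy (g : S -> R) n s : B :=
  if n is m.+1 then c%:C%C *: (lp (levy g m (l s)) + rp (levy g m (r s)))
  else (g s)%:C%C *: ramp T.

Let TT : 0 <= T <= T. Proof. by rewrite lexx ltW. Qed.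

Lemma levyT n s : levy G n s T = (G s)%:C%C.
Proof.
elim: n s => [|n IH] s.
  by rewrite path_scaleE rampE// divff ?gt_eqF// mulr1.
rewrite path_scaleE path_addE lpathE// rpathE// lhalfT// rhalfT// !IH.
rewrite -rmorphD -rmorphM Glr; congr (_%:C)%C.
by rewrite /c mulKf// gt_eqF.
Qed.

(** Each level multiplies the error by at most [2 / sqrt 2], here bounded by
    [2]. *)
Lemma levy_dist g g' e n s : (forall s, `|g s - g' s| <= e) ->
  sup_norm (levy g n s - levy g' n s) <= 2 ^+ n * e.
Proof.
move=> gg; have e0 : 0 <= e by apply: le_trans (gg s).
elim: n s => [|n IH] s.
  rewrite /= -scalerBl -rmorphB sup_normZr expr0 mul1r.
  by apply: (le_trans (ler_wpM2l (normr_ge0 _) (ramp_norm T0))); rewrite mulr1.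
rewrite /= -scalerBr opprD addrACA -lpathB -rpathB sup_normZr.
rewrite gtr0_norm// ler_pdivrMl//.
apply: (le_trans (sup_normD _ _)).
apply: (le_trans (lerD (lpath_norm _ _) (rpath_norm _ _))).
apply: (le_trans (lerD (IH _) (IH _))).
have -> : 2 ^+ n * e + 2 ^+ n * e = 2 ^+ n.+1 * e by rewrite exprS; ring.
rewrite ler_peMl ?mulr_ge0 ?exprn_ge0//.
by rewrite -[leLHS]sqrtr1 ler_sqrt// ler1n.
Qed.

(** On the first half of the interval only [y] moves; on the second half only [z]
    does, since [y] ends at zero. *)
Lemma glued_norm (y z : B) : y T = 0 ->
  sup_norm (lp y + rp z) <= Num.max (sup_norm y) (sup_norm z).
Proof.
move=> yT; apply: sup_norm_le_itv => [|t tT]; first by rewrite le_max sup_norm_ge0.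
rewrite path_addE lpathE// rpathE//.
have [[-> ->]|[-> ->]] := half_cases T t.
  by rewrite path0 addr0 le_max normc_le_sup_norm.
by rewrite yT add0r le_max normc_le_sup_norm orbT.
Qed.

Definition jump s := `|G (l s)| + `|G (r s)|.

(** By [levyT] the difference of consecutive polygons vanishes at [T], so
    [glued_norm] applies to the two halves.  At level zero the difference is that
    of a polygon with one kink and the straight segment. *)
Lemma levy_step n s :
  sup_norm (levy G n.+1 s - levy G n s) <= dyadic_bound l r jump n s.
Proof.
elim: n s => [|n IH] s; last first.
  rewrite [levy G n.+2 s]/= [levy G n.+1 s]/=.
  rewrite -scalerBr opprD addrACA -lpathB -rpathB sup_normZr gtr0_norm//.
  rewrite [leRHS]/= mulrC ler_wpM2r ?(ltW c0)//.
  have yT : (levy G n.+1 (l s) - levy G n (l s)) T = 0.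
    by rewrite path_subE !levyT subrr.
  apply: (le_trans (glued_norm _ yT)).
  by rewrite ge_max !le_max !IH/= orbT.
apply: sup_norm_le_itv => [|t tT]; first by rewrite addr_ge0.
rewrite path_subE [levy G 1 s]/= [levy G 0 s]/= !path_scaleE path_addE.
rewrite lpathE// rpathE// !path_scaleE !rampE ?lhalf_itv ?rhalf_itv//.
rewrite -!rmorphM -!rmorphD -!rmorphM -!rmorphB normc_real.
have GE : G s = c * (G (l s) + G (r s)) by rewrite Glr /c mulKf// gt_eqF.
have c1 : c <= 1.
  by rewrite invf_le1// -[leLHS]sqrtr1 ler_sqrt// ler1n.
have /andP[t0 t1] : 0 <= t / T <= 1.
  exact: frac_itv.
have /andP[a0 a1] : 0 <= lhalf T t / T <= 1.
  exact/frac_itv/lhalf_itv.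
have /andP[b0 b1] : 0 <= rhalf T t / T <= 1.
  exact/frac_itv/rhalf_itv.
rewrite GE -mulrA -mulrBr normrM (gtr0_norm c0).
rewrite (_ : _ - _ = G (l s) * (lhalf T t / T - t / T) +
   G (r s) * (rhalf T t / T - t / T)); last by ring.
apply: (@le_trans _ _ (1 * (jump s))); last by rewrite mul1r.
apply: ler_pM => //; first exact: ltW.
apply: (le_trans (ler_normD _ _)); rewrite !normrM.
by apply: lerD; apply: ler_piMr => //; rewrite ler_norml; apply/andP; split; lra.
Qed.

(** The same recursion as for [levy_step]; at level zero a ramp and a step with the
    same endpoint are compared. *)
Lemma levy_walk n s t : 0 <= t <= T ->
  normc (levy G n s t - (walk T G l r n s t)%:C%C) <= dyadic_bound l r (fun s => `|G s|) n s.
Proof.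
elim: n s t => [|n IH] s t tT.
  rewrite [levy _ _ _]/= path_scaleE rampE// -rmorphM -rmorphB normc_real /=.
  case: ifPn => [Tt|_].
    have -> : t = T by apply/eqP; rewrite eq_le Tt andbT; case/andP: tT.
    by rewrite divff ?gt_eqF// mulr1 subrr normr0.
  have /andP[t0 t1] := frac_itv tT.
  by rewrite subr0 normrM ler_piMr// ger0_norm.
rewrite [levy _ _ _]/= path_scaleE path_addE lpathE// rpathE// [walk _ _ _ _ n.+1 _ _]/=.
rewrite [X in _ - X](_ : _ = c%:C%C * ((walk T G l r n (l s) (lhalf T t))%:C%C +
   (walk T G l r n (r s) (rhalf T t))%:C%C)); last first.
  by rewrite -rmorphD -rmorphM mulrC.
rewrite -mulrBr normcM normc_real gtr0_norm// opprD addrACA.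
rewrite [leRHS]/= mulrC ler_wpM2r ?(ltW c0)//.
have [[lE rE]|[lE rE]] := half_cases T t.
  have h := IH (l s) _ (lhalf_itv T0 tT).
  by rewrite rE path0 walk0// subrr addr0 le_max h.
have h := IH (r s) _ (rhalf_itv T0 tT).
by rewrite lE levyT (walkT T0 H) subrr add0r le_max h orbT.
Qed.

End levy_def.
End levy.

(** * The limit path and its laws *)

Section limit_path.
Context {R : realType} (T : R).
Hypothesis T0 : 0 < T.
Notation B := (path_space T).
Notation lp := (lpath T0).
Notation rp := (rpath T0).
Context d (S : measurableType d) (Q : probability S R).
Variables (G : S -> R) (l r : S -> S).
Hypothesis H : splits Q G l r.
Notation levy := (levy T0 l r).

Let mG : measurable_fun setT G. Proof. by have [[]] := H. Qed.
Let ml : measurable_fun setT l. Proof. by have [] := H. Qed.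
Let mr : measurable_fun setT r. Proof. by have [] := H. Qed.

(** Real and imaginary parts of complex functionals are linear over the reals
    only. *)
Definition real_linear (g : B -> R) :=
  (forall u v, g (u + v) = g u + g v) /\ (forall (a : R) u, g (a%:C%C *: u) = a * g u).

Lemma real_linearB g u v : real_linear g -> g (u - v) = g u - g v.
Proof.
move=> [gD gZ]; have gN w : g (- w) = - g w.
  by have := gZ (- 1) w; rewrite rmorphN1 scaleN1r mulN1r.
by rewrite gD gN.
Qed.

Lemma real_linear_lp g : real_linear g -> real_linear (g \o lp).
Proof. by move=> [gD gZ]; split=> [u v|a u] /=; rewrite ?lpathD ?gD// lpathZ gZ. Qed.

Lemma real_linear_rp g : real_linear g -> real_linear (g \o rp).
Proof. by move=> [gD gZ]; split=> [u v|a u] /=; rewrite ?rpathD ?gD// rpathZ gZ. Qed.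

(** The variance of [g (levy G n s)]. *)
Fixpoint qvar n (g : B -> R) : R :=
  if n is m.+1 then (qvar m (g \o lp) + qvar m (g \o rp)) / 2 else g (ramp T) ^+ 2.

Lemma qvar_ge0 n g : 0 <= qvar n g.
Proof.
elim: n g => [|n IH] g /=; first exact: sqr_ge0.
by rewrite divr_ge0// addr_ge0.
Qed.

(** A functional of the polygon of level [n + 1] is the sum of a functional of the
    first half and one of the second, and these are independent. *)
Lemma levy_normal_law n g : real_linear g ->
  normal_law Q (fun s => g (levy G n s)) (Num.sqrt (qvar n g)).
Proof.
elim: n g => [|n IH] g gl.
  have [GG _ _ _ _] := H; rewrite /= sqrtr_sqr; apply: normal_law_norm.
  rewrite (_ : (fun s => _) = (fun s => g (ramp T) * G s)).
    by rewrite -[X in normal_law _ _ X]mulr1; exact: normal_lawZ.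
  by apply/funext => s; rewrite gl.2 mulrC.
have := normal_law_step H (IH _ (real_linear_lp gl)) (IH _ (real_linear_rp gl)).
rewrite !sqr_sqrtr ?qvar_ge0//; congr (normal_law _ _ _).
by apply/funext => s; rewrite /= gl.2 gl.1 mulrC.
Qed.

(** Let [a], [b] be the values of [g] on the two halves of the ramp and [x] its value
    on the ramp; [ramp_halves] gives [a + b = 2 x], so [(a ^ 2 + b ^ 2) / 2]
    is at least [x ^ 2]. *)
Lemma qvar_nd n g : real_linear g -> qvar n g <= qvar n.+1 g.
Proof.
elim: n g => [|n IH] g gl; last first.
  rewrite [leLHS]/= [leRHS]/= ler_pM2r ?invr_gt0// lerD//.
    exact/IH/real_linear_lp.
  exact/IH/real_linear_rp.
have E : g (lp (ramp T)) + g (rp (ramp T)) = g (ramp T) + g (ramp T).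
  by rewrite -!gl.1 ramp_halves.
rewrite /=; move: (g (lp _)) (g (rp _)) (g (ramp T)) E => a b x E.
have -> : b = x + x - a by rewrite -E addrC addKr.
have := sqr_ge0 (x - a); rewrite !expr2; lra.
Qed.

Lemma qvar_ub n g M : 0 <= M -> (forall z, `|g z| <= M * sup_norm z) ->
  qvar n g <= M ^+ 2.
Proof.
move=> M0; elim: n g => [|n IH] g gM /=.
  rewrite -real_normK ?num_real// ler_sqr ?nnegrE//.
  by apply: (le_trans (gM _)); rewrite ler_piMr// (ramp_norm T0).
have h1 : qvar n (g \o lp) <= M ^+ 2.
  apply: IH => z; apply: (le_trans (gM _)).
  by rewrite ler_wpM2l// lpath_norm.
have h2 : qvar n (g \o rp) <= M ^+ 2.
  apply: IH => z; apply: (le_trans (gM _)).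
  by rewrite ler_wpM2l// rpath_norm.
lra.
Qed.

Lemma qvar_cvg g M : real_linear g -> 0 <= M ->
  (forall z, `|g z| <= M * sup_norm z) -> cvgn (qvar ^~ g).
Proof.
move=> gl M0 gM; apply: nondecreasing_is_cvgn.
  by apply/nondecreasing_seqP => n; exact: qvar_nd.
by exists (M ^+ 2) => _ [n _ <-]; exact: qvar_ub.
Qed.

Let jmp := jump G l r.
Let absG s := `|G s|.

Let mabsG : measurable_fun setT absG.
Proof. by apply: measurableT_comp => //; exact: measurable_normr. Qed.

Let mjmp : measurable_fun setT jmp.
Proof.
apply: measurable_funD.
  exact: (measurableT_comp mabsG ml).
exact: (measurableT_comp mabsG mr).
Qed.

Let absG4 : (\int[Q]_s (absG s ^+ 4)%:E < +oo)%E.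
Proof.
have [GG _ _ _ _] := H.
rewrite (_ : (\int[Q]_s _)%E = (\int[Q]_s (G s ^+ 4)%:E)%E); last first.
  apply: eq_integral => s _; congr EFin.
  by rewrite /absG !(exprM _ 2 2) real_normK ?num_real.
rewrite (normal_law_integral GG (f := fun x => (x ^+ 4)%:E)).
- under eq_integral do rewrite mul1r.
  exact: gauss_x4.
- by apply/measurable_EFinP; exact: measurable_funX.
- by move=> x; rewrite lee_fin (exprM _ 2 2) sqr_ge0.
Qed.

Let jmp4 : (\int[Q]_s (jmp s ^+ 4)%:E < +oo)%E.
Proof.
have m4 : measurable_fun setT (fun s => (absG s ^+ 4)%:E).
  by apply/measurable_EFinP; exact: measurable_funX.
have p4 s : (0 <= (absG s ^+ 4)%:E)%E by rewrite lee_fin exprn_ge0// /absG.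
apply: (@le_lt_trans _ _ (\int[Q]_s (8%:E * ((absG (l s) ^+ 4)%:E + (absG (r s) ^+ 4)%:E)))%E).
  apply: ge0_le_integral => //.
  - by move=> s _; rewrite lee_fin exprn_ge0// /jmp /jump addr_ge0.
  - by apply/measurable_EFinP; exact: measurable_funX.
  - apply: emeasurable_funM => //; apply: emeasurable_funD.
      exact: (measurableT_comp m4 ml).
    exact: (measurableT_comp m4 mr).
  - move=> s _; rewrite -EFinD -EFinM lee_fin /jmp /jump /absG.
    move: (`|G (l s)|) (`|G (r s)|) => a b.
    (* Squaring [(a + b) ^ 2 <= 2 (a ^ 2 + b ^ 2)] gives the constant [8]. *)
    have h1 : (a + b) ^+ 2 <= 2 * (a ^+ 2 + b ^+ 2).
      by have := sqr_ge0 (a - b); rewrite sqrrB sqrrD; lra.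
    have h2 : (a ^+ 2 + b ^+ 2) ^+ 2 <= 2 * (a ^+ 4 + b ^+ 4).
      have := sqr_ge0 (a ^+ 2 - b ^+ 2); rewrite sqrrB sqrrD -!exprM; lra.
    have h3 : (a + b) ^+ 4 <= (2 * (a ^+ 2 + b ^+ 2)) ^+ 2.
      rewrite (exprM _ 2 2) ler_sqr ?nnegrE ?sqr_ge0//.
      by rewrite mulr_ge0// addr_ge0 ?sqr_ge0.
    by apply: (le_trans h3); rewrite exprMn; lra.
rewrite ge0_integralZl//; last 2 first.
- apply: emeasurable_funD; first exact: (measurableT_comp m4 ml).
  exact: (measurableT_comp m4 mr).
- by move=> s _; exact: adde_ge0.
rewrite ge0_integralD//; last 2 first.
- exact: (measurableT_comp m4 ml).
- exact: (measurableT_comp m4 mr).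
rewrite (integral_split_l H m4)// (integral_split_r H m4)//.
apply: lte_mul_pinfty; rewrite ?lee_fin//.
by apply: lte_add_pinfty; exact: absG4.
Qed.

Definition regular : set S :=
  tame l r (jump G l r) `&` tame l r (fun s => `|G s|).

Lemma measurable_regular : measurable regular.
Proof.
by apply: measurableI; [exact: (measurable_tame H mjmp)|exact: (measurable_tame H mabsG)].
Qed.

Lemma prob_regular : Q regular = 1%E.
Proof.
have m1 := measurable_tame H mjmp; have m2 := measurable_tame H mabsG.
have q1 : Q (tame l r jmp) = 1%E.
  by apply: (prob_tame H mjmp) => // s; rewrite /jmp /jump addr_ge0.
have q2 : Q (tame l r absG) = 1%E by apply: (prob_tame H mabsG) => // s; rewrite /absG.
rewrite -[regular]setCK probability_setC; last exact/measurableC/measurable_regular.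
rewrite (_ : Q (~` regular) = 0%E) ?sube0//.
rewrite /regular setCI; apply/eqP; rewrite eq_le measure_ge0 andbT.
apply: (le_trans (measureU2 _ _ _)); rewrite ?measurableC//; try exact: measurableC.
have z1 : Q (~` tame l r jmp) = 0%E by rewrite probability_setC// q1 subee.
have z2 : Q (~` tame l r absG) = 0%E by rewrite probability_setC// q2 subee.
by rewrite [X in (X + _)%E]z1 [X in (_ + X)%E]z2 adde0.
Qed.

Lemma levy_is_cvg s : regular s -> cvg (levy G n s @[n --> \oo]).
Proof.
move=> [[N _ hN] _]; apply: (@cvg_geometric_path R T _ N) => n Nn.
by apply: (le_trans (levy_step T0 H _ _)); exact: hN.
Qed.

Definition limit_path s : B := if s \in regular then lim (levy G n s @[n --> \oo]) else 0.

Lemma levy_cvg s : regular s -> levy G n s @[n --> \oo] --> limit_path s.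
Proof. by move=> rs; rewrite /limit_path mem_set//; exact: levy_is_cvg. Qed.

(** The polygons of rounded variables.  Rounding [G] at precision [4 ^ - n] moves
    the polygon of level [n] by at most [2 ^ - n]. *)
Lemma limit_path_discrete : exists X : nat -> S -> B, (forall n, discrete_rv (X n)) /\
  forall s, X n s @[n --> \oo] --> limit_path s.
Proof.
pose g n s := round_down (4 ^ n) (G s).
exists (fun n s => if s \in regular then levy (g n) n s else 0); split.
  move=> n; apply: discrete_if; first exact: measurable_regular.
  have dg : discrete_rv (g n) by exact: discrete_round_down.
  suff key k : discrete_rv (levy (g n) k) by exact: key.
  elim: k => [|k IH].
    exact: (discrete_comp (fun x : R => x%:C%C *: ramp T) dg).
  have dp := discrete_pair (discrete_precomp ml IH) (discrete_precomp mr IH).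
  exact: (discrete_comp (fun p : B * B => ((Num.sqrt 2)^-1)%:C%C *: (lp p.1 + rp p.2)) dp).
move=> s; have [rs|rs] := boolP (s \in regular); last first.
  by rewrite /limit_path (negbTE rs); exact: cvg_cst.
apply: cvg_pathP => e e0.
have e20 : 0 < e / 2 by rewrite divr_gt0.
have c := @cvg_half_pow R.
have h1 := path_cvgP (levy_cvg (set_mem rs)) e20.
have h2 := cvgr_lt _ c _ e20.
near=> n.
rewrite -(subrKA (levy G n s)) [ltRHS]splitr.
apply: (le_lt_trans (sup_normD _ _)); apply: ltrD; first by near: n; exact: h1.
apply: (@le_lt_trans _ _ (2^-1 ^+ n)); last by near: n; exact: h2.
have hd s' : `|G s' - g n s'| <= (4 ^ n).+1%:R^-1 by exact: round_down_err.
apply: (le_trans (levy_dist T0 l r n s hd)).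
rewrite ler_pdivrMr ?ltr0n//.
have -> : (2^-1 : R) ^+ n = (2 ^+ n)^-1 by rewrite exprVn.
rewrite mulrC ler_pdivlMr ?exprn_gt0// -exprMn.
have -> : (4 ^ n).+1%:R = 4%:R ^+ n + 1 :> R by rewrite -[LHS]natr1 natrX.
by rewrite -natrM lerDl.
Unshelve. all: by end_near. Qed.

Lemma limit_path_normal_law g M : real_linear g -> 0 <= M ->
  (forall z, `|g z| <= M * sup_norm z) ->
  measurable_fun setT (fun s => g (limit_path s)) ->
  normal_law Q (fun s => g (limit_path s)) (Num.sqrt (limn (qvar ^~ g))).
Proof.
move=> gl M0 gM mg.
apply: (@normal_law_lim R _ S Q regular (fun n s => g (levy G n s)) _ (fun n => Num.sqrt (qvar n g))).
- exact: mg.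
- exact: measurable_regular.
- exact: prob_regular.
- move=> s rs; apply/cvgrPdist_lt => e e0.
  (* [M] may be zero; [M + 1] can be divided by. *)
  have M1 : 0 < M + 1 by rewrite ltr_wpDl.
  have eM : 0 < e / (M + 1) by rewrite divr_gt0.
  have := path_cvgP (levy_cvg rs) eM; apply: filterS => n h.
  rewrite -real_linearB//; apply: (le_lt_trans (gM _)).
  rewrite ltr_pdivlMr// in h; apply: le_lt_trans h.
  by rewrite mulrC ler_wpM2l ?sup_norm_ge0// lerDl.
- by move=> n; exact: levy_normal_law.
- have c : qvar n g @[n --> \oo] --> limn (qvar ^~ g) by exact: (qvar_cvg gl M0 gM).
  by apply: (cvg_comp _ _ c); exact: sqrt_continuous.
Qed.

Lemma walk_limit_path s t e : regular s -> 0 <= t <= T -> 0 < e ->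
  \forall n \near \oo, normc (limit_path s t - (walk T G l r n s t)%:C%C) < e.
Proof.
move=> rs tT e0.
have e20 : 0 < e / 2 by rewrite divr_gt0.
have h1 := path_cvgP (levy_cvg rs) e20.
have [_ h2] := rs.
have c : decay_rate ^+ n @[n --> \oo] --> (0 : R).
  by apply: cvg_expr; rewrite ger0_norm /decay_rate; lra.
have h3 := cvgr_lt _ c _ e20.
near=> n.
rewrite -(subrKA (levy G n s t)) [ltRHS]splitr.
apply: (le_lt_trans (le_normcD (limit_path s t - levy G n s t : Rcomplex R) _)).
apply: ltrD.
  apply: (le_lt_trans (normc_le_sup_norm (limit_path s - levy G n s) t)).
  by near: n; exact: h1.
apply: (le_lt_trans (levy_walk T0 H n s tT)).
apply: (@le_lt_trans _ _ (decay_rate ^+ n)); last by near: n; exact: h3.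
by near: n; exact: h2.
Unshelve. all: by end_near. Qed.

Lemma walk_cvg_Re s t : regular s -> 0 <= t <= T ->
  walk T G l r n s t @[n --> \oo] --> complex.Re (limit_path s t).
Proof.
move=> rs tT; apply/cvgrPdist_lt => e e0.
apply: filterS (walk_limit_path rs tT e0) => n; apply: le_lt_trans.
by have := Re_le_normc (limit_path s t - (walk T G l r n s t)%:C%C); case: (limit_path s t).
Qed.

Lemma limit_path_real s t : complex.Im (limit_path s t) = 0.
Proof.
have [tT|tT] := boolP (t \in `[0, T]); last by rewrite path_out.
have [rs|rs] := boolP (s \in regular); last by rewrite /limit_path (negbTE rs).
apply/eqP; rewrite -normr_le0; apply/ler_addgt0Pl => e e0; rewrite addr0.
have tT' : 0 <= t <= T by move: tT; rewrite in_itv.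
have [n h] := filter_ex (walk_limit_path (set_mem rs) tT' e0).
apply: (le_trans _ (ltW h)).
have := Im_le_normc (limit_path s t - (walk T G l r n s t)%:C%C).
by case: (limit_path s t) => a b; rewrite /= subr0.
Qed.

End limit_path.

(** * Continuous functionals on the path space *)

Section complex_path.
Context {R : realType} (T : R).
Hypothesis T0 : 0 < T.
Notation B := (path_space T).

Lemma dirac_path (z : B) (t : R) : t \in `[0, T] -> cintegral \d_t `[0, T] z = z t.
Proof.
move=> tT; have mI : measurable (`[0, T]%classic : set R) by [].
have key (p : R[i] -> R) : continuous p -> (\int[\d_t]_(x in `[0, T]) p (z x)) = p (z t).
  move=> cp; rewrite /Rintegral integral_dirac//.
    by rewrite diracE mem_set// mul1e.
  apply/measurable_EFinP; apply: subspace_continuous_measurable_fun => //.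
  move=> x; apply: (@continuous_comp (subspace `[0, T]) R[i] R z p); last exact: cp.
  exact: path_continuous.
rewrite /cintegral (key (@complex.Re R)) ?(key (@complex.Im R)).
- by case: (z t).
- exact: continuous_Im.
- exact: continuous_Re.
Qed.

(** Continuity at zero gives a ball on which [f] is at most [1]; every vector
    scales into it. *)
Lemma linear_bound (f : {linear B -> R[i]}) : continuous f ->
  exists2 M : R, 0 <= M & forall z, normc (f z) <= M * sup_norm z.
Proof.
move=> cf.
have /cvgrPdist_lt/(_ _ ltr01) := cf 0.
move=> /nbhs_ballP[_ /gt0_complex[e e0 ->] he].
(* The factor [2] keeps the rescaled vector strictly inside the ball. *)
exists (2 / e); first by rewrite divr_ge0// ltW.
move=> z; have [z0|zn0] := eqVneq (sup_norm z) 0.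
  have -> : z = 0 by apply: sup_norm0_eq0; rewrite z0.
  by rewrite linear0 normc0 mulr_ge0 ?sup_norm_ge0// divr_ge0// ltW.
have zp : 0 < sup_norm z by rewrite lt_def zn0 sup_norm_ge0.
pose a : R := e / (2 * sup_norm z).
have a0 : 0 < a by rewrite divr_gt0// mulr_gt0.
have /he : ball (0 : B) e%:C%C (a%:C%C *: z).
  rewrite -ball_normE /= sub0r normrN path_normE ltcR sup_normZr gtr0_norm//.
  have -> : a * sup_norm z = e / 2 by rewrite /a; field; rewrite ?gt_eqF.
  by rewrite ltr_pdivrMr// ltr_pMr// ltr1n.
rewrite /= linear0 sub0r normrN normE -[1]/(1%:C%C) ltcR linearZ/=.
rewrite (_ : _ *: _ = a%:C%C * f z)// normcM normc_real gtr0_norm// => h.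
have -> : 2 / e * sup_norm z = a^-1 by rewrite /a; field; rewrite ?gt_eqF.
by rewrite -[leRHS]mul1r ler_pdivlMr// mulrC ltW.
Qed.

Lemma continuous_borel_complex (M : normedModType R[i]) (f : M -> R[i]) :
  continuous f -> measurable_fun setT (f : borel M -> borel R[i]).
Proof.
move=> /continuousP cf.
apply: (@measurability _ _ (borel M) (borel R[i]) setT f (@open R[i]) erefl) => _ [U oU <-].
by rewrite setTI; apply: sub_sigma_algebra; exact: cf.
Qed.

Lemma nonexpansive_continuous (M M' : normedModType R[i]) (f : M -> M') :
  (forall x y, `|f x - f y| <= `|x - y|) -> continuous f.
Proof.
move=> fl z; apply/cvgrPdist_lt => e e0.
apply/nbhs_ballP; exists e => //= y.
by rewrite -ball_normE /=; exact: le_lt_trans.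
Qed.

Lemma eval_continuous t : continuous (fun z : B => z t).
Proof.
apply: (@nonexpansive_continuous B R[i]) => y z.
by rewrite normE path_normE lecR; exact: (normc_le_sup_norm (y - z) t).
Qed.

Lemma bounded_real_continuous (g : B -> R) M : real_linear g -> 0 <= M ->
  (forall z, `|g z| <= M * sup_norm z) -> continuous g.
Proof.
move=> gl M0 gM; have M1 : 0 < M + 1 by rewrite ltr_wpDl.
apply: (@lipschitz_real_continuous R B g (M + 1) M1) => u v.
rewrite -real_linearB// path_normE -rmorphM lecR; apply: (le_trans (gM _)).
by rewrite ler_wpM2r ?sup_norm_ge0// lerDl.
Qed.

End complex_path.

(** * Complex Brownian motion *)

Section brownian.
Context {R : realType} (T : R).
Hypothesis T0 : 0 < T.
Notation B := (path_space T).
Context d (S : measurableType d) (Q : probability S R).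
Variables (G : S -> R) (l r : S -> S).
Hypothesis H : splits Q G l r.
Notation limit_path := (limit_path T0 G l r).

Let O : measurableType _ := (S * S)%type.
Let P : probability O R := (Q \x Q)%E.

Let k : R := Num.sqrt (T / 2).
Let k2 : k ^+ 2 = T / 2. Proof. by rewrite sqr_sqrtr// divr_ge0// ltW. Qed.

(** Each of the two independent real paths has variance [(t - u) / T] over
    [[u, t]]; the factor [sqrt (T / 2)] gives the real and imaginary parts
    variance [(t - u) / 2], hence the complex increment variance [t - u]. *)
Definition brownian_field (w : O) : B := k%:C%C *: (limit_path w.1 + 'i%C *: limit_path w.2).

Let Pprod (A A' : set S) : measurable A -> measurable A' ->
  P (fst @^-1` A `&` snd @^-1` A') = (Q A * Q A')%E.
Proof.
move=> mA mA'; rewrite (_ : _ `&` _ = A `*` A') //.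
exact: product_measure1E.
Qed.

Let m1 : measurable_fun setT (fst : O -> S). Proof. exact: measurable_fst. Qed.
Let m2 : measurable_fun setT (snd : O -> S). Proof. exact: measurable_snd. Qed.

Let P1 A : measurable A -> P (fst @^-1` A) = Q A.
Proof.
move=> mA; have := Pprod mA measurableT.
by rewrite preimage_setT setIT probability_setT mule1.
Qed.

Let P2 A : measurable A -> P (snd @^-1` A) = Q A.
Proof.
move=> mA; have := Pprod measurableT mA.
by rewrite preimage_setT setTI probability_setT mul1e.
Qed.

Let normal_law1 X s : normal_law Q X s -> normal_law P (X \o fst) s.
Proof.
move=> [mX XE]; split; first exact: measurableT_comp.
move=> A mA; rewrite -XE//; exact: (P1 (preimage_measurable mX mA)).
Qed.

Let normal_law2 X s : normal_law Q X s -> normal_law P (X \o snd) s.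
Proof.
move=> [mX XE]; split; first exact: measurableT_comp.
move=> A mA; rewrite -XE//; exact: (P2 (preimage_measurable mX mA)).
Qed.

Let normal_law12 X Y s t : normal_law Q X s -> normal_law Q Y t ->
  normal_law P (fun w => X w.1 + Y w.2) (Num.sqrt (s ^+ 2 + t ^+ 2)).
Proof.
move=> Xs Yt; apply: (normal_lawD (normal_law1 Xs) (normal_law2 Yt)) => A C mA mC.
have mXA := preimage_measurable Xs.1 mA; have mYC := preimage_measurable Yt.1 mC.
by rewrite [RHS](_ : _ = Q (X @^-1` A) * Q (Y @^-1` C))%E;
  [exact: (Pprod mXA mYC)|congr (_ * _)%E; [exact: (P1 mXA)|exact: (P2 mYC)]].
Qed.

Lemma measurable_limit_path : measurable_fun setT (limit_path : S -> borel B).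
Proof.
have [X [dX cX]] := limit_path_discrete T0 H.
by apply: (measurable_lim_discrete (Xn := X)) => // n A; exact: discrete_measurable.
Qed.

Lemma measurable_brownian_field : measurable_fun setT (brownian_field : O -> borel B).
Proof.
have [X [dX cX]] := limit_path_discrete T0 H.
apply: (measurable_lim_discrete
    (Xn := fun n w => k%:C%C *: (X n w.1 + 'i%C *: X n w.2))) => [n A|w].
  apply: discrete_measurable.
  have dp := discrete_pair (discrete_precomp m1 (dX n)) (discrete_precomp m2 (dX n)).
  exact: (discrete_comp (fun p : B * B => k%:C%C *: (p.1 + 'i%C *: p.2)) dp).
by apply: cvgZr; apply: cvgD; [exact: cX|apply: cvgZr; exact: cX].
Qed.

(** A real combination of the parts of [f (brownian_field w)] is a real linear
    functional of the first path plus one of the second, and the two are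
    independent normal variables. *)
Lemma brownian_field_gaussian : gaussian_field P brownian_field.
Proof.
split; first exact: measurable_brownian_field.
move=> f cf; split.
  exact: (measurableT_comp (continuous_borel_complex cf) measurable_brownian_field).
move=> a b.
have [M M0 fM] := linear_bound cf.
pose g z := a * complex.Re (f z) + b * complex.Im (f z).
have fZ (c : R[i]) z : f (c *: z) = c * f z by rewrite linearZ.
have gl : real_linear g.
  split=> [u v|c u]; rewrite /g.
    by rewrite linearD; case: (f u) (f v) => x y [x' y'] /=; ring.
  by rewrite fZ; case: (f u) => x y /=; ring.
pose N := (`|a| + `|b|) * M.
have N0 : 0 <= N by rewrite mulr_ge0// addr_ge0.
have gN z : `|g z| <= N * sup_norm z.
  rewrite /N -mulrA mulrDl; apply: (le_trans (ler_normD _ _)).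
  rewrite !normrM; apply: lerD; apply: ler_wpM2l => //; apply: le_trans (fM z).
    exact: Re_le_normc.
  exact: Im_le_normc.
have law (c : R[i]) : normal_law Q (fun s => g (c *: limit_path s))
    (Num.sqrt (limn (qvar T0 ^~ (fun z => g (c *: z))))).
  pose gc z := g (c *: z).
  have gcl : real_linear gc.
    split=> [u v|e u]; rewrite /gc; first by rewrite scalerDr gl.1.
    by rewrite scalerA mulrC -scalerA gl.2.
  have Nc0 : 0 <= N * normc c by rewrite mulr_ge0// normc_ge0.
  have gcN z : `|gc z| <= (N * normc c) * sup_norm z.
    apply: (le_trans (gN _)); rewrite -mulrA ler_wpM2l//.
    by rewrite -lecR sup_normZ normE -rmorphM.
  have cg := bounded_real_continuous gcl Nc0 gcN.
  have mg := measurableT_comp (continuous_borel_measurable cg) measurable_limit_path.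
  exact: (limit_path_normal_law H gcl Nc0 gcN mg).
have := normal_law_gaussian (normal_law12 (law k%:C%C) (law (k%:C%C * 'i%C))).
congr (gaussian _ _); apply/funext => w.
by rewrite -/(g (brownian_field w)) /brownian_field scalerDr gl.1 scalerA.
Qed.

Definition dirac_process (t : R) (w : O) : R[i] := cintegral \d_t `[0, T] (brownian_field w).
Notation W := dirac_process.
Let b t s := complex.Re (limit_path s t).

Lemma brownian_fieldE t w : brownian_field w t = (k * b t w.1 +i* (k * b t w.2))%C.
Proof.
rewrite path_scaleE path_addE path_scaleE /b.
have := limit_path_real T0 H w.1 t; have := limit_path_real T0 H w.2 t.
case: (limit_path w.1 t) => x y; case: (limit_path w.2 t) => x' y' /= -> ->.
by apply/eqP; rewrite eq_complex /=; apply/andP; split; apply/eqP; ring.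
Qed.

Lemma measurable_b t : measurable_fun setT (b t).
Proof.
apply: (measurableT_comp (continuous_borel_measurable (@continuous_Re R))).
exact: (measurableT_comp (continuous_borel_complex (@eval_continuous R T t)) measurable_limit_path).
Qed.

Lemma b_indep n (t : nat -> R) : 0 <= t 0%N -> t n <= T ->
  (forall i, (i < n)%N -> t i <= t i.+1) ->
  joint_law Q (fun (i : 'I_n) s => b (t i.+1) s - b (t i) s)
            Q (fun (i : 'I_n) s => b (t i.+1) s - b (t i) s).
Proof.
move=> t0 tn ti.
have tle i j : (i <= j)%N -> (j <= n)%N -> t i <= t j.
  elim: j => [|j IHj]; first by rewrite leqn0 => /eqP ->.
  rewrite leq_eqVlt => /orP[/eqP ->//|]; rewrite ltnS => ij jN.
  by apply: (le_trans (IHj ij (ltnW jN))); exact: ti.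
have tT i : (i <= n)%N -> 0 <= t i <= T.
  move=> iN; rewrite (le_trans t0) ?tle//= (le_trans _ tn)// tle//.
pose x m (i : 'I_n) s := walk T G l r m s (t i.+1) - walk T G l r m s (t i).
have mx m i : measurable_fun setT (x m i).
  by apply: measurable_funB; exact: (measurable_walk T H).
have mb (i : 'I_n) : measurable_fun setT (fun s => b (t i.+1) s - b (t i) s).
  by apply: measurable_funB; exact: measurable_b.
have mreg := measurable_regular H; have preg := prob_regular H.
have cx s (i : 'I_n) : regular G l r s ->
    x m i s @[m --> \oo] --> b (t i.+1) s - b (t i) s.
  move=> rs; apply: cvgB; apply: (@walk_cvg_Re R T T0 _ S Q G l r H s _ rs); apply: tT => //.
  exact: ltnW.
apply: (joint_law_lim mb mb mx mx mreg mreg preg preg cx cx) => m.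
exact: (@walk_indep R T _ S Q G l r H m n t ti).
Qed.

Lemma b_normal_law u t : 0 <= u -> u <= t -> t <= T ->
  normal_law Q (fun s => b t s - b u s) (Num.sqrt ((t - u) / T)).
Proof.
move=> u0 ut tT.
have uI : 0 <= u <= T by rewrite u0 (le_trans ut).
have tI : 0 <= t <= T by rewrite (le_trans u0).
apply: (@normal_law_lim R _ S Q (regular G l r)
   (fun n s => walk T G l r n s t - walk T G l r n s u) _
   (fun n => Num.sqrt (clock T n t - clock T n u))).
- by apply: measurable_funB; exact: measurable_b.
- exact: (measurable_regular H).
- exact: (prob_regular H).
- by move=> s rs; apply: cvgB; exact: (@walk_cvg_Re R T T0 _ S Q G l r H s _ rs).
- by move=> n; have [] := walk_normal_law T H n ut.
- have c : clock T n t - clock T n u @[n --> \oo] --> (t - u) / T.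
    by rewrite mulrBl; apply: cvgB; exact: cvg_clock.
  by apply: (cvg_comp _ _ c); exact: sqrt_continuous.
Qed.

Lemma W_E t w : t \in `[0, T] -> W t w = (k * b t w.1 +i* (k * b t w.2))%C.
Proof. by move=> tT; rewrite /dirac_process dirac_path// brownian_fieldE. Qed.

Let incE u t w : u \in `[0, T] -> t \in `[0, T] ->
  W t w - W u w = (k * (b t w.1 - b u w.1) +i* (k * (b t w.2 - b u w.2)))%C.
Proof.
move=> uT tT; rewrite !W_E//.
by apply/eqP; rewrite eq_complex /=; apply/andP; split; apply/eqP; ring.
Qed.

Lemma W_independent : independent_increments P T W.
Proof.
move=> n t t0 tn ti.
have tle i j : (i <= j)%N -> (j <= n)%N -> t i <= t j.
  elim: j => [|j IHj]; first by rewrite leqn0 => /eqP ->.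
  rewrite leq_eqVlt => /orP[/eqP ->//|]; rewrite ltnS => ij jN.
  by apply: (le_trans (IHj ij (ltnW jN))); exact: ti.
have tT i : (i <= n)%N -> t i \in `[0, T].
  by move=> iN; rewrite in_itv/= (le_trans t0) ?tle//= (le_trans _ tn)// tle.
pose x (i : 'I_n) s := b (t i.+1) s - b (t i) s.
have jx : joint_law Q x Q x by exact: b_indep.
have mx i : measurable_fun setT (x i) by apply: measurable_funB; exact: measurable_b.
have mx1 i : measurable_fun setT (x i \o (fst : O -> S)) by exact: measurableT_comp.
have mx2 i : measurable_fun setT (x i \o (snd : O -> S)) by exact: measurableT_comp.
pose h (z : R * R) : borel R[i] := (k * z.1 +i* (k * z.2))%C.
have mh : measurable_fun setT h.
  by apply: measurable_complex; apply: measurable_funM.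
pose XY (i : 'I_n) (w : O) := ((x i \o fst) w, (x i \o snd) w).
have mcap (C : 'I_n -> set R) : (forall i, measurable (C i)) ->
    measurable (\bigcap_(i in [set: 'I_n]) x i @^-1` C i).
  exact: bigcap_preimage_measurable.
have jXY : joint_law P XY P XY.
  apply: joint_law_pair => // A C mA mC.
  transitivity (P (fst @^-1` (\bigcap_(i in [set: 'I_n]) x i @^-1` A i) `&`
      snd @^-1` (\bigcap_(i in [set: 'I_n]) x i @^-1` C i))).
    congr (P _); apply/seteqP; split => [w hw|w [h1 h2] i _].
      by split => i _; have [] := hw i Logic.I.
    by split; [exact: (h1 i Logic.I)|exact: (h2 i Logic.I)].
  rewrite (Pprod (mcap A mA) (mcap C mC)) jx// jx// -big_split/=.
  apply: eq_bigr => i _; congr (_ * _)%E; apply/esym.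
    exact: (P1 (preimage_measurable (mx i) (mA i))).
  exact: (P2 (preimage_measurable (mx i) (mC i))).
have := joint_law_comp mh jXY.
rewrite (_ : (fun i : 'I_n => h \o XY i) = (fun (i : 'I_n) w => W (t i.+1) w - W (t i) w))//.
apply/funext => i; apply/funext => w; rewrite incE//; apply: tT => //.
exact: ltnW.
Qed.

(** With [x], [y] the parts of the increment, independent and of the same centred
    normal law, [E (x ^ 2 - y ^ 2) = 0]; the mixed moment [2 E (x y)] is the
    variance of [x + y] minus the two variances, which is zero as well. *)
Lemma W_increment u t : 0 <= u -> u < t -> t <= T ->
  proper_complex_gaussian P (fun w => W t w - W u w) (t - u).
Proof.
move=> u0 ut tT.
have uI : u \in `[0, T] by rewrite in_itv/= u0 (le_trans (ltW ut)).
have tI : t \in `[0, T] by rewrite in_itv/= tT (le_trans u0 (ltW ut)).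
pose x s := k * (b t s - b u s).
pose sg := k * Num.sqrt ((t - u) / T).
have xs : normal_law Q x sg by apply: normal_lawZ; apply: b_normal_law => //; exact: ltW.
have sg2 : sg ^+ 2 = (t - u) / 2.
  rewrite exprMn k2 sqr_sqrtr; first by field; rewrite gt_eqF.
  by rewrite divr_ge0 ?(ltW T0)// subr_ge0 ltW.
have -> : (fun w => W t w - W u w) = (fun w : O => (x w.1 +i* x w.2)%C).
  by apply/funext => w; rewrite (incE w uI tI).
have x1 := normal_law1 xs; have x2 := normal_law2 xs; have x12 := normal_law12 xs xs.
have i1 := normal_law_integrable_sqr x1; have i2 := normal_law_integrable_sqr x2.
have i12 := normal_law_integrable_sqr x12.
have E1 : \int[P]_w (x w.1 ^+ 2) = (t - u) / 2 by rewrite /Rintegral (normal_law_sqr x1)/= sg2.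
have E2 : \int[P]_w (x w.2 ^+ 2) = (t - u) / 2 by rewrite /Rintegral (normal_law_sqr x2)/= sg2.
have E12 : \int[P]_w ((x w.1 + x w.2) ^+ 2) = t - u.
  rewrite /Rintegral (normal_law_sqr x12)/= sqr_sqrtr ?addr_ge0 ?sqr_ge0// sg2.
  by field.
split.
- split; first by apply: measurable_complex; [exact: x1.1|exact: x2.1].
  move=> a c; have := normal_law_gaussian (normal_law12 (normal_lawZ a xs) (normal_lawZ c xs)).
  exact.
- rewrite /cexpectation /cintegral /= /Rintegral.
  by rewrite (normal_law_mean x1) (normal_law_mean x2).
- rewrite /cexpectation /cintegral.
  rewrite [X in (X +i* _)%C](_ : _ = 0); last first.
    transitivity (\int[P]_w (x w.1 ^+ 2 - x w.2 ^+ 2)).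
      by congr fine; apply: eq_integral => w _ /=; rewrite !expr2.
    by rewrite RintegralB// E1 E2 subrr.
  rewrite [X in (_ +i* X)%C](_ : _ = 0)//.
  transitivity (\int[P]_w ((x w.1 + x w.2) ^+ 2 - (x w.1 ^+ 2 + x w.2 ^+ 2))).
    by congr fine; apply: eq_integral => w _ /=; congr EFin; ring.
  rewrite RintegralB//; last exact: (integrableD measurableT i1 i2).
  by rewrite RintegralD// E1 E2 E12; field.
- rewrite /cexpectation /cintegral.
  have nE w : `|(x w.1 +i* x w.2)%C| ^+ 2 = (x w.1 ^+ 2 + x w.2 ^+ 2)%:C%C.
    rewrite normE -rmorphXn; congr (_%:C)%C.
    by rewrite /= sqr_sqrtr// addr_ge0// sqr_ge0.
  rewrite [X in (X +i* _)%C](_ : _ = t - u); last first.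
    transitivity (\int[P]_w (x w.1 ^+ 2 + x w.2 ^+ 2)).
      by congr fine; apply: eq_integral => w _; rewrite nE.
    by rewrite RintegralD// E1 E2; field.
  rewrite [X in (_ +i* X)%C](_ : _ = 0)//.
  transitivity (\int[P]_w (0 : R)).
    by congr fine; apply: eq_integral => w _; rewrite nE.
  by rewrite /Rintegral integral0.
Qed.

Lemma W_brownian : complex_brownian_motion P T W.
Proof.
split.
- move=> t tT; rewrite (_ : W t = (fun w => brownian_field w t)).
    exact: (measurableT_comp (continuous_borel_complex (@eval_continuous R T t)) measurable_brownian_field).
  by apply/funext => w; rewrite /dirac_process dirac_path.
- apply: aeW => w; split.
    apply: (@subspace_eq_continuous _ _ _ (brownian_field w)); last exact: path_continuous.
    have E (t : R) : t \in `[0, T] -> brownian_field w t = dirac_process t w.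
      by move=> tT; rewrite /dirac_process dirac_path.
    by move=> t /set_mem; exact: E.
  by rewrite /dirac_process dirac_path ?path0// in_itv/= lexx ltW.
- exact: W_independent.
- exact: W_increment.
Qed.

End brownian.

Theorem proposition5p2 (R : realType) (T : R) (hT : 0 < T) :
  exists (d : measure_display) (Omega : measurableType d)
    (P : probability Omega R) (Z : Omega -> path_space T),
    gaussian_field P Z /\
    complex_brownian_motion P T
      (fun (t : R) (w : Omega) => cintegral \d_t `[0, T] (Z w)).
Proof.
have [d [S [Q [G [l [r H]]]]]] := @splits_exists R.
exists _, (S * S)%type, (Q \x Q)%E, (brownian_field hT G l r); split.
  exact: brownian_field_gaussian.
exact: W_brownian.
Qed.
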